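(* Let $\tilde X_1,\dots,\tilde X_d$ be as in the context. There are a neighborhood $V$ of the origin in $G_{d,m}$, a neighborhood $\tilde U$ of the origin in $\mathbb R^N$, a neighborhood $T$ of the origin in $\mathbb R^q$ and a family of smooth maps $\Theta_y:\tilde U\times\tilde U\to V$, $y\in T$, such that: (a) $\Theta_y(\tilde x_1,\tilde x)=\Theta_y(\tilde x,\tilde x_1)^{-1}$ (inverse in the group $G_{d,m}$); in particular $\Theta_y(\tilde x,\tilde x)=0$ (the identity element); (b) for every fixed $(\tilde x,y)\in\tilde U\times T$, the map $\Theta_{(\tilde x,y)}:\tilde x_1\mapsto\Theta_y(\tilde x,\tilde x_1)$ is a diffeomorphism of a neighborhood of $\tilde x$ onto a neighborhood of the origin in $G_{d,m}$; (c) for every $\tilde x\in\tilde U$, $y\in T$ and $j=1,\dots,d$, $(\Theta_{(\tilde x,y)})_*\tilde X_{j,y}=Y_j+R_{j,y}$, where the vector field $R_{j,y}$ has local degree $\le0$.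
   Context: Let $\mathfrak g_{d,m}$ be the free nilpotent Lie algebra of step $m$ on $d$ generators, $N=\dim\mathfrak g_{d,m}$, and $G_{d,m}$ the connected simply connected Lie group with Lie algebra $\mathfrak g_{d,m}$; $Y_1,\dots,Y_d$ are the generators, identified with left-invariant vector fields. $\mathfrak g_{d,m}=\bigoplus_{j=1}^mV^j$ is graded, $V^j$ spanned by basic commutators $Y_{[I]}=\operatorname{ad}Y_{i_1}\cdots\operatorname{ad}Y_{i_{j-1}}Y_{i_j}$ with $|I|=j$. Put $Y_{j1}=Y_j$, and for $k\ge2$ choose tuples $I_{1k},I_{2k},\dots$ of length $k$ such that $Y_{jk}=Y_{[I_{jk}]}$ form a basis of $V^k$. Exponential coordinates: $(u_{jk})\in\mathbb R^N\leftrightarrow\exp(\sum u_{jk}Y_{jk})\in G_{d,m}$; the origin $0$ is the identity. Dilations $\delta_t$ act by $u_{jk}\mapsto t^ku_{jk}$. A function $f$ is homogeneous of degree $\lambda$ if $f\circ\delta_t=t^\lambda f$; a differential operator $D$ is homogeneous of degree $\lambda$ if $D(f\circ\delta_t)=t^\lambda(Df)\circ\delta_t$; if $f$ is homogeneous of degree $i$, $fY_{jk}$ is homogeneous of degree $k-i$. A vector field $X=\sum a_{jk}Y_{jk}$ near $0$ has local degree $\le\lambda$ if, after expanding each $a_{jk}$ in Taylor series at $0$ in the coordinates $u_{jk}$, every resulting homogeneous term is a homogeneous differential operator of degree $\le\lambda$. Setting: $\tilde X_1,\dots,\tilde X_d$ are smooth vector fields on $\tilde U_0\times T_0$, $\tilde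 U_0\subset\mathbb R^N$, $T_0\subset\mathbb R^q$ open neighborhoods of the origin, with no $\partial/\partial y$ components, so each is a smooth family $\{\tilde X_{j,y}\}$ of vector fields on $\tilde U_0$; at every point they are free of order $m$ (the values of their basic commutators of order $\le m$ span a space of dimension $N$) and these values span $\mathbb R^N$. *)

(* Defs.v *)
From HB Require Import structures.
From mathcomp Require Import all_boot all_order all_algebra.
From mathcomp Require Import all_classical all_reals all_analysis.
Set Implicit Arguments. Unset Strict Implicit. Unset Printing Implicit Defensive.
Import Order.TTheory GRing.Theory Num.Theory.
Import numFieldNormedType.Exports.
Local Open Scope classical_set_scope.
Local Open Scope ring_scope.

Section Defs.
Variable R : realType.

Fixpoint iderive {V W : normedModType R} (vs : seq V) (f : V -> W) : V -> W :=
  if vs is v :: vs' then (fun x => 'D_v (iderive vs' f) x) else f.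

Definition smooth_on {V W : normedModType R} (A : set V) (f : V -> W) : Prop :=
  forall vs : seq V,
    (forall x, A x -> {for x, continuous (iderive vs f)}) /\
    (forall v x, A x -> derivable (iderive vs f) x v).

(* [A,B] = AB - BA as first order operators; in coordinates DB.A - DA.B *)
Definition vbr {N : nat} (A B : 'rV[R]_N -> 'rV[R]_N) : 'rV[R]_N -> 'rV[R]_N :=
  fun x => 'D_(A x) B x - 'D_(B x) A x.

Fixpoint brX {d N : nat} (F : 'I_d -> 'rV[R]_N -> 'rV[R]_N) (I : seq 'I_d)
  : 'rV[R]_N -> 'rV[R]_N :=
  match I with
  | [::] => fun _ => 0
  | [:: i] => F i
  | i :: I' => vbr (F i) (brX F I')
  end.

Definition comm_span_all {d N : nat} (m : nat) (F : 'I_d -> 'rV[R]_N -> 'rV[R]_N)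
  (x : 'rV[R]_N) : Prop :=
  forall v : 'rV[R]_N, exists s : seq (seq 'I_d * R),
    all (fun p => (0 < size p.1 <= m)%N) s /\
    v = \sum_(p <- s) p.2 *: brX F p.1 x.

(* ---------- the free nilpotent Lie algebra g_{d,m} ----------
   realized as the Lie elements of the free associative algebra on d
   letters truncated at degree m: elements are functions words -> R. *)
Definition tens (d : nat) := seq 'I_d -> R.

Definition tzero d : tens d := fun _ => 0.
Definition tone d : tens d := fun w => if w == [::] then 1 else 0.
Definition tadd d (a b : tens d) : tens d := fun w => a w + b w.
Definition tscale d (c : R) (a : tens d) : tens d := fun w => c * a w.
Definition tmul d (m : nat) (a b : tens d) : tens d := fun w =>
  if (size w <= m)%N then \sum_(i < (size w).+1) a (take i w) * b (drop i w)
  else 0.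
Definition tbr d m (a b : tens d) : tens d :=
  tadd (tmul m a b) (tscale (-1) (tmul m b a)).
Definition tgen d (j : 'I_d) : tens d := fun w => if w == [:: j] then 1 else 0.
Definition tpow d m (a : tens d) (n : nat) : tens d := iter n (tmul m a) (@tone d).
Definition texp d m (a : tens d) : tens d := fun w =>
  \sum_(n < m.+1) (n`!%:R)^-1 * tpow m a n w.
Definition tlog d m (b : tens d) : tens d :=
  let c := tadd b (tscale (-1) (@tone d)) in
  fun w => \sum_(n < m) ((-1) ^+ n / (n.+1)%:R) * tpow m c n.+1 w.

Fixpoint brY d m (I : seq 'I_d) : tens d :=
  match I with
  | [::] => @tzero d
  | [:: i] => tgen i
  | i :: I' => tbr m (tgen i) (brY m I')
  end.

Definition graded_basis d m N (Is : 'I_N -> seq 'I_d) : Prop :=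
  (forall i, (0 < size (Is i) <= m)%N) /\
  (forall k (c : 'I_N -> R),
     (forall w, \sum_(i < N | size (Is i) == k) c i * brY m (Is i) w = 0) ->
     forall i, size (Is i) == k -> c i = 0) /\
  (forall J : seq 'I_d, (0 < size J <= m)%N -> exists c : 'I_N -> R,
     forall w, brY m J w = \sum_(i < N | size (Is i) == size J) c i * brY m (Is i) w).

(* exponential coordinates: u <-> exp(sum_i u_i Y_i) *)
Definition Lie_of d m N (Is : 'I_N -> seq 'I_d) (u : 'rV[R]_N) : tens d :=
  fun w => \sum_(i < N) u ord0 i * brY m (Is i) w.
Definition coords d m N (Is : 'I_N -> seq 'I_d) (a : tens d) : 'rV[R]_N :=
  xget 0 (fun u => Lie_of m Is u = a).

(* group inverse of G_{d,m} in exponential coordinates: exp(X)^-1 = exp(-X) *)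
Definition ginv N (u : 'rV[R]_N) : 'rV[R]_N := - u.

(* left-invariant vector field on G_{d,m} (exponential coordinates) with
   value b at the identity: u |-> d/dt|_{t=0} (u . exp(t b)). *)
Definition Yfield d m N (Is : 'I_N -> seq 'I_d) (b : tens d) (u : 'rV[R]_N)
  : 'rV[R]_N :=
  coords m Is (fun w =>
    derive1 (fun t : R => tlog m (tmul m (texp m (Lie_of m Is u))
                                         (texp m (tscale t b))) w) 0).

Definition unitv N (l : 'I_N) : 'rV[R]_N := \row_(k < N) (k == l)%:R.
Definition wdeg d N (Is : 'I_N -> seq 'I_d) (s : seq 'I_N) : nat :=
  \sum_(l <- s) size (Is l).

(* Z = sum_i a_i Y_i near 0 and each Taylor term (at 0, in the coordinates u)
   f Y_i of a_i, f homogeneous of degree wdeg s, has degree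
   size (Is i) - wdeg s <= lam. *)
Definition local_degree_le d m N (Is : 'I_N -> seq 'I_d) (lam : int)
  (Z : 'rV[R]_N -> 'rV[R]_N) : Prop :=
  exists (U : set 'rV[R]_N) (a : 'I_N -> 'rV[R]_N -> R^o),
    [/\ open U, U 0,
        (forall i, smooth_on U (a i)),
        (forall p, U p -> Z p = \sum_(i < N) a i p *: Yfield m Is (brY m (Is i)) p) &
        (forall i (s : seq 'I_N),
           iderive (map (@unitv N) s) (a i) 0 != 0 ->
           ((size (Is i))%:Z - (wdeg Is s)%:Z <= lam)%R)].

End Defs.

(* Main.v *)
(* Smoothness is only required for fixed y, so y is a mere parameter. Let B(x) be the commutator
   frame at x and let u.B be the vector field with constant coordinates u in it. Instead of
   inverting the flow exp(u.B), it is enough to have a smooth map Theta whose jet of order m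
   agrees with the canonical coordinates, i.e. (u.B)^n Theta(x, -) (x) = u for n = 1 and 0 for the
   other n <= m. Such a map is obtained from (x1 - x) B(x)^-1 by successive polynomial corrections.
   Replacing it by (Theta(x, x1) - Theta(x1, x)) / 2 keeps the jets, because u.B acting on the
   first and on the second variable commute and their sum is differentiation along the diagonal,
   where the jets are constant. This gives (a), and (b) follows from the inverse function theorem.

   For (c), words in the fields X_j act as differential operators, and the jet condition
   identifies the Taylor polynomial at 0 of X_j Theta, in the coordinates Theta, with the value at
   x of exp(L(u)) b_j acting on Theta, where L(u) is the element of the free algebra with
   coordinates u. The formula for the differential of exp shows that, modulo tensors of degree
   > m, exp(L(u)) b_j is the directional derivative of exp at L(u) along Y_j(u), and this acts on
   Theta as Y_j(u). By homogeneity the remaining tensors have coefficients of weight >= m in u,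
   and the fields Y_i have degree at most m. *)
Require Import Defs.
From HB Require Import structures.
From mathcomp Require Import all_boot all_order all_algebra.
From mathcomp Require Import all_classical all_reals all_analysis.
From mathcomp Require Import ring lra zify.
Set Implicit Arguments. Unset Strict Implicit. Unset Printing Implicit Defensive.
Import Order.TTheory GRing.Theory Num.Theory.
Import numFieldNormedType.Exports.
Local Open Scope classical_set_scope.
Local Open Scope ring_scope.

(** * Smooth functions, composition and the inverse function theorem *)

(** The fields X_j need not generate a nilpotent algebra, so tensors of degree > m may act on
    functions as nonzero operators and cannot be dropped. This is why the free algebra below is
    untruncated and why the remainder is an explicit series, whose weight is read off from
    dilations. Jets of finite order suffice because a Taylor term of the coefficient of Y_i has
    positive degree only if its weight is below [size (Is i)], hence below m, while every coordinate
    has weight at least 1. The remainder gets the same bound, weight >= m, in all its coordinate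
    components. Such a bound survives multiplication by smooth functions, so passing from the
    coordinate frame to the frame of the Y_i is harmless. The fields Y_j, defined by differentiating
    log(exp(u) exp(t b)), become explicit as the power series x / (1 - e^(-x)) in ad u applied to b.
    It is the inverse of the series in the differential of exp, and this makes exp(L(u)) b_j a
    directional derivative of exp. *)

Section DirectionalDerivatives.
Variable R : realType.

(** The two difference quotients are the same function of [h], so derivative and derivability
    transfer without any regularity of [f]. Lines, slices, the diagonal and diagonal scalings are
    all treated this way. *)
Lemma derive_along (V V' W : normedModType R) (f : V' -> W) (phi : V -> V')
    (a w : V) (w' : V') :
  (forall h : R, phi (h *: w + a) = h *: w' + phi a) ->
  'D_w (fun x => f (phi x)) a = 'D_w' f (phi a) /\
  (derivable (fun x => f (phi x)) a w <-> derivable f (phi a) w').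
Proof.
move=> H.
have E : (fun h : R => h^-1 *: (((fun x => f (phi x)) \o shift a) (h *: w) - f (phi a)))
       = (fun h : R => h^-1 *: ((f \o shift (phi a)) (h *: w') - f (phi a))).
  by apply/funext => h /=; rewrite H.
by rewrite /derive /derivable E.
Qed.

Lemma derive_line (V W : normedModType R) (f : V -> W) (p v : V) (t : R) :
  'D_1 (fun s : R => f (p + s *: v)) t = 'D_v f (p + t *: v) /\
  (derivable (fun s : R => f (p + s *: v)) t 1 <-> derivable f (p + t *: v) v).
Proof.
apply: (@derive_along _ _ _ f (fun s : R => p + s *: v)) => h.
by rewrite scalerDl addrCA [h *: 1]mulr1.
Qed.

(** Derivability is assumed in one direction only, so homogeneity is obtained on the line through
    [p], where derivability is differentiability. *)
Lemma derive_dirZ (V W : normedModType R) (f : V -> W) (p v : V) (c : R) :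
  derivable f p v ->
  derivable f p (c *: v) /\ 'D_(c *: v) f p = c *: 'D_v f p.
Proof.
move=> df.
have [E1 D1] := @derive_line V W f p v 0.
rewrite scale0r addr0 in E1 D1.
have /D1 /derivable1_diffP dg := df.
have [Ec Dc] : 'D_c (fun s : R => f (p + s *: v)) 0 = 'D_(c *: v) f (p + 0 *: v) /\
  (derivable (fun s : R => f (p + s *: v)) 0 c <-> derivable f (p + 0 *: v) (c *: v)).
  apply: (@derive_along _ _ _ f (fun s : R => p + s *: v)) => h.
  by rewrite scalerDl scale0r addrCA !addr0 scalerA.
rewrite scale0r addr0 in Ec Dc.
split; first by apply/Dc; exact: diff_derivable.
rewrite -Ec -E1 (deriveE c dg) (deriveE (1:R) dg).
by rewrite -{1}[c](@mulr1 R); exact: linearZ.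
Qed.

Lemma line_MVT (V : normedModType R) (f : V -> R) (p v : V) :
  (forall t : R, 0 <= t <= 1 -> derivable f (p + t *: v) v) ->
  exists2 t : R, 0 <= t <= 1 & f (p + v) - f p = 'D_v f (p + t *: v).
Proof.
move=> df.
have [] := @MVT_segment R (fun s : R => f (p + s *: v))
  (fun s => 'D_v f (p + s *: v)) 0 1 ler01.
- move=> x; rewrite in_itv /= => /andP[/ltW x0 /ltW x1].
  have [E D] := @derive_line V _ f p v x.
  by split; [apply/D/df; rewrite x0|].
- apply: derivable_within_continuous => x.
  rewrite in_itv /= => x01.
  by have [_ D] := @derive_line V _ f p v x; apply/D/df.
move=> c; rewrite in_itv /= => c01; rewrite scale1r scale0r addr0 subr0 mulr1 => ->.
by exists c.
Qed.

End DirectionalDerivatives.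

(** * Smooth real-valued functions and their closure properties *)

Section Smooth.
Variable R : realType.

Section General.
Variable V : normedModType R.

(** Frechet differentiability is built into the recursion, so that the chain rule and linearity in
    the direction are available at every order. [smooth_on] speaks of directional derivatives only;
    [smooth_on_smooth] and [smooth_smooth_on] relate the two. *)
Fixpoint Ck (n : nat) (A : set V) (f : V -> R) : Prop :=
  match n with
  | 0 => forall x, A x -> {for x, continuous f}
  | n'.+1 => (forall x, A x -> differentiable f x) /\ forall v, Ck n' A ('D_v f)
  end.

Definition smooth (A : set V) (f : V -> R) := forall n, Ck n A f.
Implicit Types (A B : set V) (f g : V -> R).

Lemma near_open A x (P : V -> Prop) : open A -> A x -> (forall y, A y -> P y) ->
  \forall y \near x, P y.
Proof.
move=> oA Ax AP; have : nbhs x A by apply: open_nbhs_nbhs.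
by apply: filterS.
Qed.

Lemma continuous_near_eq (W : normedModType R) (f g : V -> W) x :
  (\forall y \near x, f y = g y) -> {for x, continuous f} -> {for x, continuous g}.
Proof.
move=> fg cf; have E := nbhs_singleton fg.
have cf' : f @ x --> f x by exact: cf.
have : g @ x --> g x; last by [].
rewrite -E; apply: cvg_trans cf'; apply: near_eq_cvg.
exact: fg.
Qed.

Lemma differentiable_eps (W : normedModType R) (f : V -> W) x :
  differentiable f x -> forall e : R, 0 < e ->
  \forall h \near 0, `|f (h + x) - f x - 'd f x h| <= e * `|h|.
Proof.
move=> /diff_locallyP [_ /eqaddoP H] e e0.
apply: filterS (H _ e0) => h /=.
rewrite -![(_ + _ : _ -> _) _]/(_ + _) -![(- _ : _ -> _) _]/(- _) /= opprD addrA.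
by [].
Qed.

Lemma eps_differentiable (W : normedModType R) (f : V -> W) x (df : {linear V -> W}) :
  continuous df ->
  (forall e : R, 0 < e ->
    \forall h \near 0, `|f (h + x) - f x - df h| <= e * `|h|) ->
  differentiable f x /\ forall v, 'D_v f x = df v.
Proof.
move=> cdf H.
have E : f \o shift x = cst (f x) + df +o_ (0 : V) id.
  apply/eqaddoP => e e0; apply: filterS (H e e0) => h /=.
  by rewrite -![(_ + _ : _ -> _) _]/(_ + _) -![(- _ : _ -> _) _]/(- _) /= opprD addrA.
have D := diff_unique cdf E.
have D' : differentiable f x by apply/diff_locallyP; rewrite D.
by split=> // v; rewrite deriveE // D.
Qed.

Lemma near_translate (P : V -> Prop) x :
  (\forall y \near x, P y) -> \forall h \near 0, P (h + x).
Proof.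
move=> nP; have c : {for 0, continuous (fun h : V => h + x)}.
  by apply: cvgD; [exact: cvg_id|exact: cvg_cst].
by apply: (c [set y | P y]); rewrite /= add0r.
Qed.

Lemma differentiable_near_eq (W : normedModType R) (f g : V -> W) x :
  (\forall y \near x, f y = g y) -> differentiable f x -> differentiable g x.
Proof.
move=> fg df.
have gfx := nbhs_singleton fg.
have nfg := near_translate fg.
have := diff_locallyP x f; case=> /(_ df) [cdf _] _.
apply: (eps_differentiable cdf _).1 => e e0.
have := differentiable_eps df e0; apply: filterS2 nfg => h <-.
by rewrite gfx.
Qed.

End General.
End Smooth.

Section SmoothClosure.
Variable R : realType.
Variable V : normedModType R.
Implicit Types (A B : set V) (f g : V -> R).

Lemma open_derive_eq A f g : open A -> (forall x, A x -> f x = g x) ->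
  forall v x, A x -> 'D_v f x = 'D_v g x.
Proof. by move=> oA fg v x Ax; apply: near_eq_derive; exact: near_open oA Ax fg. Qed.

Lemma Ck_eq n A f g : open A -> (forall x, A x -> f x = g x) ->
  Ck n A f -> Ck n A g.
Proof.
move=> oA; elim: n f g => [|n IH] f g fg /=.
  move=> H x Ax; apply: continuous_near_eq (H x Ax); exact: near_open oA Ax fg.
move=> [df Df]; split=> [x Ax|v].
  by apply: differentiable_near_eq (df x Ax); exact: near_open oA Ax fg.
by apply: IH (Df v); exact: open_derive_eq.
Qed.

Lemma Ck_sub n A B f : A `<=` B -> Ck n B f -> Ck n A f.
Proof.
move=> AB; elim: n f => [|n IH] f /= => [H x /AB|[df Df]]; first exact: H.
by split=> [x /AB|v]; [exact: df|exact: IH].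
Qed.

Lemma CkW n A f : Ck n.+1 A f -> Ck n A f.
Proof.
elim: n f => [|n IH] f [df Df]; first by move=> x Ax; exact/differentiable_continuous/df.
by split=> // v; apply: IH.
Qed.

Lemma Ck_cst n A (c : R) : Ck n A (fun _ => c).
Proof.
elim: n c => [|n IH] c /=; first by move=> x _; exact: cvg_cst.
split=> [x _|v]; first exact: differentiable_cst.
by have -> : 'D_v (fun _ : V => c) = fun _ => 0 by apply/funext => x; exact: derive_cst.
Qed.

Lemma CkD n A f g : open A -> Ck n A f -> Ck n A g -> Ck n A (fun x => f x + g x).
Proof.
move=> oA; elim: n f g => [|n IH] f g /=.
  by move=> cf cg x Ax; apply: cvgD; [exact: cf|exact: cg].
move=> [df Df] [dg Dg]; split=> [x Ax|v].
  by apply: differentiableD; [exact: df|exact: dg].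
apply: (Ck_eq oA _ (IH _ _ (Df v) (Dg v))) => x Ax.
by rewrite -deriveD //; apply: diff_derivable; [exact: df|exact: dg].
Qed.

Lemma CkM n A f g : open A -> Ck n A f -> Ck n A g -> Ck n A (fun x => f x * g x).
Proof.
move=> oA; elim: n f g => [|n IH] f g.
  by move=> cf cg x Ax; apply: cvgM; [exact: cf|exact: cg].
move=> Cf Cg; have [df Df] := Cf; have [dg Dg] := Cg; split=> [x Ax|v].
  by apply: differentiableM; [exact: df|exact: dg].
have H1 := IH _ _ (CkW Cf) (Dg v).
have H2 := IH _ _ (CkW Cg) (Df v).
apply: (Ck_eq oA _ (CkD oA H1 H2)) => x Ax.
rewrite -[RHS]/('D_v (f * g) x) deriveM //; apply: diff_derivable; [exact: df|exact: dg].
Qed.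

Lemma CkV n A f : open A -> (forall x, A x -> f x != 0) -> Ck n A f ->
  Ck n A (fun x => (f x)^-1).
Proof.
move=> oA f0; elim: n => [|n IH].
  by move=> cf x Ax; apply: cvgV; [exact: f0|exact: cf].
move=> Cf; have [df Df] := Cf; split=> [x Ax|v].
  by apply: differentiableV; [exact: df|exact: f0].
have Ci := IH (CkW Cf).
apply: (Ck_eq oA _ (CkM oA (Ck_cst n A (-1)) (CkM oA (CkM oA Ci Ci) (Df v)))) => x Ax.
rewrite (deriveV (f0 x Ax) (diff_derivable (df x Ax))).
by rewrite mulN1r -[RHS]/(- (f x ^- 2) * 'D_v f x) mulNr expr2 invfM.
Qed.

Lemma smooth_eq A f g : open A -> (forall x, A x -> f x = g x) ->
  smooth A f -> smooth A g.
Proof. by move=> oA fg sf n; apply: Ck_eq (sf n). Qed.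

Lemma smooth_sub A B f : A `<=` B -> smooth B f -> smooth A f.
Proof. by move=> AB sf n; apply: Ck_sub (sf n). Qed.

Lemma smooth_derive A f v : smooth A f -> smooth A ('D_v f).
Proof. by move=> sf n; have [_ H] := sf n.+1; exact: H. Qed.

Lemma smooth_continuous A f x : smooth A f -> A x -> {for x, continuous f}.
Proof. by move=> sf Ax; exact: (sf 0%N x Ax). Qed.

Lemma smooth_differentiable A f x : smooth A f -> A x -> differentiable f x.
Proof. by move=> sf Ax; have [+ _] := sf 1%N; apply. Qed.

Lemma smooth_derivable A f x v : smooth A f -> A x -> derivable f x v.
Proof. by move=> sf Ax; apply: diff_derivable; exact: smooth_differentiable Ax. Qed.

Lemma smooth_cst A (c : R) : smooth A (fun _ => c).
Proof. by move=> n; exact: Ck_cst. Qed.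

Lemma smoothD A f g : open A -> smooth A f -> smooth A g ->
  smooth A (fun x => f x + g x).
Proof. by move=> oA sf sg n; apply: CkD. Qed.

Lemma smoothM A f g : open A -> smooth A f -> smooth A g ->
  smooth A (fun x => f x * g x).
Proof. by move=> oA sf sg n; apply: CkM. Qed.

Lemma smoothZ A (c : R) f : open A -> smooth A f -> smooth A (fun x => c * f x).
Proof. by move=> oA sf; apply: smoothM => //; exact: smooth_cst. Qed.

Lemma smoothN A f : open A -> smooth A f -> smooth A (fun x => - f x).
Proof.
by move=> oA sf; apply: (smooth_eq oA _ (smoothZ (-1) oA sf)) => x _; rewrite mulN1r.
Qed.

Lemma smoothB A f g : open A -> smooth A f -> smooth A g ->
  smooth A (fun x => f x - g x).
Proof. by move=> oA sf sg; apply: smoothD => //; exact: smoothN. Qed.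

Lemma smoothV A f : open A -> (forall x, A x -> f x != 0) -> smooth A f ->
  smooth A (fun x => (f x)^-1).
Proof. by move=> oA f0 sf n; apply: CkV. Qed.

Lemma Ck_sum n A (I : Type) (r : seq I) (P : pred I) (F : I -> V -> R) :
  open A -> (forall i, P i -> Ck n A (F i)) ->
  Ck n A (fun x => \sum_(i <- r | P i) F i x).
Proof.
move=> oA sF; elim: r => [|i r IH].
  by apply: (Ck_eq oA _ (Ck_cst n A 0)) => x _; rewrite big_nil.
case Pi : (P i).
  by apply: (Ck_eq oA _ (CkD oA (sF _ Pi) IH)) => x _; rewrite big_cons Pi.
by apply: (Ck_eq oA _ IH) => x _; rewrite big_cons Pi.
Qed.

Lemma smooth_sum A (I : Type) (r : seq I) (P : pred I) (F : I -> V -> R) :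
  open A -> (forall i, P i -> smooth A (F i)) ->
  smooth A (fun x => \sum_(i <- r | P i) F i x).
Proof. by move=> oA sF n; apply: Ck_sum => // i Pi; exact: sF. Qed.

Lemma smooth_prod A (I : Type) (r : seq I) (P : pred I) (F : I -> V -> R) :
  open A -> (forall i, P i -> smooth A (F i)) ->
  smooth A (fun x => \prod_(i <- r | P i) F i x).
Proof.
move=> oA sF; elim: r => [|i r IH].
  by apply: (smooth_eq oA _ (smooth_cst A 1)) => x _; rewrite big_nil.
case Pi : (P i).
  by apply: (smooth_eq oA _ (smoothM oA (sF _ Pi) IH)) => x _; rewrite big_cons Pi.
by apply: (smooth_eq oA _ IH) => x _; rewrite big_cons Pi.
Qed.

Lemma smooth_linear A f : (forall x, differentiable f x) ->
  (forall v x, 'D_v f x = f v) -> smooth A f.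
Proof.
move=> df Df [|n]; first by move=> x _; exact: differentiable_continuous.
split=> // v; have -> : 'D_v f = fun=> f v by apply/funext => x; rewrite Df.
exact: Ck_cst.
Qed.

Lemma derive_sum_fun (I : Type) (r : seq I) (F : I -> V -> R) x v :
  (forall i, derivable (F i) x v) ->
  derivable (fun y => \sum_(i <- r) F i y) x v /\
  'D_v (fun y => \sum_(i <- r) F i y) x = \sum_(i <- r) 'D_v (F i) x.
Proof.
move=> dF; elim: r => [|i r [IHd IH]].
  have -> : (fun y => \sum_(i <- [::]) F i y) = cst 0 by apply/funext => y; rewrite big_nil.
  by rewrite big_nil; split; [exact: derivable_cst|exact: derive_cst].
have -> : (fun y => \sum_(j <- i :: r) F j y) = F i + (fun y => \sum_(j <- r) F j y).
  by apply/funext => y; rewrite big_cons.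
rewrite big_cons -IH; split; [exact: derivableD|exact: deriveD].
Qed.

Lemma derive_mul A f g v x : smooth A f -> smooth A g -> A x ->
  'D_v (fun y => f y * g y) x = 'D_v f x * g x + f x * 'D_v g x.
Proof.
move=> sf sg Ax; rewrite -[LHS]/('D_v (f * g) x) deriveM.
- by rewrite addrC [in X in X + _]/GRing.scale /= mulrC.
- exact: smooth_derivable Ax.
- exact: smooth_derivable Ax.
Qed.

Lemma derive_add A f g v x : smooth A f -> smooth A g -> A x ->
  'D_v (fun y => f y + g y) x = 'D_v f x + 'D_v g x.
Proof. by move=> sf sg Ax; apply: deriveD; exact: smooth_derivable Ax. Qed.

Lemma derive_linear_dir A f x : smooth A f -> A x ->
  forall (c : R) u v, 'D_(c *: u + v) f x = c * 'D_u f x + 'D_v f x.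
Proof.
move=> sf Ax c u v; have df := smooth_differentiable sf Ax.
by rewrite !deriveE // linearP.
Qed.

Lemma derive_sum_dir A f x : smooth A f -> A x ->
  forall (I : Type) (r : seq I) (c : I -> R) (u : I -> V),
  'D_(\sum_(i <- r) c i *: u i) f x = \sum_(i <- r) c i * 'D_(u i) f x.
Proof.
move=> sf Ax I r c u; elim: r => [|i r IH]; first by rewrite !big_nil derive0.
by rewrite !big_cons (derive_linear_dir sf Ax) IH.
Qed.

End SmoothClosure.

(** * Row vectors: coordinates, chain rule and composition *)

Section Coordinates.
Variable R : realType.

Lemma unitvE n (l : 'I_n) : unitv R l = delta_mx 0 l.
Proof. by apply/rowP => k; rewrite !mxE eqxx. Qed.

Lemma unitv_sum n (v : 'rV[R]_n) : v = \sum_i v 0 i *: unitv R i.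
Proof. by rewrite {1}(row_sum_delta v); apply: eq_bigr => i _; rewrite unitvE. Qed.

Lemma coord_derive n (i : 'I_n) (v x : 'rV[R]_n) : 'D_v (fun y : 'rV[R]_n => (y 0 i : R)) x = v 0 i.
Proof.
have := derive_mx (@derivable_id _ _ x v); rewrite derive_id => /matrixP /(_ 0 i).
by rewrite mxE.
Qed.

Lemma smooth_coord n (A : set 'rV[R]_n) (i : 'I_n) :
  smooth A (fun y : 'rV[R]_n => (y 0 i : R)).
Proof.
apply: smooth_linear => [x|v x]; first exact: differentiable_coord.
exact: coord_derive.
Qed.

Section Composition.
Variables (V : normedModType R) (n : nat).
Implicit Types (A : set V) (B : set 'rV[R]_n).

Lemma row_continuous (g : V -> 'rV[R]_n) x :
  (forall i, {for x, continuous (fun y => g y 0 i : R)}) -> {for x, continuous g}.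
Proof.
move=> cg; apply/cvgrPdist_le => e e0.
near=> y.
rewrite [leLHS]/Num.Def.normr /= mx_normrE (bigmax_le _ (ltW e0)) //= => -[i j] _.
rewrite !mxE /= ord1.
move: j; near: y; apply: filter_forall => j.
exact: ((cvgrPdist_le _ _).1 (cg j)).
Unshelve. all: by end_near. Qed.

Lemma row_differentiable (g : V -> 'rV[R]_n) x :
  (forall i, differentiable (fun y => g y 0 i : R) x) -> differentiable g x.
Proof.
move=> dg.
have -> : g = \sum_i (fun y => g y 0 i *: unitv R i).
  by apply/funext => y; rewrite fct_sumE -unitv_sum.
by apply: differentiable_sum => i; apply: differentiableZl.
Qed.

Lemma row_derive (g : V -> 'rV[R]_n) x v :
  (forall i, derivable (fun y => g y 0 i : R) x v) ->
  derivable g x v /\ forall i, 'D_v g x 0 i = 'D_v (fun y => g y 0 i : R) x.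
Proof.
move=> dg; have D : derivable g x v by apply/derivable_mxP => i j; rewrite ord1.
by split=> // i; rewrite derive_mx // mxE.
Qed.

Lemma chain_rule (f : 'rV[R]_n -> R) (g : V -> 'rV[R]_n) x v :
  (forall i, differentiable (fun y => g y 0 i : R) x) -> differentiable f (g x) ->
  differentiable (fun y => f (g y)) x /\
  'D_v (fun y => f (g y)) x = \sum_i 'D_v (fun y => g y 0 i : R) x * 'D_(unitv R i) f (g x).
Proof.
move=> dg df; have Dg := row_differentiable dg.
have D := differentiable_comp Dg df.
split=> //.
rewrite (deriveE v D) diff_comp //= -(deriveE v Dg).
rewrite [in LHS](unitv_sum ('D_v g x)) linear_sum; apply: eq_bigr => i _.
rewrite linearZ -(deriveE (unitv R i) df).
have [_ ->] // := @row_derive g x v (fun i => @diff_derivable _ _ _ _ x v (dg i)).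
Qed.

Lemma Ck_comp k A B (f : 'rV[R]_n -> R) (g : V -> 'rV[R]_n) :
  open A -> (forall x, A x -> B (g x)) ->
  Ck k B f -> (forall i, Ck k A (fun y => g y 0 i : R)) ->
  Ck k A (fun y => f (g y)).
Proof.
move=> oA gAB; elim: k f => [|k IH] f.
  move=> cf cg x Ax.
  have c1 : g @ x --> g x by apply: row_continuous => i; exact: cg.
  have c2 : f @ g x --> f (g x) by apply: cf; exact: gAB.
  exact: (cvg_comp _ _ c1 c2).
move=> Cf Cg.
have [df Df] := Cf.
split=> [x Ax|v].
  by have [] := @chain_rule f g x 0 (fun i => (Cg i).1 x Ax) (df _ (gAB x Ax)).
have E x : A x -> \sum_i 'D_v (fun y => g y 0 i : R) x * 'D_(unitv R i) f (g x) =
    'D_v (fun y => f (g y)) x.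
  by move=> Ax; have [_ ->] := @chain_rule f g x v (fun i => (Cg i).1 x Ax) (df _ (gAB x Ax)).
apply: (Ck_eq oA E).
apply: Ck_sum => // i _; apply: CkM => //; first exact: (Cg i).2.
apply: (IH ('D_(unitv R i) f)) => [|j]; [exact: Df|exact: CkW].
Qed.

Lemma smooth_comp A B (f : 'rV[R]_n -> R) (g : V -> 'rV[R]_n) :
  open A -> (forall x, A x -> B (g x)) ->
  smooth B f -> (forall i, smooth A (fun y => g y 0 i : R)) ->
  smooth A (fun y => f (g y)).
Proof. by move=> oA gAB sf sg k; apply: (Ck_comp oA gAB) => // i; exact: sg. Qed.

End Composition.

End Coordinates.

(** * From continuous partial derivatives to differentiability *)

Section C1.
Variable R : realType.

Lemma norm_coord_le n (v : 'rV[R]_n) i : `|v 0 i| <= `|v|.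
Proof.
rewrite [leRHS]/Num.Def.normr /= mx_normrE.
exact: (le_bigmax _ (fun k : 'I_1 * 'I_n => `|v k.1 k.2|) (0, i)).
Qed.

Lemma norm_row_le n (v : 'rV[R]_n) e : 0 <= e -> (forall i, `|v 0 i| <= e) -> `|v| <= e.
Proof.
move=> e0 H; rewrite [leLHS]/Num.Def.normr /= mx_normrE bigmax_le // => -[i j] _ /=.
by rewrite ord1.
Qed.

Lemma norm_row_lt n (v : 'rV[R]_n) e : 0 < e -> (forall i, `|v 0 i| < e) -> `|v| < e.
Proof.
move=> e0 H; rewrite [ltLHS]/Num.Def.normr /= mx_normrE bigmax_lt // => -[i j] _ /=.
by rewrite ord1.
Qed.

Lemma ball_convex (a b x d t : R) : 0 <= t <= 1 -> `|x - a| < d -> `|x - b| < d ->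
  `|x - (b + t * (a - b))| < d.
Proof.
move=> /andP[t0 t1] Ha Hb.
have -> : x - (b + t * (a - b)) = t * (x - a) + (1 - t) * (x - b) by ring.
apply: le_lt_trans (ler_normD _ _) _; rewrite !normrM (ger0_norm t0) (@ger0_norm _ (1 - t)) ?subr_ge0 //.
move: t0; rewrite le_eqVlt => /predU1P[<-|t0]; first by rewrite mul0r add0r subr0 mul1r.
have -> : d = t * d + (1 - t) * d by ring.
by rewrite ltr_leD // ?ltr_pM2l // ler_wpM2l ?subr_ge0 // ltW.
Qed.

(** The path from [b] to [a] changes one coordinate at a time, and the mean value theorem applies to
    each piece; balls of the sup norm contain all intermediate points. Both ends move, as the
    contraction argument for the inverse function requires. *)
Lemma C1_strict n (A : set 'rV[R]_n) (f : 'rV[R]_n -> R) x :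
  open A -> A x -> (forall i y, A y -> derivable f y (unitv R i)) ->
  (forall i, {for x, continuous ('D_(unitv R i) f)}) ->
  forall e : R, 0 < e -> exists2 d : R, 0 < d & forall a b, ball x d a -> ball x d b ->
    `|f a - f b - \sum_i (a - b) 0 i * 'D_(unitv R i) f x| <= e * `|a - b|.
Proof.
move=> oA Ax Df cf e e0.
(* There are n pieces, each with error at most [e']; the successor keeps the denominator nonzero
   when n = 0. *)
pose e' := e / n.+1%:R.
have e'0 : 0 < e' by rewrite divr_gt0.
have : \forall y \near x, A y /\ forall i, `|'D_(unitv R i) f x - 'D_(unitv R i) f y| <= e'.
  near=> y; split; first by near: y; exact: open_nbhs_nbhs.
  near: y; apply: filter_forall => i.
  exact: ((cvgrPdist_le _ _).1 (cf i)).
move=> /nbhs_ballP[d /= d0 Hd]; exists d => // a b.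
rewrite -ball_normE /= => Ba Bb.
pose mid k : 'rV[R]_n := \row_i (if (i < k)%N then a 0 i else b 0 i).
have mid0 : mid 0%N = b by apply/rowP => i; rewrite mxE.
have midn : mid n = a by apply/rowP => i; rewrite mxE ltn_ord.
have midS (k : 'I_n) t : mid k + t *: ((a - b) 0 k *: unitv R k) =
    \row_i (if (i < k)%N then a 0 i else if i == k then b 0 i + t * (a 0 i - b 0 i) else b 0 i).
  apply/rowP => i; rewrite !mxE; case: eqP => [->|]; rewrite ?ltnn ?mulr1 // !mulr0 addr0.
  by case: ifP.
have Bmid (k : 'I_n) t : 0 <= t <= 1 -> ball x d (mid k + t *: ((a - b) 0 k *: unitv R k)).
  move=> t01; rewrite midS -ball_normE; apply: norm_row_lt => // i.
  have La : `|x 0 i - a 0 i| < d.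
    by apply: le_lt_trans Ba; have := norm_coord_le (x - a) i; rewrite !mxE.
  have Lb : `|x 0 i - b 0 i| < d.
    by apply: le_lt_trans Bb; have := norm_coord_le (x - b) i; rewrite !mxE.
  by rewrite !mxE; do 2?case: ifP => // _; exact: ball_convex.
have step (k : 'I_n) :
    `|f (mid k.+1) - f (mid k) - (a - b) 0 k * 'D_(unitv R k) f x| <= e' * `|a - b|.
  have -> : mid k.+1 = mid k + ((a - b) 0 k *: unitv R k).
    rewrite -[_ *: unitv R k]scale1r midS; apply/rowP => i; rewrite !mxE ltnS leq_eqVlt.
    case: eqP => [/val_inj->|ne /=]; first by rewrite ltnn eqxx mul1r subrKC.
    by case: ltnP => // _; case: eqP => // E; case: ne; rewrite E.
  have DD y : A y -> derivable f y ((a - b) 0 k *: unitv R k) /\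
      'D_((a - b) 0 k *: unitv R k) f y = (a - b) 0 k *: 'D_(unitv R k) f y.
    by move=> Ay; apply: derive_dirZ; exact: Df.
  have [t t01|t t01 ->] := @line_MVT R _ f (mid k) ((a - b) 0 k *: unitv R k).
    by have [] := DD _ (Hd _ (Bmid k t t01)).1.
  have [Ay Hy] := Hd _ (Bmid k t t01).
  have [_ ->] := DD _ Ay.
  rewrite -[_ *: 'D__ _ _]/(_ * _) -mulrBr normrM mulrC distrC.
  apply: ler_pM => //; exact: norm_coord_le.
have -> : f a - f b = \sum_(k < n) (f (mid k.+1) - f (mid k)).
  rewrite -(big_mkord xpredT (fun k => f (mid k.+1) - f (mid k))) telescope_sumr //.
  by rewrite mid0 midn.
rewrite -sumrB; apply: le_trans (ler_norm_sum _ _ _) _.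
apply: le_trans (ler_sum _ (fun k _ => step k)) _.
rewrite sumr_const card_ord -mulr_natr /e' mulrAC; apply: ler_wpM2r => //.
rewrite -mulrA ler_piMr ?(ltW e0) // mulrC ler_pdivrMr // mul1r ler_nat; exact: leqnSn.
Unshelve. all: by end_near. Qed.

Definition linear_form n (c : 'I_n -> R) (h : 'rV[R]_n) : R := \sum_i h 0 i * c i.

Lemma linear_form_is_linear n (c : 'I_n -> R) : linear (linear_form c).
Proof.
move=> k u v; rewrite /linear_form /GRing.scale /= mulr_sumr -big_split; apply: eq_bigr => i _.
by rewrite !mxE mulrDl mulrA.
Qed.
HB.instance Definition _ n (c : 'I_n -> R) :=
  GRing.isLinear.Build R 'rV[R]_n R _ (linear_form c) (linear_form_is_linear c).

Lemma linear_form_continuous n (c : 'I_n -> R) : continuous (linear_form c).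
Proof.
move=> x; apply: (@smooth_continuous R _ setT (linear_form c)) => //.
apply: smooth_sum => [|i _]; first exact: openT.
by apply: smoothM; [exact: openT|exact: smooth_coord|exact: smooth_cst].
Qed.

Lemma C1_differentiable n (A : set 'rV[R]_n) (f : 'rV[R]_n -> R) x :
  open A -> A x -> (forall i y, A y -> derivable f y (unitv R i)) ->
  (forall i, {for x, continuous ('D_(unitv R i) f)}) -> differentiable f x.
Proof.
move=> oA Ax Df cf.
pose c i := 'D_(unitv R i) f x.
apply: (@eps_differentiable _ _ _ f x (linear_form c) _ _).1.
  exact: linear_form_continuous.
move=> e e0; have [d d0 Hd] := C1_strict oA Ax Df cf e0.
near=> h.
have := Hd (h + x) x; rewrite addrK /linear_form; apply; last exact: ballxx.
rewrite -ball_normE /= opprD addrC subrK normrN.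
near: h; apply/nbhs_ballP; exists d => // y.
by rewrite -ball_normE /= sub0r normrN.
Unshelve. all: by end_near. Qed.

(** The induction treats all lists [vs] at once: a derivative of [iderive vs f] is again of this
    form, and its continuous partial derivatives give differentiability. *)
Lemma smooth_on_smooth n (A : set 'rV[R]_n) (f : 'rV[R]_n -> R) :
  open A -> smooth_on A (f : _ -> R^o) -> smooth A f.
Proof.
move=> oA sf.
suff H k : forall vs, Ck k A (iderive vs (f : _ -> R^o)) by move=> k; exact: (H k [::]).
elim: k => [|k IH] vs; first by move=> x Ax; exact: (sf vs).1.
split=> [x Ax|v]; last exact: (IH (v :: vs)).
apply: (C1_differentiable oA Ax) => [i y Ay|i]; first exact: (sf vs).2.
exact: (sf (unitv R i :: vs)).1.
Qed.

Lemma smooth_iderive (V : normedModType R) (A : set V) (f : V -> R) vs :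
  smooth A f -> smooth A (iderive vs (f : _ -> R^o)).
Proof. by move=> sf; elim: vs => //= v vs IH; exact: smooth_derive. Qed.

Lemma smooth_smooth_on (V : normedModType R) (A : set V) (f : V -> R) :
  smooth A f -> smooth_on A (f : _ -> R^o).
Proof.
move=> sf vs; have si := smooth_iderive vs sf.
by split=> [x Ax|v x Ax]; [exact: smooth_continuous Ax|exact: smooth_derivable Ax].
Qed.

End C1.

(** * Symmetry of second derivatives *)

Section Schwarz.
Variables (R : realType) (V : normedModType R) (A : set V) (f : V -> R).
Hypotheses (oA : open A) (sf : smooth A f).

(** Two mean value theorems: along [u] for y |-> f(y + s v) - f(y), then along [v] for the
    derivative of [f] in the direction [u]. *)
Lemma second_difference x (u v : V) (s : R) : s != 0 ->
  (forall a b : R, 0 <= a <= 1 -> 0 <= b <= 1 -> A (x + a *: (s *: u) + b *: (s *: v))) ->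
  exists2 p : R * R, (0 <= p.1 <= 1) && (0 <= p.2 <= 1) &
    f (x + s *: u + s *: v) - f (x + s *: v) - (f (x + s *: u) - f x) =
    s ^+ 2 * 'D_v ('D_u f) (x + p.1 *: (s *: u) + p.2 *: (s *: v)).
Proof.
move=> s0 HA.
have A0 a : 0 <= a <= 1 -> A (x + a *: (s *: u)).
  by move=> a01; have := HA a 0 a01; rewrite scale0r addr0; apply; rewrite lexx ler01.
have A1 a : 0 <= a <= 1 -> A (x + a *: (s *: u) + s *: v).
  by move=> a01; have := HA a 1 a01; rewrite scale1r; apply; rewrite lexx ler01.
have sh y w : 'D_w (fun z => f (z + s *: v)) y = 'D_w f (y + s *: v) /\
    (derivable (fun z => f (z + s *: v)) y w <-> derivable f (y + s *: v) w).
  by apply: (@derive_along _ _ _ _ f (fun z => z + s *: v)) => h; rewrite addrA.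
have dZ g y w : smooth A g -> A y -> derivable g y (s *: w) /\ 'D_(s *: w) g y = s * 'D_w g y.
  by move=> sg Ay; apply: derive_dirZ; exact: smooth_derivable Ay.
have dg a : 0 <= a <= 1 -> derivable (fun z => f (z + s *: v)) (x + a *: (s *: u)) (s *: u).
  by move=> a01; apply/(sh _ _).2; have [] := dZ f _ u sf (A1 _ a01).
have df a : 0 <= a <= 1 -> derivable f (x + a *: (s *: u)) (s *: u).
  by move=> a01; have [] := dZ f _ u sf (A0 _ a01).
have [a a01|a a01 Ea] := @line_MVT R V (fun z => f (z + s *: v) - f z) x (s *: u).
  by apply: (@derivableB _ _ _ (fun z => f (z + s *: v)) f); [exact: dg|exact: df].
have E1 : 'D_(s *: u) (fun z => f (z + s *: v) - f z) (x + a *: (s *: u)) =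
    s * ('D_u f (x + a *: (s *: u) + s *: v) - 'D_u f (x + a *: (s *: u))).
  rewrite (@deriveB _ _ _ (fun z => f (z + s *: v)) f) ?(sh _ _).1; [|exact: dg|exact: df].
  by rewrite (dZ f _ u sf (A1 _ a01)).2 (dZ f _ u sf (A0 _ a01)).2 mulrBr.
have sDu := smooth_derive u sf.
have [b b01|b b01 Eb] := @line_MVT R V ('D_u f) (x + a *: (s *: u)) (s *: v).
  by have [] := dZ _ _ v sDu (HA a b a01 b01).
exists (a, b); first by rewrite /= a01 b01.
rewrite /= expr2 -mulrA -(dZ _ _ v sDu (HA a b a01 b01)).2 -Eb -E1 -Ea.
by rewrite [x + _ + _]addrAC; ring.
Qed.

Lemma common_close (p q z e : R) : `|p - z| < e -> `|q - z| < e -> `|p - q| < e + e.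
Proof.
move=> H1 H2; rewrite -(subrKA z); apply: le_lt_trans (ler_normD _ _) _.
by apply: ltrD => //; rewrite distrC.
Qed.

(** The second difference is symmetric in [u] and [v], so the two mixed derivatives take a common
    value at points arbitrarily close to [x]. With [e] half of the supposed gap, continuity gives a
    contradiction. *)
Lemma derive_comm x (u v : V) : A x -> 'D_v ('D_u f) x = 'D_u ('D_v f) x.
Proof.
move=> Ax; apply/eqP/negPn/negP => ne.
pose e := `|'D_v ('D_u f) x - 'D_u ('D_v f) x| / 2.
have e0 : 0 < e by rewrite divr_gt0 // normr_gt0 subr_eq0.
have cvu := smooth_continuous (smooth_derive v (smooth_derive u sf)) Ax.
have cuv := smooth_continuous (smooth_derive u (smooth_derive v sf)) Ax.
have nA : \forall y \near x, A y by exact: open_nbhs_nbhs.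
have nvu := (cvgrPdist_lt _ _).1 cvu e e0.
have nuv := (cvgrPdist_lt _ _).1 cuv e e0.
have : nbhs x (A `&` ([set y | `|'D_v ('D_u f) x - 'D_v ('D_u f) y| < e] `&`
    [set y | `|'D_u ('D_v f) x - 'D_u ('D_v f) y| < e])).
  exact: (filterI nA (filterI (nvu _) (nuv _))).
move=> /nbhs_ballP[d /= d0 Hd].
have [s s0 Hs] : exists2 s : R, 0 < s & s * (`|u| + `|v|) < d.
  have K0 : 0 < 1 + (`|u| + `|v|) by rewrite ltr_wpDr // addr_ge0.
  exists (d / (1 + (`|u| + `|v|))); first by rewrite divr_gt0.
  by rewrite mulrAC ltr_pdivrMr // ltr_pM2l // ltrDr.
have B a b : 0 <= a <= 1 -> 0 <= b <= 1 -> ball x d (x + a *: (s *: u) + b *: (s *: v)).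
  move=> /andP[a0 a1] /andP[b0 b1]; rewrite -ball_normE /= -addrA opprD addNKr normrN.
  apply: le_lt_trans (ler_normD _ _) _; rewrite !normrZ !ger0_norm ?(ltW s0) //.
  by apply: le_lt_trans Hs; rewrite mulrDr; apply: lerD; apply: ler_piMl => //; apply: mulr_ge0 => //; exact: ltW.
have [[a b] /= /andP[a01 b01] E1] := @second_difference x u v s (lt0r_neq0 s0)
  (fun a b a01 b01 => (Hd _ (B a b a01 b01)).1).
have B' a' b' : 0 <= a' <= 1 -> 0 <= b' <= 1 -> ball x d (x + a' *: (s *: v) + b' *: (s *: u)).
  by move=> *; rewrite addrAC; exact: B.
have [[a' b'] /= /andP[a01' b01'] E2] := @second_difference x v u s (lt0r_neq0 s0)
  (fun a b a01 b01 => (Hd _ (B' a b a01 b01)).1).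
have E : 'D_v ('D_u f) (x + a *: (s *: u) + b *: (s *: v)) =
         'D_u ('D_v f) (x + a' *: (s *: v) + b' *: (s *: u)).
  apply: (@mulfI _ (s ^+ 2)); first by rewrite expf_neq0 // gt_eqF.
  by rewrite -E1 -E2 [x + s *: v + _]addrAC; ring.
have [_ [H1 _]] := Hd _ (B a b a01 b01).
have [_ [_ H2]] := Hd _ (B' a' b' a01' b01').
rewrite /mkset E in H1.
have := common_close H1 H2.
by rewrite -splitr ltxx.
Qed.

End Schwarz.

(** * Smooth families of matrices *)

Section SmoothMatrix.
Variables (R : realType) (V : normedModType R) (A : set V).
Hypothesis oA : open A.

Lemma smooth_det n (M : V -> 'M[R]_n) :
  (forall i j, smooth A (fun x => M x i j)) -> smooth A (fun x => \det (M x)).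
Proof.
move=> sM; rewrite /determinant.
apply: smooth_sum => // s _; apply: smoothM => //; first exact: smooth_cst.
exact: smooth_prod.
Qed.

(** Cramer's formula writes the entries of the inverse as cofactors divided by the determinant. *)
Lemma smooth_invmx n (M : V -> 'M[R]_n) :
  (forall i j, smooth A (fun x => M x i j)) -> (forall x, A x -> M x \in unitmx) ->
  forall i j, smooth A (fun x => invmx (M x) i j).
Proof.
move=> sM uM i j.
apply: (@smooth_eq _ _ A (fun x => (\det (M x))^-1 * ((-1) ^+ (j + i) *
   \det (row' j (col' i (M x)))))) => //.
  by move=> x /uM ux; rewrite /invmx ux !mxE.
apply: smoothM => //.
  apply: smoothV => //; last exact: smooth_det.
  by move=> x /uM; rewrite unitmxE unitfE.
apply: smoothM => //; first exact: smooth_cst.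
apply: smooth_det => k l; apply: smooth_eq (sM (lift j k) (lift i l)) => // x _.
by rewrite !mxE.
Qed.

Lemma smooth_mulmx m n p (M : V -> 'M[R]_(m, n)) (K : V -> 'M[R]_(n, p)) :
  (forall i j, smooth A (fun x => M x i j)) -> (forall i j, smooth A (fun x => K x i j)) ->
  forall i j, smooth A (fun x => (M x *m K x) i j).
Proof.
move=> sM sK i j.
apply: (@smooth_eq _ _ A (fun x => \sum_k M x i k * K x k j)) => //.
  by move=> x _; rewrite mxE.
by apply: smooth_sum => // k _; exact: smoothM.
Qed.

End SmoothMatrix.

(** * The inverse function theorem *)

HB.instance Definition _ (R : realType) (n : nat) := Complete.on 'rV[R]_n.

Section InverseFunction.
Variable R : realType.

Lemma contraction_half (X : completeNormedModType R) (U : set X) (phi : X -> X) :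
  closed U -> U !=set0 -> (forall x, U x -> U (phi x)) ->
  (forall x y, U x -> U y -> `|phi x - phi y| <= 2^-1 * `|x - y|) ->
  exists2 p, U p & p = phi p.
Proof.
move=> cU U0 sphi lip.
pose g : {fun U >-> U} := HB.pack phi (isFun.Build _ _ U U phi sphi).
apply: (@banach_fixed_point R X U g) => //.
exists 2^-1%:nng; split => /=; first by rewrite invf_lt1 // ltr1n.
by move=> [x y] [/= Ux Uy]; exact: lip.
Qed.

Lemma mulmx_bound n (C : 'M[R]_n) : exists2 K : R, 0 < K & forall v : 'rV[R]_n, `|v *m C| <= K * `|v|.
Proof.
exists (1 + \sum_i \sum_j `|C i j|).
  by rewrite ltr_wpDr // sumr_ge0 // => i _; rewrite sumr_ge0.
move=> v; apply: norm_row_le => [|j].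
  by rewrite mulr_ge0 // addr_ge0 // sumr_ge0 // => i _; rewrite sumr_ge0.
rewrite mxE; apply: le_trans (ler_norm_sum _ _ _) _.
apply: (@le_trans _ _ (\sum_i `|C i j| * `|v|)).
  apply: ler_sum => i _; rewrite normrM mulrC; apply: ler_wpM2l => //; exact: norm_coord_le.
rewrite -mulr_suml; apply: ler_wpM2r => //; rewrite ler_wpDl //.
apply: ler_sum => i _; rewrite (bigD1 j) //= lerDl sumr_ge0 //.
Qed.

Section AtPoint.
Variables (n : nat) (A : set 'rV[R]_n) (f : 'rV[R]_n -> 'rV[R]_n).
Hypotheses (oA : open A) (sf : forall i, smooth A (fun y => f y 0 i : R)).

(** Rows are indexed by the direction of differentiation, so the differential acts on row vectors by
    multiplication on the right. *)
Definition jac (y : 'rV[R]_n) : 'M[R]_n :=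
  \matrix_(i, j) 'D_(unitv R i) (fun z => f z 0 j : R) y.

Lemma smooth_jac i j : smooth A (fun y => jac y i j).
Proof.
apply: smooth_eq (smooth_derive (unitv R i) (sf j)) => // y _.
by rewrite mxE.
Qed.

Lemma strict_jac x : A x -> forall e : R, 0 < e ->
  exists2 d : R, 0 < d & forall a b, ball x d a -> ball x d b ->
    `|f a - f b - (a - b) *m jac x| <= e * `|a - b|.
Proof.
move=> Ax e e0.
have H j : {d : R | 0 < d & forall a b, ball x d a -> ball x d b ->
    `|f a 0 j - f b 0 j - \sum_i (a - b) 0 i * 'D_(unitv R i) (fun z => f z 0 j : R) x| <= e * `|a - b|}.
  apply/cid2; apply: (C1_strict oA Ax _ _ e0) => [i y Ay|i].
    exact: smooth_derivable Ay.
  exact: smooth_continuous (smooth_derive _ (sf j)) Ax.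
pose d := \big[Num.min/1]_j s2val (H j).
have d0 : 0 < d by apply: lt_bigmin => // j _; exact: (s2valP (H j)).
have dj j : d <= s2val (H j) by exact: bigmin_le_cond.
exists d => // a b Ba Bb.
apply: norm_row_le => [|j]; first by rewrite mulr_ge0 // ltW.
have := s2valP' (H j) a b (le_ball (dj j) Ba) (le_ball (dj j) Bb).
rewrite !mxE; under [X in _ -> `|_ - X| <= _]eq_bigr do rewrite !mxE.
by under [X in `|_ - X| <= _ -> _]eq_bigr do rewrite !mxE.
Qed.

(** Strict differentiability makes [f], composed with the inverse differential [C], close to the
    identity. This yields at once injectivity with a Lipschitz inverse ([B3]) and, by contraction,
    surjectivity onto a small ball ([surj]). The derivative of the inverse is the inverse Jacobian
    matrix at [psi p], from which smoothness bootstraps. *)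
Lemma inverse_function x : A x -> jac x \in unitmx ->
  exists (W W' : set 'rV[R]_n) (psi : 'rV[R]_n -> 'rV[R]_n),
    [/\ open W /\ W x /\ W `<=` A, open W' /\ W' (f x),
        forall a, W a -> W' (f a) /\ psi (f a) = a,
        forall p, W' p -> W (psi p) /\ f (psi p) = p &
        forall i, smooth W' (fun p => psi p 0 i : R)].
Proof.
move=> Ax ux.
have sdet : smooth A (fun y => \det (jac y)) by apply: smooth_det => //; exact: smooth_jac.
have nu : \forall y \near x, A y /\ jac y \in unitmx.
  have cd := smooth_continuous sdet Ax.
  have nz : \det (jac x) != 0 by rewrite -unitfE -unitmxE.
  have n1 : \forall y \near x, A y by exact: open_nbhs_nbhs.
  have n2 : \forall y \near x, \det (jac y) != 0.
    by apply: (cd [set z | z != 0]); apply: open_nbhs_nbhs; split => //; exact: open_neq.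
  by apply: filterS2 n1 n2 => y Ay dy; split => //; rewrite unitmxE unitfE.
have [d1 /= d10 Hd1] := (nbhs_ballP _ _).1 nu.
set C := invmx (jac x).
have [K K0 HK] := mulmx_bound C.
(* Chosen so that K * e = 1/2, the contraction ratio. *)
pose e := (2 * K)^-1.
have e0 : 0 < e by rewrite invr_gt0 mulr_gt0.
have Ke : K * e = 2^-1 by rewrite /e invfM mulrCA mulfV ?mulr1 // gt_eqF.
have [d2 d20 Hd2] := strict_jac Ax e0.
pose d := Num.min d1 d2.
have d0 : 0 < d by rewrite lt_min d10.
have B1 a : `|x - a| < d -> A a /\ jac a \in unitmx.
  by move=> H; apply: Hd1; rewrite -ball_normE /=; apply: lt_le_trans H _; rewrite ge_min lexx.
have B2 a b : `|x - a| < d -> `|x - b| < d -> `|a - b - (f a - f b) *m C| <= 2^-1 * `|a - b|.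
  move=> Ha Hb.
  have L y : `|x - y| < d -> ball x d2 y.
    by move=> H; rewrite -ball_normE /=; apply: lt_le_trans H _; rewrite ge_min lexx orbT.
  rewrite -{1}[a - b](mulmxK ux) -mulmxBl -Ke -mulrA -normrN -mulNmx opprB.
  apply: le_trans (HK _) _; rewrite ler_pM2l //; apply: Hd2; exact: L.
have B3 a b : `|x - a| < d -> `|x - b| < d -> `|a - b| <= 2 * K * `|f a - f b|.
  move=> Ha Hb; have H := B2 a b Ha Hb.
  have := ler_normD (a - b - (f a - f b) *m C) ((f a - f b) *m C); rewrite subrK.
  have := HK (f a - f b).
  move: H; set X := `|_ - _ *m C|; set Y := `|_ *m C|; set Z := `|a - b|.
  set T := `|f a - f b|.
  move=> h1 h2 h3; nra.
pose r := d / 2.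
have r0 : 0 < r by rewrite divr_gt0.
have rd : r < d by rewrite /r; lra.
pose rho := r * e.
have rho0 : 0 < rho by rewrite mulr_gt0.
have surj p : `|f x - p| < rho -> exists2 a, `|x - a| < r & f a = p.
  move=> Hp.
  (* Newton's iteration with the differential frozen at [x]; since [C] is invertible, its fixed
     points are the solutions of f a = p. *)
  pose phi a := a - (f a - p) *m C.
  pose U := closed_ball_ (fun v : 'rV[R]_n => `|v|) x r.
  have Kp : `|(f x - p) *m C| < r / 2.
    apply: le_lt_trans (HK _) _; apply: (@lt_le_trans _ _ (K * rho)); first by rewrite ltr_pM2l.
    by rewrite /rho mulrCA Ke.
  have Uphi a : U a -> `|x - phi a| < r.
    move=> Ua.
    have -> : x - phi a = (x - a - (f x - f a) *m C) + (f x - p) *m C.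
      rewrite /phi !mulmxBl; move: (f a *m C) (f x *m C) (p *m C) => u v w.
      by apply/rowP => i; rewrite !mxE; ring.
    have Hx : `|x - x| < d by rewrite subrr normr0.
    have Ha : `|x - a| < d by apply: le_lt_trans Ua rd.
    have := B2 x a Hx Ha; have := ler_normD (x - a - (f x - f a) *m C) ((f x - p) *m C).
    have Ua' : `|x - a| <= r by exact: Ua.
    move: Kp Ua'; set X := `|_ + _|; set Y := `|_ *m C|; set Z := `|_ - _ *m C|.
    move=> h1 h2 h3 h4; lra.
  have [||a Ua|a b Ua Ub|a Ua Ea] := @contraction_half _ U phi.
  - exact: closed_closed_ball_.
  - by exists x; rewrite /U /closed_ball_ /= subrr normr0 ltW.
  - exact/ltW/Uphi.
  - have -> : phi a - phi b = a - b - (f a - f b) *m C.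
      rewrite /phi !mulmxBl; move: (f a *m C) (f b *m C) (p *m C) => u v w.
      by apply/rowP => i; rewrite !mxE; ring.
    by apply: B2; apply: le_lt_trans rd.
  exists a; first by rewrite Ea; exact: Uphi.
  have E0 : (f a - p) *m C = 0.
    by rewrite -[LHS](subKr a) -/(phi a) -Ea subrr.
  by apply/eqP; rewrite -subr_eq0 -[X in X == _](mulmxKV ux) E0 mul0mx.
pose W' := ball (f x) rho.
have inW' p : W' p <-> `|f x - p| < rho by rewrite /W' -ball_normE.
(* The condition on [f a] is imposed so that [f] maps [W] exactly onto [W']. *)
pose W := [set a | `|x - a| < r /\ W' (f a)].
pose psi p := xget x [set a | `|x - a| < r /\ f a = p].
have psiP p : W' p -> `|x - psi p| < r /\ f (psi p) = p.
  move=> /inW'/surj[a Ha fa]; rewrite /psi; case: xgetP => [y _ //|/(_ a)].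
  by case.
have Wd a : W a -> `|x - a| < d by move=> [H _]; exact: lt_trans H rd.
have psiW p : W' p -> W (psi p) by move=> W'p; have [? E] := psiP p W'p; split=> //; rewrite E.
have WA a : W a -> A a by move=> /Wd/B1[].
have psi_lip p q : W' p -> W' q -> `|psi p - psi q| <= 2 * K * `|p - q|.
  move=> hp hq; have := B3 _ _ (Wd _ (psiW _ hp)) (Wd _ (psiW _ hq)).
  by rewrite (psiP p hp).2 (psiP q hq).2.
have oW' : open W' by exact: ball_open.
have oW : open W.
  rewrite openE => a [Ha W'a].
  have cf : f @ a --> f a.
    apply: row_continuous => i; apply: (smooth_continuous (sf i)).
    by have [] := B1 a (lt_trans Ha rd).
  have n2 : nbhs a (f @^-1` W') by apply: cf; exact: open_nbhs_nbhs.
  have n1 : nbhs a (ball x r).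
    by apply: open_nbhs_nbhs; split; [exact: ball_open|rewrite -ball_normE].
  by apply: filterS2 n1 n2 => b; rewrite -ball_normE.
exists W, W', psi; split.
- split=> //; split=> //; split; first by rewrite subrr normr0.
  exact: ballxx.
- by split=> //; exact: ballxx.
- move=> a Wa; have W'a := Wa.2; split=> //; apply/eqP; rewrite -subr_eq0 -normr_le0.
  apply: le_trans (B3 _ _ (Wd _ (psiW _ W'a)) (Wd _ Wa)) _.
  by rewrite (psiP _ W'a).2 subrr normr0 mulr0.
- by move=> p W'p; split; [exact: psiW|have [] := psiP p W'p].
have K2 : 0 < 2 * K by rewrite mulr_gt0.
have Dpsi p i : W' p -> differentiable (fun q => psi q 0 i : R) p /\
    forall v, 'D_v (fun q => psi q 0 i : R) p = \sum_j v 0 j * invmx (jac (psi p)) j i.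
  move=> W'p; set a := psi p; set Ca := invmx (jac a).
  have Wa := psiW p W'p; have [Aa ua] := B1 a (Wd _ Wa).
  have [Ka Ka0 HKa] := mulmx_bound Ca.
  apply: (@eps_differentiable _ _ _ (fun q => psi q 0 i : R) p (linear_form (fun j => Ca j i))).
    exact: linear_form_continuous.
  move=> e1 e10.
  (* The error of [f] at [a] is later multiplied by [Ka], and the increment of [psi] is at most 2 K
     |h|: this tolerance leaves e1 |h|. *)
  have e20 : 0 < e1 / (Ka * (2 * K)) by rewrite divr_gt0 // mulr_gt0.
  have [d3 d30 Hd3] := strict_jac Aa e20.
  have n1 : \forall h \near (0 : 'rV[R]_n), W' (h + p).
    by apply: near_translate; exact: open_nbhs_nbhs.
  have n2 : \forall h \near (0 : 'rV[R]_n), ball 0 (d3 / (2 * K)) h.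
    by apply: nbhsx_ballx; rewrite divr_gt0.
  apply: filterS2 n1 n2 => h W'h; rewrite -ball_normE /= sub0r normrN => Hh.
  have Lb : `|psi (h + p) - a| <= 2 * K * `|h|.
    by apply: le_trans (psi_lip _ _ W'h W'p) _; rewrite addrK.
  have Bb : ball a d3 (psi (h + p)).
    rewrite -ball_normE /= distrC; apply: le_lt_trans Lb _.
    by rewrite mulrC -ltr_pdivlMr.
  have := Hd3 _ _ Bb (ballxx a d30).
  rewrite (psiP _ W'h).2 (psiP _ W'p).2 addrK => H.
  have -> : psi (h + p) 0 i - psi p 0 i - linear_form (fun j => Ca j i) h =
      (- (h - (psi (h + p) - a) *m jac a) *m Ca) 0 i.
    by rewrite mulNmx mulmxBl mulmxK // /linear_form !mxE -/a; ring.
  apply: le_trans (norm_coord_le _ i) _; apply: le_trans (HKa _) _; rewrite normrN.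
  apply: (@le_trans _ _ (Ka * (e1 / (Ka * (2 * K)) * (2 * K * `|h|)))).
    rewrite ler_pM2l //; apply: le_trans H _; rewrite ler_pM2l //.
  by rewrite le_eqVlt; apply/orP; left; apply/eqP; field; rewrite !gt_eqF.
(* Bootstrapping: the derivative of [psi] is a smooth function of [psi], so class C^k of [psi] gives
   class C^k of its derivative. *)
move=> i k; elim: k i => [|k IH] i.
  by move=> p W'p; apply: differentiable_continuous; have [] := Dpsi p i W'p.
split=> [p W'p|v]; first by have [] := Dpsi p i W'p.
apply: (@Ck_eq _ _ k W' (fun p => \sum_j v 0 j * invmx (jac (psi p)) j i)) => //.
  by move=> p W'p; have [_ ->] := Dpsi p i W'p.
apply: Ck_sum => // j _; apply: CkM => //; first exact: Ck_cst.
apply: (@Ck_comp _ _ _ k W' W (fun a => invmx (jac a) j i) psi) => //.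
apply: smooth_invmx => // [i1 j1|a /Wd/B1[] //].
by apply: smooth_sub (smooth_jac i1 j1).
Qed.

End AtPoint.
End InverseFunction.

(** * Iterated directional derivatives *)

Section IteratedDerivatives.
Variable R : realType.

Section General.
Variables (V : normedModType R) (A : set V).
Hypothesis oA : open A.
Implicit Types f g : V -> R^o.

Lemma iderive_eq f g vs : (forall x, A x -> f x = g x) ->
  forall x, A x -> iderive vs f x = iderive vs g x.
Proof.
move=> fg; elim: vs => [|v vs IH] x Ax /=; first exact: fg.
exact: (open_derive_eq oA IH).
Qed.

Lemma iderive_rcons f vs v : iderive (rcons vs v) f = iderive vs (fun x => 'D_v f x).
Proof. by elim: vs => //= u vs ->. Qed.

Lemma iderive_add f g vs : smooth A f -> smooth A g -> forall x, A x ->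
  iderive vs (fun y => f y + g y : R^o) x = iderive vs f x + iderive vs g x.
Proof.
move=> sf sg; elim: vs => [|v vs IH] x Ax //=.
rewrite (open_derive_eq oA IH _ Ax); apply: (derive_add _ _ _ Ax); exact: smooth_iderive.
Qed.

Lemma iderive_scale f (c : R) vs : smooth A f -> forall x, A x ->
  iderive vs (fun y => c * f y : R^o) x = c * iderive vs f x.
Proof.
move=> sf; elim: vs => [|v vs IH] x Ax //=.
rewrite (open_derive_eq oA IH _ Ax).
have := @derive_mul R V A (fun=> c) (iderive vs f) v x (smooth_cst A c) (smooth_iderive vs sf) Ax.
by move=> ->; rewrite derive_cst mul0r add0r.
Qed.

Lemma iderive_cst vs (c : R) x : vs != [::] -> iderive vs (fun _ : V => c : R^o) x = 0.
Proof.
elim/last_ind: vs => // vs v _ _; rewrite iderive_rcons.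
have -> : (fun x : V => 'D_v (fun _ : V => c : R^o) x) = fun=> 0.
  by apply/funext => y; exact: derive_cst.
elim: vs x => //= u vs IH x.
have -> : iderive vs (fun _ : V => 0 : R^o) = fun=> 0 by apply/funext.
exact: derive_cst.
Qed.

Lemma iderive_zero vs x : iderive vs (fun _ : V => 0 : R^o) x = 0.
Proof. by case: vs => // v vs; exact: iderive_cst. Qed.

Lemma iderive_sum (I : Type) (r : seq I) (F : I -> V -> R^o) vs :
  (forall i, smooth A (F i)) -> forall x, A x ->
  iderive vs (fun y => \sum_(i <- r) F i y : R^o) x = \sum_(i <- r) iderive vs (F i) x.
Proof.
move=> sF; elim: r => [|i r IH] x Ax.
  rewrite big_nil (iderive_eq (g := fun=> 0)) ?iderive_zero // => y _.
  by rewrite big_nil.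
rewrite big_cons -IH // -iderive_add //; last by apply: smooth_sum.
by apply: iderive_eq => // y _; rewrite big_cons.
Qed.

End General.

(** Each derivative in direction i brings out one factor [lam i]. With powers of a scalar for [lam],
    this detects the weight of a function homogeneous under dilations. *)
Lemma iderive_diag n (lam : 'I_n -> R) (f : 'rV[R]_n -> R^o) s v : smooth setT f ->
  iderive (map (@unitv R n) s) (fun u => f (\row_i (lam i * u 0 i))) v =
  (\prod_(i <- s) lam i) * iderive (map (@unitv R n) s) f (\row_i (lam i * v 0 i)).
Proof.
move=> sf; elim: s v => [|i s IH] v /=; first by rewrite big_nil mul1r.
have -> : iderive [seq unitv R i | i <- s] (fun u => f (\row_i (lam i * u 0 i))) =
  fun v => \prod_(i <- s) lam i * iderive (map (@unitv R n) s) f (\row_i (lam i * v 0 i)).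
  exact/funext.
have H (h : R) : (\row_k (lam k * (h *: unitv R i + v) 0 k) : 'rV[R]_n) =
    h *: (lam i *: unitv R i) + \row_k (lam k * v 0 k).
  by apply/rowP => k; rewrite !mxE; case: eqP => [->|_] /=; ring.
have [E D] := @derive_along R _ _ _ (fun w => \prod_(i <- s) lam i * iderive (map (@unitv R n) s) f w)
   (fun u : 'rV[R]_n => \row_i (lam i * u 0 i)) v (unitv R i) (lam i *: unitv R i) H.
rewrite E.
have si := smooth_iderive (map (@unitv R n) s) sf.
rewrite (derive_dirZ _ _).2; last first.
  by apply: smooth_derivable (smoothZ _ _ si) _ => //; exact: openT.
have -> : 'D_(unitv R i) (fun w => \prod_(i0 <- s) lam i0 * iderive [seq unitv R i | i <- s] f w)
   (\row_i0 (lam i0 * v 0 i0)) = \prod_(i0 <- s) lam i0 *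
   'D_(unitv R i) (iderive [seq unitv R i | i <- s] f) (\row_i0 (lam i0 * v 0 i0)).
  exact: (@iderive_scale _ setT openT _ _ [:: unitv R i] si).
by rewrite big_cons -mulrA.
Qed.

End IteratedDerivatives.

(** * The free nilpotent algebra and the exponential map *)

Section NCSeries.
Variables (R : realType) (d : nat).

(* Series are not truncated, so that [nc] is an honest ring: working in step [m] means
   working up to [eqm m] below. *)
Definition nc := seq 'I_d -> R.

HB.instance Definition _ := GRing.Lmodule.on nc.

Definition ncmul (a b : nc) : nc :=
  fun w => \sum_(i < (size w).+1) a (take i w) * b (drop i w).
Definition ncone : nc := fun w => (w == [::])%:R.
(** The left quotient by a letter: [a] is its constant term plus the sum of x ([lsh x a]) over the
    letters x. The twisted Leibniz rule [lshM] drives the inductions on words. *)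
Definition lsh (x : 'I_d) (a : nc) : nc := fun w => a (x :: w).

Lemma ncDE (a b : nc) w : (a + b) w = a w + b w. Proof. by []. Qed.
Lemma ncZE (c : R) (a : nc) w : (c *: a) w = c * a w. Proof. by []. Qed.
Lemma ncNE (a : nc) w : (- a) w = - a w. Proof. by []. Qed.
Lemma nc0E w : (0 : nc) w = 0. Proof. by []. Qed.
Lemma nc_sumE (I : Type) (r : seq I) (P : pred I) (F : I -> nc) w :
  (\sum_(i <- r | P i) F i) w = \sum_(i <- r | P i) F i w.
Proof. by elim/big_rec2: _ => // i x y _ <-. Qed.

Lemma ncmul_nil a b : ncmul a b [::] = a [::] * b [::].
Proof. by rewrite /ncmul big_ord_recl big_ord0 addr0. Qed.

Lemma ncmul_cons a b x w : ncmul a b (x :: w) = a [::] * b (x :: w) + ncmul (lsh x a) b w.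
Proof. by rewrite /ncmul big_ord_recl. Qed.

Lemma lsh_mul a b x : lsh x (ncmul a b) = a [::] *: lsh x b + ncmul (lsh x a) b.
Proof. by apply/funext => w; rewrite /lsh ncmul_cons. Qed.

Lemma ncmulDl : left_distributive ncmul +%R.
Proof.
move=> a b c; apply/funext => w; rewrite ncDE /ncmul -big_split; apply: eq_bigr => i _.
by rewrite ncDE mulrDl.
Qed.

Lemma ncmulDr : right_distributive ncmul +%R.
Proof.
move=> a b c; apply/funext => w; rewrite ncDE /ncmul -big_split; apply: eq_bigr => i _.
by rewrite ncDE mulrDr.
Qed.

Lemma ncmulZl (k : R) a b : k *: ncmul a b = ncmul (k *: a) b.
Proof.
apply/funext => w; rewrite ncZE /ncmul mulr_sumr; apply: eq_bigr => i _.
by rewrite ncZE mulrA.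
Qed.

Lemma ncmulZr (k : R) a b : k *: ncmul a b = ncmul a (k *: b).
Proof.
apply/funext => w; rewrite ncZE /ncmul mulr_sumr; apply: eq_bigr => i _.
by rewrite ncZE mulrCA.
Qed.

Lemma ncmulA : associative ncmul.
Proof.
move=> a b c; apply/funext => w; elim: w a => [|x w IH] a.
  by rewrite !ncmul_nil mulrA.
rewrite !ncmul_cons lsh_mul ncmulDl ncDE -ncmulZl ncZE -IH ncmul_nil.
by rewrite mulrDr mulrA addrA.
Qed.

Lemma nc1mul : left_id ncone ncmul.
Proof.
move=> a; apply/funext => -[|x w]; first by rewrite ncmul_nil mul1r.
rewrite ncmul_cons mul1r /ncmul big1 ?addr0 // => i _.
by rewrite /lsh /ncone /= mul0r.
Qed.

Lemma ncmul1 : right_id ncone ncmul.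
Proof.
move=> a; apply/funext => w; elim: w a => [|x w IH] a; first by rewrite ncmul_nil mulr1.
by rewrite ncmul_cons IH mulr0 add0r.
Qed.

Lemma ncone_neq0 : ncone != 0.
Proof.
by apply/eqP => /(congr1 (fun f : nc => f [::])) /eqP; rewrite oner_eq0.
Qed.

HB.instance Definition _ := GRing.Zmodule_isNzRing.Build nc
  ncmulA nc1mul ncmul1 ncmulDl ncmulDr ncone_neq0.
HB.instance Definition _ := GRing.Lmodule_isLalgebra.Build R nc ncmulZl.
HB.instance Definition _ := GRing.Lalgebra_isAlgebra.Build R nc ncmulZr.

Lemma ncME (a b : nc) w : (a * b) w = \sum_(i < (size w).+1) a (take i w) * b (drop i w).
Proof. by []. Qed.
Lemma nc1E w : (1 : nc) w = (w == [::])%:R. Proof. by []. Qed.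
Lemma ncM_nil (a b : nc) : (a * b) [::] = a [::] * b [::].
Proof. exact: ncmul_nil. Qed.
Lemma lshM (a b : nc) x : lsh x (a * b) = a [::] *: lsh x b + lsh x a * b.
Proof. exact: lsh_mul. Qed.

Definition eqm (m : nat) (a b : nc) := forall w, (size w <= m)%N -> a w = b w.
(** [ord] bounds the degree from below and [supp] from above. The first gives vanishing up to step
    m; the second makes a series a finite combination of words, which can act as a differential
    operator. *)
Definition ord (k : nat) (a : nc) := forall w, (size w < k)%N -> a w = 0.
Definition supp (K : nat) (a : nc) := forall w, (K < size w)%N -> a w = 0.

Lemma eqm_sym m a b : eqm m a b -> eqm m b a.
Proof. by move=> H w /H. Qed.
Lemma eqm_trans m a b c : eqm m a b -> eqm m b c -> eqm m a c.
Proof. by move=> H1 H2 w wm; rewrite H1 // H2. Qed.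
Lemma eqmD m a b a' b' : eqm m a a' -> eqm m b b' -> eqm m (a + b) (a' + b').
Proof. by move=> H1 H2 w wm; rewrite !ncDE H1 // H2. Qed.
Lemma eqmZ m (c : R) a a' : eqm m a a' -> eqm m (c *: a) (c *: a').
Proof. by move=> H w wm; rewrite !ncZE H. Qed.
Lemma eqmN m a a' : eqm m a a' -> eqm m (- a) (- a').
Proof. by move=> H w wm; rewrite !ncNE H. Qed.
Lemma eqmM m a b a' b' : eqm m a a' -> eqm m b b' -> eqm m (a * b) (a' * b').
Proof.
move=> H1 H2 w wm; rewrite !ncME; apply: eq_bigr => i _; congr (_ * _).
  by apply: H1; rewrite size_take; case: ifP => // _; apply: leq_trans wm; rewrite -ltnS.
by apply: H2; rewrite size_drop; apply: leq_trans wm; exact: leq_subr.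
Qed.
Lemma eqm_sum m (I : Type) (r : seq I) (P : pred I) (F G : I -> nc) :
  (forall i, P i -> eqm m (F i) (G i)) ->
  eqm m (\sum_(i <- r | P i) F i) (\sum_(i <- r | P i) G i).
Proof. by move=> H w wm; rewrite !nc_sumE; apply: eq_bigr => i Pi; exact: H. Qed.
Lemma eqmX m a a' n : eqm m a a' -> eqm m (a ^+ n) (a' ^+ n).
Proof. by move=> H; elim: n => [|n IH] //; rewrite !exprS; exact: eqmM. Qed.

Lemma ord_eqm m a : ord m.+1 a -> eqm m a 0.
Proof. by move=> H w wm; rewrite H. Qed.
Lemma ordW k l a : (l <= k)%N -> ord k a -> ord l a.
Proof. by move=> lk H w wl; apply: H; exact: leq_trans lk. Qed.
Lemma ordD k a b : ord k a -> ord k b -> ord k (a + b).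
Proof. by move=> H1 H2 w wk; rewrite ncDE H1 // H2 // addr0. Qed.
Lemma ordN k a : ord k a -> ord k (- a).
Proof. by move=> H w wk; rewrite ncNE H // oppr0. Qed.
Lemma ordZ k (c : R) a : ord k a -> ord k (c *: a).
Proof. by move=> H w wk; rewrite ncZE H // mulr0. Qed.
Lemma ord_sum k (I : Type) (r : seq I) (P : pred I) (F : I -> nc) :
  (forall i, P i -> ord k (F i)) -> ord k (\sum_(i <- r | P i) F i).
Proof. by move=> H w wk; rewrite nc_sumE big1 // => i Pi; exact: H. Qed.
Lemma ordM k l a b : ord k a -> ord l b -> ord (k + l) (a * b).
Proof.
move=> H1 H2 w wk; rewrite ncME big1 // => i _.
case: (ltnP (size (take i w)) k) => [/H1->|ki]; first by rewrite mul0r.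
rewrite [X in _ * X]H2 ?mulr0 // size_drop.
have := ltn_ord i; move: ki; rewrite size_take; case: ifP; lia.
Qed.
Lemma ordX a n : ord 1 a -> ord n (a ^+ n).
Proof. by move=> H; elim: n => [|n IH] //; rewrite exprS -add1n; exact: ordM. Qed.

Lemma suppW K K' a : (K <= K')%N -> supp K a -> supp K' a.
Proof. by move=> KK H w wK; apply: H; exact: leq_ltn_trans wK. Qed.
Lemma suppD K a b : supp K a -> supp K b -> supp K (a + b).
Proof. by move=> H1 H2 w wk; rewrite ncDE H1 // H2 // addr0. Qed.
Lemma suppN K a : supp K a -> supp K (- a).
Proof. by move=> H w wk; rewrite ncNE H // oppr0. Qed.
Lemma suppZ K (c : R) a : supp K a -> supp K (c *: a).
Proof. by move=> H w wk; rewrite ncZE H // mulr0. Qed.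
Lemma supp_sum K (I : Type) (r : seq I) (P : pred I) (F : I -> nc) :
  (forall i, P i -> supp K (F i)) -> supp K (\sum_(i <- r | P i) F i).
Proof. by move=> H w wk; rewrite nc_sumE big1 // => i Pi; exact: H. Qed.
Lemma suppM K L a b : supp K a -> supp L b -> supp (K + L) (a * b).
Proof.
move=> H1 H2 w wk; rewrite ncME big1 // => i _.
case: (ltnP K (size (take i w))) => [/H1->|ki]; first by rewrite mul0r.
rewrite [X in _ * X]H2 ?mulr0 // size_drop.
have := ltn_ord i; move: ki; rewrite size_take; case: ifP; lia.
Qed.
Lemma supp1 : supp 0 (1 : nc).
Proof. by case. Qed.
Lemma suppX K a n : supp K a -> supp (n * K) (a ^+ n).
Proof.
move=> H; elim: n => [|n IH]; first by rewrite expr0; exact: supp1.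
by rewrite exprS mulSn; exact: suppM.
Qed.

(** The dilation of the free algebra: an algebra endomorphism that multiplies every letter by
    [t]. *)
Definition dil (t : R) (a : nc) : nc := fun w => t ^+ size w * a w.

Lemma dilD t a b : dil t (a + b) = dil t a + dil t b.
Proof. by apply/funext => w; rewrite /dil !ncDE mulrDr. Qed.
Lemma dilZ t (c : R) a : dil t (c *: a) = c *: dil t a.
Proof. by apply/funext => w; rewrite /dil !ncZE mulrCA. Qed.
Lemma dilN t a : dil t (- a) = - dil t a.
Proof. by apply/funext => w; rewrite /dil !ncNE mulrN. Qed.
Lemma dil_sum t (I : Type) (r : seq I) (F : I -> nc) :
  dil t (\sum_(i <- r) F i) = \sum_(i <- r) dil t (F i).
Proof.
apply/funext => w; rewrite /dil nc_sumE mulr_sumr [RHS]nc_sumE.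
by apply: eq_bigr.
Qed.
Lemma dilM t a b : dil t (a * b) = dil t a * dil t b.
Proof.
apply/funext => w; rewrite /dil !ncME mulr_sumr; apply: eq_bigr => i _.
rewrite mulrACA -exprD -size_cat cat_take_drop //.
Qed.
Lemma dil1 t : dil t 1 = 1.
Proof. by apply/funext => -[|x w]; rewrite /dil !nc1E ?expr0 ?mul1r ?mulr0. Qed.
Lemma dilX t a n : dil t (a ^+ n) = dil t a ^+ n.
Proof. by elim: n => [|n IH]; rewrite ?expr0 ?dil1 // !exprS dilM IH. Qed.
Lemma dil_eqm t m a b : eqm m a b -> eqm m (dil t a) (dil t b).
Proof. by move=> H w wm; rewrite /dil H. Qed.

Definition ncgen (i : 'I_d) : nc := fun w => (w == [:: i])%:R.
Lemma ord_gen i : ord 1 (ncgen i).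
Proof. by case. Qed.
Lemma supp_gen i : supp 1 (ncgen i).
Proof. by case=> // x [|y w] // _; rewrite /ncgen eqseq_cons andbF. Qed.

Definition brk (a b : nc) : nc := a * b - b * a.
Lemma brkDr a b c : brk a (b + c) = brk a b + brk a c.
Proof. by rewrite /brk mulrDr mulrDl opprD addrACA. Qed.
Lemma brkDl a b c : brk (a + b) c = brk a c + brk b c.
Proof. by rewrite /brk mulrDr mulrDl opprD addrACA. Qed.
Lemma brkZr (k : R) a b : brk a (k *: b) = k *: brk a b.
Proof. by rewrite /brk -scalerAr -scalerAl scalerBr. Qed.
Lemma brkZl (k : R) a b : brk (k *: a) b = k *: brk a b.
Proof. by rewrite /brk -scalerAr -scalerAl scalerBr. Qed.
Lemma brk0r a : brk a 0 = 0. Proof. by rewrite /brk mulr0 mul0r subrr. Qed.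
Lemma brk0l a : brk 0 a = 0. Proof. by rewrite /brk mulr0 mul0r subrr. Qed.
Lemma brk_sumr (I : Type) (r : seq I) (F : I -> nc) a :
  brk a (\sum_(i <- r) F i) = \sum_(i <- r) brk a (F i).
Proof. by elim/big_rec2: _ => [|i x y _ <-]; rewrite ?brk0r ?brkDr. Qed.
Lemma brk_suml (I : Type) (r : seq I) (F : I -> nc) a :
  brk (\sum_(i <- r) F i) a = \sum_(i <- r) brk (F i) a.
Proof. by elim/big_rec2: _ => [|i x y _ <-]; rewrite ?brk0l ?brkDl. Qed.
Lemma brk_jacobi a b c : brk (brk a b) c = brk a (brk b c) - brk b (brk a c).
Proof.
rewrite /brk !mulrBl !mulrBr !mulrA.
move: (a * b * c) (b * a * c) (c * a * b) (c * b * a) (a * c * b) (b * c * a) => *.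
by apply/funext => w; rewrite !(ncDE, ncNE); ring.
Qed.
Lemma ord_brk k l a b : ord k a -> ord l b -> ord (k + l) (brk a b).
Proof. by move=> H1 H2; apply: ordD; [|apply: ordN; rewrite addnC]; exact: ordM. Qed.
Lemma supp_brk k l a b : supp k a -> supp l b -> supp (k + l) (brk a b).
Proof. by move=> H1 H2; apply: suppD; [|apply: suppN; rewrite addnC]; exact: suppM. Qed.
Lemma eqm_brk m a b a' b' : eqm m a a' -> eqm m b b' -> eqm m (brk a b) (brk a' b').
Proof. by move=> H1 H2; apply: eqmD; [|apply: eqmN]; exact: eqmM. Qed.
Lemma dil_brk t a b : dil t (brk a b) = brk (dil t a) (dil t b).
Proof. by rewrite /brk dilD dilN !dilM. Qed.

End NCSeries.

(** * Truncated exponential and logarithm *)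

Section ExpLog.
Variables (R : realType) (d : nat).
Local Notation A := (nc R d).
Implicit Types (a b z : A).

Definition ncexp (m : nat) a : A := \sum_(n < m.+1) (n`!%:R)^-1 *: a ^+ n.
Definition nclog (m : nat) b : A := \sum_(n < m) ((-1) ^+ n / (n.+1)%:R) *: (b - 1) ^+ n.+1.

Section PolynomialIdentity.
Variable m : nat.

(** Only powers of a single element occur in log(exp a), so the identity can be proved between
    polynomials in one commuting variable and then evaluated. *)
Definition expP : {poly R} := \sum_(n < m.+1) (n`!%:R)^-1 *: 'X^n.
Definition logP : {poly R} := \sum_(n < m) ((-1) ^+ n / (n.+1)%:R) *: 'X^(n.+1).

Lemma expP0 : expP.[0] = 1.
Proof.
rewrite /expP big_ord_recl hornerD hornerZ hornerXn expr0 mulr1 fact0 invr1 horner_sum big1 ?addr0 // => i _.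
by rewrite hornerZ hornerXn expr0n mulr0.
Qed.

Lemma fact_neq0 n : n`!%:R != 0 :> R.
Proof. by rewrite pnatr_eq0 -lt0n fact_gt0. Qed.

Lemma deriv_expP : expP^`() = expP - (m`!%:R)^-1 *: 'X^m.
Proof.
have -> : expP - (m`!%:R)^-1 *: 'X^m = \sum_(i < m) (i`!%:R)^-1 *: 'X^i.
  by rewrite /expP big_ord_recr /= addrK.
rewrite /expP big_ord_recl derivD !linear_sum /= expr0 derivZ -(polyC1) derivC scaler0 add0r.
apply: eq_bigr => i _; rewrite /bump /= add1n derivZ derivXn /= -[_ *+ i.+1]scaler_nat scalerA; congr (_ *: _).
rewrite factS natrM invfM mulrAC mulVf ?mul1r // pnatr_eq0 //.
Qed.

Lemma deriv_logP : (1 + 'X) * logP^`() = 1 - (- 'X) ^+ m.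
Proof.
have -> : logP^`() = \sum_(i < m) (- 'X) ^+ i.
  rewrite /logP linear_sum /=; apply: eq_bigr => i _.
  rewrite derivZ derivXn /= -['X^i *+ _]scaler_nat scalerA -mulrA mulVf ?mulr1 ?pnatr_eq0 //.
  by rewrite [in RHS]exprNn -mul_polyC rmorphXn rmorphN1.
rewrite -[1 in RHS](expr1n _ m) subrXX; congr (_ * _); first by rewrite opprK.
by apply: eq_bigr => i _; rewrite expr1n mul1r.
Qed.

Lemma coprime_Xn_exp : coprimep ('X^m) expP.
Proof.
apply: coprimep_expl; rewrite coprimep_sym coprimepX /root expP0; exact: oner_neq0.
Qed.

(* Both polynomials vanish at 0 and have the same derivative modulo [X^m]. *)
Lemma logP_expP i : (i <= m)%N -> (logP \Po (expP - 1) - 'X)`_i = 0.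
Proof.
set c := expP - 1; set Q := logP \Po c.
have dc : 'X^m %| c ^+ m.
  apply: dvdp_exp2r; rewrite -['X]subr0 dvdp_XsubCl /root /c hornerD expP0 hornerN hornerC subrr.
  by [].
have dvd : 'X^m %| Q^`() - 1.
  (* Multiplication by [expP], which is coprime to X^m, turns the chain rule into the geometric sum
     of [deriv_logP]. *)
  rewrite -(Gauss_dvdpr _ coprime_Xn_exp).
  have E1 : expP * (logP^`() \Po c) = 1 - (- c) ^+ m.
    have := congr1 (fun p => p \Po c) deriv_logP.
    rewrite comp_polyM comp_polyB comp_polyD comp_polyX rmorphXn /= rmorphN /= comp_polyX.
    by rewrite comp_polyC /c subrKC.
  have E2 : c^`() = expP^`() by rewrite /c derivB derivC subr0.
  rewrite /Q deriv_comp mulrBr mulr1 mulrA E1 E2 deriv_expP mulrBl mul1r.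
  have -> : expP - (m`!%:R)^-1 *: 'X^m - (- c) ^+ m * (expP - (m`!%:R)^-1 *: 'X^m) - expP =
    - ((m`!%:R)^-1 *: 'X^m) - (- c) ^+ m * (expP - (m`!%:R)^-1 *: 'X^m) by ring.
  apply: dvdp_sub; first by rewrite dvdpNr -mul_polyC; exact: dvdp_mull (dvdpp _).
  by apply: dvdp_mulr; rewrite exprNn; apply: dvdp_mull.
have Q0 : Q.[0] = 0.
  rewrite /Q horner_comp /c hornerD expP0 hornerN hornerC subrr /logP horner_sum big1 // => j _.
  by rewrite hornerZ hornerXn expr0n mulr0.
case: i => [_|i im].
  by rewrite coefB coefX subr0 -horner_coef0 Q0.
rewrite coefB coefX eqSS.
have := dvdpP _ _ dvd => -[q Eq].
have : (Q^`() - 1)`_i = 0 by rewrite Eq coefMXn im.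
rewrite coefB coef_deriv coef1 => /eqP; rewrite subr_eq0 => /eqP H.
have i1 : (i.+1)%:R != 0 :> R by rewrite pnatr_eq0.
apply: (mulfI i1); rewrite mulrBr mulr0 mulr_natl H.
case: eqP => [->|_]; first by rewrite mulr1 subrr.
by rewrite mulr0 subr0.
Qed.

End PolynomialIdentity.

Lemma horner_algZ a (c : R) (p : {poly R}) : horner_alg a (c *: p) = c *: horner_alg a p.
Proof. by rewrite linearZ /= mulr_algl. Qed.

Lemma horner_alg_coef a (p : {poly R}) : horner_alg a p = \sum_(i < size p) p`_i *: a ^+ i.
Proof.
rewrite -{1}(coefK p) poly_def rmorph_sum; apply: eq_bigr => i _.
by rewrite /= horner_algZ rmorphXn /= horner_algX.
Qed.

Lemma horner_alg_comp a (p q : {poly R}) :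
  horner_alg a (p \Po q) = horner_alg (horner_alg a q) p.
Proof.
rewrite comp_polyE rmorph_sum horner_alg_coef; apply: eq_bigr => i _.
by rewrite /= horner_algZ rmorphXn.
Qed.

Lemma ncexpE m a : ncexp m a = horner_alg a (expP m).
Proof.
rewrite /expP rmorph_sum; apply: eq_bigr => i _.
by rewrite /= horner_algZ rmorphXn /= horner_algX.
Qed.

Lemma nclogE m b : nclog m b = horner_alg (b - 1) (logP m).
Proof.
rewrite /logP rmorph_sum; apply: eq_bigr => i _.
by rewrite /= horner_algZ rmorphXn /= horner_algX.
Qed.

(** The polynomial log(exp X) - X only has terms of degree > m; evaluated at [a], which has no
    constant term, these have order > m. *)
Lemma log_exp m a : ord 1 a -> eqm m (nclog m (ncexp m a)) a.
Proof.
move=> oa; rewrite nclogE ncexpE.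
have -> : horner_alg a (expP m) - 1 = horner_alg a (expP m - 1).
  by rewrite rmorphB rmorph1.
rewrite -horner_alg_comp.
have : eqm m (horner_alg a (logP m \Po (expP m - 1) - 'X)) 0.
  rewrite horner_alg_coef; apply: ord_eqm; apply: ord_sum => i _.
  case: (leqP i m) => im; first by rewrite logP_expP // scale0r.
  by apply: ordZ; apply: ordW im _; exact: ordX.
rewrite rmorphB /= horner_algX => H w wm; have := H w wm.
by rewrite ncDE ncNE nc0E => /eqP; rewrite subr_eq0 => /eqP.
Qed.

End ExpLog.

(** * Curves of series and the differential of the exponential *)

Section Curves.
Variables (R : realType) (d : nat).
Local Notation A := (nc R d).
Implicit Types (a b z : A).

(** The derivative is coefficientwise and at t = 0 only; each coefficient of a product is a finite
    sum, so the product rule follows from the scalar one. *)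
Definition cder (g : R -> A) (g' : A) :=
  forall w, is_derive (0 : R) (1 : R) (fun t => g t w) (g' w).

Lemma cder_cst a : cder (fun=> a) 0.
Proof. by move=> w; exact: is_derive_cst. Qed.

Lemma cderD f g f' g' : cder f f' -> cder g g' -> cder (fun t => f t + g t) (f' + g').
Proof. by move=> H1 H2 w; exact: (is_deriveD (H1 w) (H2 w)). Qed.

Lemma cderM f g f' g' : cder f f' -> cder g g' ->
  cder (fun t => f t * g t) (f' * g 0 + f 0 * g').
Proof.
move=> H1 H2 w.
have -> : (fun t => (f t * g t) w) =
    \sum_(i < (size w).+1) (fun t => f t (take i w)) * (fun t => g t (drop i w)).
  by apply/funext => t; rewrite ncME fct_sumE.
apply: is_derive_eq.
  by apply: is_derive_sum => i; exact: (is_deriveM (H1 _) (H2 _)).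
rewrite ncDE !ncME -big_split; apply: eq_bigr => i _ /=.
by rewrite addrC; congr (_ + _); exact: mulrC.
Qed.

Lemma cderZ (c : R) f f' : cder f f' -> cder (fun t => c *: f t) (c *: f').
Proof. by move=> H w; exact: (is_deriveZ c (H w)). Qed.

Lemma cder_sum n (f : 'I_n -> R -> A) (f' : 'I_n -> A) :
  (forall i, cder (f i) (f' i)) -> cder (fun t => \sum_i f i t) (\sum_i f' i).
Proof.
move=> H w.
have -> : (fun t => (\sum_i f i t) w) = \sum_i (fun t => f i t w).
  by apply/funext => t; rewrite nc_sumE fct_sumE.
rewrite nc_sumE; apply: is_derive_sum => i; exact: H.
Qed.

Lemma cder_scale b : cder (fun t => t *: b) b.
Proof.
move=> w; have H := is_deriveM (is_derive_id (0 : R) (1 : R)) (is_derive_cst (b w) (0 : R) (1 : R)).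
have -> : (fun t => (t *: b) w) = (id : R -> R) * cst (b w) by apply/funext => t.
apply: is_derive_eq.
by rewrite scaler0 add0r /cst /GRing.scale /= mulr1.
Qed.

(* Noncommutative derivative of [a ^+ n] in the direction [z]. *)
Fixpoint dpow (n : nat) a z : A :=
  if n is n'.+1 then dpow n' a z * a + a ^+ n' * z else 0.

Lemma cderX f f' n : cder f f' -> cder (fun t => f t ^+ n) (dpow n (f 0) f').
Proof.
move=> H; elim: n => [|n IH]; first exact: cder_cst.
have := cderM IH H.
by congr (cder _ _); apply/funext => t; rewrite exprSr.
Qed.

Lemma cder_line a b : cder (fun t => a + t *: b) b.
Proof. by have := cderD (cder_cst a) (cder_scale b); rewrite add0r. Qed.

Lemma eqm_dpow m n a a' z z' : eqm m a a' -> eqm m z z' -> eqm m (dpow n a z) (dpow n a' z').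
Proof.
move=> H1 H2; elim: n => //= n IH; apply: eqmD; apply: eqmM => //; exact: eqmX.
Qed.

Definition adn n a b : A := iter n (brk a) b.

Lemma eqm_adn m n a a' b b' : eqm m a a' -> eqm m b b' -> eqm m (adn n a b) (adn n a' b').
Proof. by move=> H1 H2; elim: n => //= n IH; exact: eqm_brk. Qed.

Lemma ord_adn n a b : ord 1 a -> ord 1 b -> ord n.+1 (adn n a b).
Proof. by move=> H1 H2; elim: n => //= n IH; rewrite -add1n; exact: ord_brk. Qed.

(** All factors [a] are moved to the left of [z]: passing one of them across ad(a)^k z costs
    -ad(a)^(k+1) z, and Pascal's rule collects the coefficients. *)
Lemma dpow_adn n a z : dpow n.+1 a z =
  \sum_(k < n.+1) ((-1) ^+ k * 'C(n.+1, k.+1)%:R) *: (a ^+ (n - k) * adn k a z).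
Proof.
elim: n => [|n IH].
  by rewrite big_ord_recl big_ord0 addr0 /= mul0r add0r subnn !expr0 !mul1r binn scale1r.
rewrite -[LHS]/(dpow n.+1 a z * a + a ^+ n.+1 * z) IH.
have E1 : (\sum_(k < n.+1) ((-1) ^+ k * 'C(n.+1, k.+1)%:R) *: (a ^+ (n - k) * adn k a z)) * a =
  \sum_(k < n.+1) ((-1) ^+ k * 'C(n.+1, k.+1)%:R) *: (a ^+ (n.+1 - k) * adn k a z) -
  \sum_(k < n.+1) ((-1) ^+ k * 'C(n.+1, k.+1)%:R) *: (a ^+ (n - k) * adn k.+1 a z).
  rewrite mulr_suml -sumrB; apply: eq_bigr => k _.
  rewrite -scalerAl -scalerBr; congr (_ *: _).
  rewrite subSn -1?ltnS // exprSr -!mulrA -mulrBr; congr (_ * _).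
  by rewrite [adn k.+1 a z]iterS -/(adn k a z) /brk opprB addrC subrK.
rewrite E1; under [RHS]eq_bigr => k _ do rewrite binS natrD mulrDr scalerDl.
rewrite big_split /= [X in _ = X + _]big_ord_recr /= bin_small // mulr0 scale0r addr0.
rewrite [X in _ = _ + X]big_ord_recl /= expr0 bin0 mul1r scale1r subn0.
rewrite -addrA; congr (_ + _); rewrite addrC; congr (_ + _).
rewrite -sumrN; apply: eq_bigr => k _.
by rewrite /bump /= add1n subSS exprS mulN1r mulNr scaleNr.
Qed.

Lemma triangular_sum (F : nat -> nat -> A) m :
  \sum_(n < m) \sum_(k < n.+1) F (n - k)%N k = \sum_(j < m) \sum_(k < m - j) F j k.
Proof.
elim: m => [|m IH]; first by rewrite !big_ord0.
rewrite big_ord_recr /= IH.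
have -> : \sum_(k < m.+1) F (m - k)%N k = \sum_(j < m.+1) F j (m - j)%N.
  rewrite (reindex_inj rev_ord_inj) /=; apply: eq_bigr => i _.
  by rewrite subSS subKn // -ltnS.
under [RHS]eq_bigr => j _.
  rewrite subSn -1?ltnS // big_ord_recr /=; over.
rewrite big_split /=; congr (_ + _).
by rewrite big_ord_recr /= subnn big_ord0 addr0.
Qed.

(** In the square of indices, the terms with j + k >= m have order > m, and only the triangle
    remains. *)
Lemma triangular_eqm (F : nat -> nat -> A) m :
  (forall j k, ord (j + k).+1 (F j k)) ->
  eqm m (\sum_(j < m.+1) \sum_(k < m.+1) F j k)
        (\sum_(n < m) \sum_(k < n.+1) F (n - k)%N k).
Proof.
move=> oF; rewrite triangular_sum big_ord_recr /= -[X in eqm _ _ X]addr0.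
apply: eqmD; last first.
  apply: ord_eqm; apply: ord_sum => k _; apply: ordW (oF m k).
  by rewrite ltnS leq_addr.
apply: eqm_sum => j _.
rewrite -!(big_mkord xpredT (F j)) (@big_cat_nat _ _ _ (m - j)) //=; last first.
  by apply: leq_trans (leq_subr _ _) _.
rewrite -[X in eqm _ _ X]addr0; apply: eqmD => //.
apply: ord_eqm; rewrite big_nat; apply: ord_sum => k /andP[k1 _].
apply: ordW (oF j k); rewrite ltnS -leq_subLR //.
Qed.

(* Coefficients of (1 - e^(-x)) / x. *)
Definition dexpc (k : nat) : R := (-1) ^+ k / (k.+1)`!%:R.

(** The classical formula: the differential of exp at a along z is exp(a) times (1 - e^(-ad a)) /
    (ad a) applied to z. After [dpow_adn] it rests on C(n+1, k+1) / (n+1)! = 1 / ((n-k)! (k+1)!),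
    which separates the exponential factor from the series in ad a. *)
Lemma dexp m a z : ord 1 a -> ord 1 z ->
  eqm m (\sum_(n < m) ((n.+1)`!%:R)^-1 *: dpow n.+1 a z)
        (ncexp m a * \sum_(k < m.+1) dexpc k *: adn k a z).
Proof.
move=> oa oz.
pose F j k : A := ((j`!%:R)^-1 * dexpc k) *: (a ^+ j * adn k a z).
have oF j k : ord (j + k).+1 (F j k).
  by apply: ordZ; rewrite -addnS; apply: ordM; [exact: ordX|exact: ord_adn].
have -> : ncexp m a * (\sum_(k < m.+1) dexpc k *: adn k a z) =
    \sum_(j < m.+1) \sum_(k < m.+1) F j k.
  rewrite /ncexp mulr_suml; apply: eq_bigr => j _; rewrite mulr_sumr; apply: eq_bigr => k _.
  by rewrite /F -scalerAl -scalerAr scalerA.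
apply: eqm_sym; apply: eqm_trans (triangular_eqm oF) _.
apply: eqm_sum => n _; rewrite dpow_adn scaler_sumr; apply: eqm_sum => k _.
rewrite /F scalerA /dexpc => w _; congr ((_ *: _) w).
have kn : (k <= n)%N by rewrite -ltnS.
have := @bin_fact n.+1 k.+1 (ltn_ord k); rewrite subSS => <-.
have := fact_neq0 R (n - k); have := fact_neq0 R k.+1.
have : 'C(n.+1, k.+1)%:R != 0 :> R by rewrite pnatr_eq0 -lt0n bin_gt0.
move: ((-1) ^+ k) ((n - k)`!) (k.+1`!) ('C(n.+1, k.+1)) => e p q r r0 q0 p0.
by rewrite !natrM; field; rewrite ?p0 ?q0 ?r0.
Qed.

(** The coefficients of x / (1 - e^(-x)) up to degree m. They come from a Bezout relation between
    the truncated series [g], of constant term 1, and X^(m+1), divided by its constant value [k]. *)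
Lemma dexpc_inverse m : exists c : nat -> R, c 0%N = 1 /\
  forall n, (n <= m)%N -> \sum_(k < n.+1) dexpc (n - k) * c k = (n == 0%N)%:R.
Proof.
pose g : {poly R} := \poly_(i < m.+1) dexpc i.
have g0 : g.[0] = 1 by rewrite horner_coef0 coef_poly /dexpc expr0 factS fact0 muln1 invr1 mulr1.
have cop : coprimep g ('X^(m.+1)).
  by rewrite coprimep_sym; apply: coprimep_expl; rewrite coprimep_sym coprimepX /root g0 oner_neq0.
have [[u v] /= Huv] := Bezout_coprimepP _ _ cop.
have [k k0 Ek] : exists2 k : R, k != 0 & u * g + v * 'X^(m.+1) = k%:P.
  by have := Huv; rewrite -size_poly_eq1 => /size_poly1P[k k0 Ek]; exists k.
have H n : (n <= m)%N -> \sum_(i < n.+1) dexpc (n - i) * (k^-1 *: u)`_i = (n == 0%N)%:R.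
  move=> nm.
  have : (u * g + v * 'X^(m.+1))`_n = k * (n == 0%N)%:R.
    by rewrite Ek coefC; case: eqP; rewrite ?mulr1 ?mulr0.
  rewrite coefD coefMXn ltnS nm addr0 coefM => E.
  apply: (mulfI k0); rewrite -E mulr_sumr; apply: eq_bigr => i _.
  rewrite coefZ coef_poly ltnS (leq_trans (leq_subr _ _) nm).
  by move: (dexpc _) (u`_i) => x y; field.
exists (fun i => (k^-1 *: u)`_i); split; last exact: H.
have := H 0%N (leq0n m); rewrite big_ord_recl big_ord0 addr0.
by rewrite subnn /dexpc expr0 factS fact0 muln1 invr1 mulr1 mul1r.
Qed.

(** With the coefficients of [dexpc_inverse], this is (ad a) / (1 - e^(-ad a)) applied to [b]: the
    direction along which exp at [a] has derivative exp(a) b. *)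
Definition Zser m (c : nat -> R) a b : A := \sum_(k < m.+1) c k *: adn k a b.

Lemma ord_Zser m (c : nat -> R) a b : ord 1 a -> ord 1 b -> ord 1 (Zser m c a b).
Proof. by move=> oa ob; apply: ord_sum => k _; apply: ordZ; apply: (@ordW R d k.+1 1 _ _ (@ord_adn k a b oa ob)). Qed.

Lemma adnZ n a (c : R) b : adn n a (c *: b) = c *: adn n a b.
Proof. by elim: n => //= n ->; rewrite brkZr. Qed.

Lemma adn_sum n a (I : Type) (r : seq I) (F : I -> A) :
  adn n a (\sum_(i <- r) F i) = \sum_(i <- r) adn n a (F i).
Proof. by elim: n => //= n ->; rewrite brk_sumr. Qed.

(** Series in the single operator ad a multiply like scalar power series, and the Cauchy product of
    the two coefficient sequences is 1 up to degree m. *)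
Lemma Zser_inverse m (c : nat -> R) a b : ord 1 a -> ord 1 b ->
  (forall n, (n <= m)%N -> \sum_(k < n.+1) dexpc (n - k) * c k = (n == 0%N)%:R) ->
  eqm m (\sum_(k < m.+1) dexpc k *: adn k a (Zser m c a b)) b.
Proof.
move=> oa ob Hc.
pose F j k : A := (dexpc j * c k) *: adn (j + k) a b.
have oF j k : ord (j + k).+1 (F j k) by apply: ordZ; exact: ord_adn.
have -> : \sum_(j < m.+1) dexpc j *: adn j a (Zser m c a b) =
    \sum_(j < m.+1) \sum_(k < m.+1) F j k.
  apply: eq_bigr => j _; rewrite /Zser adn_sum scaler_sumr; apply: eq_bigr => k _.
  by rewrite adnZ scalerA /F /adn iterD.
apply: eqm_trans (triangular_eqm oF) _.
have -> : \sum_(n < m) \sum_(k < n.+1) F (n - k)%N k = \sum_(n < m) (val n == 0%N)%:R *: adn n a b.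
  apply: eq_bigr => n _; rewrite -(Hc n (ltnW (ltn_ord n))) scaler_suml; apply: eq_bigr => k _.
  by rewrite /F subnK // -ltnS.
case: m {Hc F oF} => [|m]; first by rewrite big_ord0; apply: eqm_sym; exact: ord_eqm.
rewrite big_ord_recl big1 ?addr0 ?scale1r // => i _.
by rewrite scale0r.
Qed.

(* [log (exp a exp (t b))] and [a + t z] with [z = Zser m c a b] have exponentials that are
   tangent at [t = 0], by [dexp]; so their logarithms are tangent as well. *)
Lemma log_curve m (c : nat -> R) a b w : ord 1 a -> ord 1 b ->
  (forall n, (n <= m)%N -> \sum_(k < n.+1) dexpc (n - k) * c k = (n == 0%N)%:R) ->
  (size w <= m)%N ->
  is_derive (0 : R) (1 : R) (fun t => nclog m (ncexp m a * ncexp m (t *: b)) w) (Zser m c a b w).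
Proof.
move=> oa ob Hc wm.
set z := Zser m c a b.
have oz : ord 1 z by exact: ord_Zser.
have dexpc' f f' : cder f f' ->
    cder (fun t => ncexp m (f t)) (\sum_(n < m) ((n.+1)`!%:R)^-1 *: dpow n.+1 (f 0) f').
  move=> H; have := cder_sum (fun n : 'I_m.+1 => cderZ (n`!%:R)^-1 (cderX n H)).
  by rewrite big_ord_recl scaler0 add0r.
have dlog f f' : cder f f' ->
    cder (fun t => nclog m (f t)) (\sum_(n < m) ((-1) ^+ n / (n.+1)%:R) *: dpow n.+1 (f 0 - 1) f').
  move=> H; have H' := cderD H (cder_cst (- 1)); rewrite addr0 in H'.
  exact: (cder_sum (fun n : 'I_m => cderZ ((-1) ^+ n / (n.+1)%:R) (cderX n.+1 H'))).
have D1 := dlog _ _ (dexpc' _ _ (cder_line a z)).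
have D2 := dlog _ _ (cderM (cder_cst (ncexp m a)) (dexpc' _ _ (cder_scale b))).
move: D1 D2; cbv beta; rewrite mul0r add0r !scale0r addr0 => D1 D2.
have E0 : ncexp m (0 : A) = 1.
  rewrite /ncexp big_ord_recl expr0 fact0 invr1 scale1r big1 ?addr0 // => i _.
  by rewrite expr0n /= scaler0.
have E1 : eqm m (\sum_(n < m) ((n.+1)`!%:R)^-1 *: dpow n.+1 a z)
   (ncexp m a * \sum_(n < m) ((n.+1)`!%:R)^-1 *: dpow n.+1 0 b).
  apply: eqm_trans (dexp oa oz) _; apply: eqmM => //.
  apply: eqm_trans (Zser_inverse oa ob Hc) _.
  case: m {Hc z oz dexpc' dlog D1 D2 E0 wm} => [|m]; first by rewrite big_ord0; exact: ord_eqm.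
  rewrite big_ord_recl big1 => [|i _].
    by rewrite /= mul0r add0r expr0 mul1r factS fact0 muln1 invr1 scale1r addr0.
  by rewrite /= mulr0 add0r exprS !mul0r scaler0.
have H1 : is_derive (0 : R) (1 : R) (fun t => nclog m (ncexp m (a + t *: z)) w) (z w).
  have -> : (fun t => nclog m (ncexp m (a + t *: z)) w) = (fun t => (a + t *: z) w).
    apply/funext => t; apply: log_exp => //; apply: ordD => //; exact: ordZ.
  exact: cder_line.
have := D2 w; rewrite E0 mulr1.
have -> // : (\sum_(n < m) ((-1) ^+ n / n.+1%:R) *:
    dpow n.+1 (ncexp m a - 1) (ncexp m a * \sum_(n < m) ((n.+1)`!%:R)^-1 *: dpow n.+1 0 b)) w = z w.
rewrite -(@derive_val _ _ _ _ _ _ _ H1) (@derive_val _ _ _ _ _ _ _ (D1 w)).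
apply: (@eqm_sum _ _ m) wm => n _; apply: eqmZ; apply: eqm_dpow => //; exact: eqm_sym.
Qed.

End Curves.

(** * Iterated brackets and comparison with the truncated algebra *)

Section LieElements.
Variables (R : realType) (d : nat).
Local Notation A := (nc R d).

(** The recursion of [brY] with the untruncated bracket, so that the result can act through words of
    fields that satisfy no nilpotency relation. *)
Fixpoint lie (J : seq 'I_d) : A :=
  match J with
  | [::] => 0
  | [:: i] => ncgen R i
  | i :: J' => brk (ncgen R i) (lie J')
  end.

Lemma lie_cons i J : J != [::] -> lie (i :: J) = brk (ncgen R i) (lie J).
Proof. by case: J. Qed.

Lemma ord_lie J : ord (size J) (lie J).
Proof.
elim: J => // i [|j J] IH; first exact: ord_gen.
rewrite lie_cons // -[size _]/(1 + size (j :: J))%N; apply: ord_brk => //; exact: ord_gen.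
Qed.

Lemma supp_lie J : supp (size J) (lie J).
Proof.
elim: J => // i [|j J] IH; first exact: supp_gen.
rewrite lie_cons // -[size _]/(1 + size (j :: J))%N; apply: supp_brk => //; exact: supp_gen.
Qed.

Lemma lie_homog J w : size w != size J -> lie J w = 0.
Proof. by rewrite neq_ltn => /orP[]; [exact: ord_lie|exact: supp_lie]. Qed.

Lemma dil_lie t J : dil t (lie J) = t ^+ size J *: lie J.
Proof.
apply/funext => w; rewrite /dil ncZE; case: (eqVneq (size w) (size J)) => [->//|H].
by rewrite lie_homog // !mulr0.
Qed.

Lemma tmulE m (a b : A) w : tmul m a b w = if (size w <= m)%N then (a * b) w else 0.
Proof. by []. Qed.

Lemma eqm_tmul m (a b a' b' : A) : eqm m a a' -> eqm m b b' -> eqm m (tmul m a b) (a' * b').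
Proof. by move=> H1 H2 w wm; rewrite tmulE wm (eqmM H1 H2 wm). Qed.

Lemma eqm_tpow m (a a' : A) n : eqm m a a' -> eqm m (tpow m a n) (a' ^+ n).
Proof.
move=> H; elim: n => [|n IH].
  by move=> w _; rewrite expr0 /tpow /= /tone nc1E; case: ifP.
rewrite exprS; exact: eqm_tmul.
Qed.

Lemma eqm_texp m (a a' : A) : eqm m a a' -> eqm m (texp m a) (ncexp m a').
Proof.
move=> H w wm; rewrite /texp /ncexp nc_sumE; apply: eq_bigr => n _.
by rewrite ncZE (eqm_tpow _ H).
Qed.

Lemma eqm_tlog m (b b' : A) : eqm m b b' -> eqm m (tlog m b) (nclog m b').
Proof.
move=> H w wm; rewrite /tlog /nclog nc_sumE; apply: eq_bigr => n _.
rewrite ncZE; congr (_ * _); apply: (eqm_tpow _ _) wm => {}w wm.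
rewrite /tadd /tscale mulN1r ncDE ncNE H // nc1E /tone; congr (_ - _).
by case: ifP.
Qed.

Lemma tlog_big m (b : A) w : (m < size w)%N -> tlog m b w = 0.
Proof.
move=> wm; rewrite /tlog big1 // => n _.
by rewrite /tpow iterS -/(tpow _ _ _) /tmul leqNgt wm mulr0.
Qed.

(** Truncation only affects words longer than m, on which a bracket of length at most m vanishes by
    homogeneity. *)
Lemma brYE m J : (size J <= m)%N -> brY R m J = lie J.
Proof.
elim: J => // i [|j J] IH Jm.
  by apply/funext => w; rewrite /= /tgen /ncgen; case: ifP.
have IH' := IH (ltnW Jm).
apply/funext => w; rewrite lie_cons // -[LHS]/(tbr m (tgen R i) (brY R m (j :: J)) w).
rewrite IH' /tbr /tadd /tscale !tmulE.
case: (leqP (size w) m) => wm.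
  rewrite /brk ncDE ncNE mulN1r; congr ((_ : A) w - (_ : A) w).
    by congr (_ * _); apply/funext => v; rewrite /tgen /ncgen; case: ifP.
  by congr (_ * _); apply/funext => v; rewrite /tgen /ncgen; case: ifP.
rewrite mulr0 addr0; apply/esym; rewrite -lie_cons //; apply: supp_lie.
exact: leq_ltn_trans Jm wm.
Qed.

End LieElements.

(** * The free nilpotent Lie algebra in the coordinates of a graded basis *)

Section GradedBasis.
Variables (R : realType) (d m N : nat) (Is : 'I_N -> seq 'I_d).
Hypothesis gb : graded_basis R m Is.
Local Notation A := (nc R d).

Lemma size_Is i : (0 < size (Is i) <= m)%N. Proof. by have [H _] := gb. Qed.
Lemma Is_neq0 i : Is i != [::].
Proof. by have /andP[] := size_Is i; case: (Is i). Qed.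
Lemma brY_Is i : brY R m (Is i) = lie R (Is i).
Proof. by apply: brYE; have /andP[] := size_Is i. Qed.

Definition Lc (u : 'rV[R]_N) : A := \sum_i u 0 i *: lie R (Is i).

Lemma Lc_linear (c : R) u v : Lc (c *: u + v) = c *: Lc u + Lc v.
Proof.
rewrite /Lc scaler_sumr -big_split; apply: eq_bigr => i _ /=.
by rewrite !mxE scalerDl scalerA.
Qed.
Lemma LcD u v : Lc (u + v) = Lc u + Lc v.
Proof. by have := Lc_linear 1 u v; rewrite !scale1r. Qed.
Lemma Lc0 : Lc 0 = 0.
Proof. by rewrite /Lc big1 // => i _; rewrite mxE scale0r. Qed.
Lemma LcZ (c : R) u : Lc (c *: u) = c *: Lc u.
Proof. by have := Lc_linear c u 0; rewrite Lc0 !addr0. Qed.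
Lemma LcN u : Lc (- u) = - Lc u.
Proof. by rewrite -scaleN1r LcZ scaleN1r. Qed.
Lemma Lc_sum (I : Type) (r : seq I) (F : I -> 'rV[R]_N) :
  Lc (\sum_(i <- r) F i) = \sum_(i <- r) Lc (F i).
Proof. by elim/big_rec2: _ => [|i x y _ <-]; rewrite ?Lc0 ?LcD. Qed.
Lemma Lc_unitv i : Lc (unitv R i) = lie R (Is i).
Proof.
rewrite /Lc (bigD1 i) //= mxE eqxx scale1r big1 ?addr0 // => j ji.
by rewrite mxE (negbTE ji) scale0r.
Qed.

Lemma Lie_ofE u : Lie_of m Is u = Lc u.
Proof.
apply/funext => w; rewrite /Lie_of /Lc nc_sumE; apply: eq_bigr => i _.
by rewrite brY_Is ncZE.
Qed.

Lemma ord_Lc u : ord 1 (Lc u).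
Proof.
apply: ord_sum => i _; apply: ordZ; apply: (ordW _ (@ord_lie R d (Is i))).
by have /andP[] := size_Is i.
Qed.

Lemma supp_Lc u : supp m (Lc u).
Proof.
apply: supp_sum => i _; apply: suppZ; apply: (suppW _ (@supp_lie R d (Is i))).
by have /andP[] := size_Is i.
Qed.

(** Independence is given degree by degree; a word of length k only sees the basis elements of
    length k, which isolates one degree at a time. *)
Lemma Lc_inj u v : Lc u = Lc v -> u = v.
Proof.
move=> E; have [_ [free _]] := gb.
suff H i : (u - v) 0 i = 0.
  by apply/rowP => i; apply/eqP; rewrite -subr_eq0; have := H i; rewrite !mxE => ->.
apply: (free (size (Is i)) (fun i => (u - v) 0 i)) => // w.
have E0 : Lc (u - v) = 0 by rewrite LcD LcN E subrr.
case: (eqVneq (size w) (size (Is i))) => wk; last first.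
  rewrite big1 // => j /eqP jk; rewrite brY_Is lie_homog ?mulr0 //.
  by rewrite jk.
have := congr1 (fun a : A => a w) E0; rewrite /Lc nc_sumE nc0E => E1; rewrite -[RHS]E1.
rewrite [RHS](bigID (fun j => size (Is j) == size (Is i))) /= [X in _ = _ + X]big1.
  by rewrite addr0; apply: eq_bigr => j _; rewrite brY_Is ncZE.
by move=> j jk; rewrite ncZE lie_homog ?mulr0 // wk eq_sym.
Qed.

Lemma coordsK u : coords m Is (Lc u) = u.
Proof.
rewrite /coords; case: xgetP => [v _ /=|/(_ u)]; first by rewrite Lie_ofE => /Lc_inj.
by rewrite /= Lie_ofE.
Qed.

Lemma lie_Lc J : J != [::] -> (size J <= m)%N -> exists v, lie R J = Lc v.
Proof.
move=> J0 Jm; have [_ [_ span]] := gb.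
have [|c Hc] := span J; first by rewrite Jm andbT; case: J J0 {Jm}.
exists (\row_i (if size (Is i) == size J then c i else 0)).
apply/funext => w; rewrite -(brYE R Jm) Hc /Lc nc_sumE big_mkcond; apply: eq_bigr => i _.
by rewrite mxE ncZE brY_Is; case: ifP; rewrite ?mul0r.
Qed.

Lemma lie_mod_Lc J : J != [::] -> exists v, eqm m (lie R J) (Lc v).
Proof.
move=> J0; case: (leqP (size J) m) => Jm.
  by have [v ->] := lie_Lc J0 Jm; exists v.
exists 0; rewrite Lc0; apply: ord_eqm; exact: (ordW Jm (@ord_lie R d J)).
Qed.

Lemma mod_Lc_sum (I : Type) (r : seq I) (c : I -> R) (F : I -> A) :
  (forall i, exists v, eqm m (F i) (Lc v)) ->
  exists v, eqm m (\sum_(i <- r) c i *: F i) (Lc v).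
Proof.
move=> H; elim: r => [|i r [v Hv]]; first by exists 0; rewrite big_nil Lc0.
have [u Hu] := H i; exists (c i *: u + v).
by rewrite big_cons Lc_linear; apply: eqmD => //; exact: eqmZ.
Qed.

Lemma brk_gen_Lc i (a : A) v : eqm m a (Lc v) -> exists v', eqm m (brk (ncgen R i) a) (Lc v').
Proof.
move=> H.
have [v' Hv'] := @mod_Lc_sum _ (index_enum _) (fun k => v 0 k) (fun k => lie R (i :: Is k))
  (fun k => lie_mod_Lc (isT : i :: Is k != [::])).
exists v'; apply: eqm_trans (eqm_brk (fun w _ => erefl) H) _.
rewrite /Lc brk_sumr; apply: eqm_trans Hv'; apply: eqm_sum => k _.
by rewrite brkZr -lie_cons ?Is_neq0.
Qed.

(** The Jacobi identity removes letters from the left entry one by one, until only right-nested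
    brackets remain. Those longer than m are zero modulo degree > m. *)
Lemma brk_lie_Lc I J : I != [::] -> J != [::] ->
  exists v, eqm m (brk (lie R I) (lie R J)) (Lc v).
Proof.
elim: I J => // i [|j I] IH J _ J0.
  by rewrite -[lie R [:: i]]/(ncgen R i) -lie_cons //; exact: lie_mod_Lc.
rewrite lie_cons // brk_jacobi -(lie_cons R i J0).
have [u Hu] := IH J isT J0; have [u' Hu'] := brk_gen_Lc i Hu.
have [v Hv] := IH (i :: J) isT isT.
exists (u' - v); rewrite LcD LcN.
by apply: eqmD => //; exact: eqmN.
Qed.

Definition struct_const (i l : 'I_N) : 'rV[R]_N :=
  sval (cid (brk_lie_Lc (Is_neq0 i) (Is_neq0 l))).

Lemma struct_constP i l :
  eqm m (brk (lie R (Is i)) (lie R (Is l))) (Lc (struct_const i l)).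
Proof. exact: (svalP (cid (brk_lie_Lc (Is_neq0 i) (Is_neq0 l)))). Qed.

(** The matrix of ad ([Lc u]), modulo degree > m, acting on row vectors of coordinates from the
    right. *)
Definition admx (u : 'rV[R]_N) : 'M[R]_N :=
  \matrix_(l, k) \sum_i u 0 i * struct_const i l 0 k.

Lemma admxP u v : eqm m (brk (Lc u) (Lc v)) (Lc (v *m admx u)).
Proof.
have -> : v *m admx u = \sum_i \sum_l (u 0 i * v 0 l) *: struct_const i l.
  apply/rowP => k; rewrite !mxE exchange_big summxE /=; apply: eq_bigr => l _.
  by rewrite mxE mulr_sumr summxE; apply: eq_bigr => i _; rewrite mxE mulrA [v 0 l * _]mulrC.
rewrite {1}/Lc brk_suml Lc_sum; apply: eqm_sum => i _.
rewrite brkZl {1}/Lc brk_sumr Lc_sum scaler_sumr; apply: eqm_sum => l _.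
by rewrite brkZr LcZ scalerA; apply: eqmZ; exact: struct_constP.
Qed.

Definition adit u k (b : 'rV[R]_N) : 'rV[R]_N := iter k (fun v => v *m admx u) b.

Lemma aditP u k b : eqm m (adn k (Lc u) (Lc b)) (Lc (adit u k b)).
Proof.
elim: k => //= k IH; apply: eqm_trans (admxP _ _).
by apply: eqm_brk.
Qed.

Definition Zc (c : nat -> R) u b : 'rV[R]_N := \sum_(k < m.+1) c k *: adit u k b.

Lemma ZcP c u b : eqm m (Zser m c (Lc u) (Lc b)) (Lc (Zc c u b)).
Proof. by rewrite /Zc Lc_sum; apply: eqm_sum => k _; rewrite LcZ; apply: eqmZ; exact: aditP. Qed.

Definition dexp_inverse (c : nat -> R) := c 0%N = 1 /\
  forall n, (n <= m)%N -> \sum_(k < n.+1) dexpc R (n - k) * c k = (n == 0%N)%:R.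

(** Up to degree m the derivative defining the field is given by [log_curve]; on longer words both
    sides vanish. The field thus becomes a polynomial in the coordinates. *)
Lemma YfieldE c u b : dexp_inverse c -> Yfield m Is (Lc b) u = Zc c u b.
Proof.
move=> [_ Hc]; rewrite /Yfield -[RHS]coordsK; congr (coords m Is _); apply/funext => w.
rewrite Lie_ofE; case: (leqP (size w) m) => wm; last first.
  rewrite (_ : (fun t => _) = cst 0) ?derive1_cst ?(supp_Lc _ wm) //.
  by apply/funext => t; exact: tlog_big.
have -> : (fun t : R => tlog m (tmul m (texp m (Lc u)) (texp m (tscale t (Lc b)))) w) =
    (fun t : R => nclog m (ncexp m (Lc u) * ncexp m (t *: Lc b)) w).
  apply/funext => t; apply: (eqm_tlog _ wm); apply: eqm_tmul; exact: eqm_texp.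
rewrite derive1E (@derive_val _ _ _ _ _ _ _ (log_curve (ord_Lc u) (ord_Lc b) Hc wm)).
exact: ZcP.
Qed.

Lemma admx0 : admx 0 = 0.
Proof. by apply/matrixP => l k; rewrite !mxE big1 // => i _; rewrite mxE mul0r. Qed.

Lemma Zc0 c b : c 0%N = 1 -> Zc c 0 b = b.
Proof.
move=> c0; rewrite /Zc big_ord_recl c0 scale1r big1 ?addr0 // => k _.
by rewrite /= admx0 mulmx0 scaler0.
Qed.

Definition dilc (t : R) (u : 'rV[R]_N) : 'rV[R]_N := \row_i (t ^+ size (Is i) * u 0 i).

Lemma Lc_dilc t u : Lc (dilc t u) = dil t (Lc u).
Proof.
by rewrite dil_sum; apply: eq_bigr => i _; rewrite mxE dilZ dil_lie scalerA mulrC.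
Qed.

(** Homogeneity of degree 1 of the left-invariant field of a generator: brackets commute with
    dilations and the generator scales by [t]. *)
Lemma Zc_dilc c t u b j : Lc b = ncgen R j ->
  t *: Lc (Zc c (dilc t u) b) = dil t (Lc (Zc c u b)).
Proof.
move=> Hb; apply/funext => w; case: (leqP (size w) m) => wm; last first.
  by rewrite ncZE /dil !(supp_Lc _ wm) !mulr0.
have H2 := dil_eqm t (ZcP c u b) wm; rewrite -H2 ncZE -(ZcP c (dilc t u) b wm) -ncZE.
congr ((_ : A) w).
rewrite /Zser scaler_sumr dil_sum; apply: eq_bigr => k _.
rewrite dilZ scalerA mulrC -scalerA; congr (_ *: _).
rewrite -adnZ Lc_dilc Hb.
have -> : t *: ncgen R j = dil t (ncgen R j).
  by have := dil_lie t [:: j]; rewrite expr1.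
by elim: (val k) => //= n ->; rewrite dil_brk.
Qed.

End GradedBasis.

(** * Series with smooth coefficients *)

Section SmoothSeries.
Variables (R : realType) (d : nat) (V : normedModType R) (U : set V).
Hypothesis oU : open U.
Local Notation A := (nc R d).

Definition ncsmooth (f : V -> A) := forall w, smooth U (fun u => f u w).

Lemma ncsmooth_cst a : ncsmooth (fun=> a).
Proof. by move=> w; exact: smooth_cst. Qed.
Lemma ncsmoothD f g : ncsmooth f -> ncsmooth g -> ncsmooth (fun u => f u + g u).
Proof. by move=> H1 H2 w; exact: smoothD. Qed.
Lemma ncsmoothB f g : ncsmooth f -> ncsmooth g -> ncsmooth (fun u => f u - g u).
Proof. by move=> H1 H2 w; exact: smoothB. Qed.
Lemma ncsmoothZ (k : V -> R) f : smooth U k -> ncsmooth f -> ncsmooth (fun u => k u *: f u).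
Proof. by move=> H1 H2 w; exact: smoothM. Qed.
Lemma ncsmoothM f g : ncsmooth f -> ncsmooth g -> ncsmooth (fun u => f u * g u).
Proof. by move=> H1 H2 w; apply: smooth_sum => // i _; exact: smoothM. Qed.
Lemma ncsmooth_sum (I : Type) (r : seq I) (F : I -> V -> A) :
  (forall i, ncsmooth (F i)) -> ncsmooth (fun u => \sum_(i <- r) F i u).
Proof.
move=> H w; apply: (@smooth_eq _ _ U (fun u => \sum_(i <- r) F i u w)) => //.
  by move=> u _; rewrite nc_sumE.
by apply: smooth_sum => // i _; exact: H.
Qed.
Lemma ncsmoothX f n : ncsmooth f -> ncsmooth (fun u => f u ^+ n).
Proof.
move=> H; elim: n => [|n IH]; first exact: ncsmooth_cst.
by move=> w; under eq_fun do rewrite exprS; exact: (ncsmoothM H IH).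
Qed.
Lemma ncsmooth_dpow f g n : ncsmooth f -> ncsmooth g -> ncsmooth (fun u => dpow n (f u) (g u)).
Proof.
move=> H1 H2; elim: n => [|n IH]; first exact: ncsmooth_cst.
by apply: ncsmoothD; apply: ncsmoothM => //; exact: ncsmoothX.
Qed.
Lemma ncsmooth_exp f m : ncsmooth f -> ncsmooth (fun u => ncexp m (f u)).
Proof.
move=> H; apply: ncsmooth_sum => n; apply: ncsmoothZ; first exact: smooth_cst.
exact: ncsmoothX.
Qed.

End SmoothSeries.

(** * The algebraic remainder and its weight *)

Section Discrepancy.
Variables (R : realType) (d m N : nat) (Is : 'I_N -> seq 'I_d).
Hypothesis gb : graded_basis R m Is.
Variables (c : nat -> R) (j : 'I_d) (bj : 'rV[R]_N).
Hypotheses (Hc : dexp_inverse m c) (Hbj : Lc Is bj = ncgen R j).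
Local Notation A := (nc R d).
Local Notation L := (Lc Is).
Let T := @openT 'rV[R]_N.

Lemma smooth_Zc (b : 'rV[R]_N) i : smooth setT (fun u => Zc gb c u b 0 i : R).
Proof.
have sM l k : smooth setT (fun u : 'rV[R]_N => admx gb u l k).
  apply: (@smooth_eq _ _ setT (fun u : 'rV[R]_N => \sum_i0 u 0 i0 * struct_const gb i0 l 0 k)) => //.
    by move=> u _; rewrite mxE.
  apply: smooth_sum => // i0 _; apply: smoothM => //; [exact: smooth_coord|exact: smooth_cst].
have sI k l : smooth setT (fun u => adit gb u k b 0 l : R).
  elim: k l => [|k IH] l; first exact: smooth_cst.
  by apply: (smooth_mulmx T _ sM) => i1 j1; rewrite (ord1 i1).
apply: (@smooth_eq _ _ setT (fun u => \sum_(k < m.+1) c k * adit gb u k b 0 i)) => //.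
  by move=> u _; rewrite /Zc summxE; apply: eq_bigr => k _; rewrite !mxE.
by apply: smooth_sum => // k _; exact: smoothZ.
Qed.

Lemma ncsmooth_Lc (f : 'rV[R]_N -> 'rV[R]_N) : (forall i, smooth setT (fun u => f u 0 i : R)) ->
  ncsmooth setT (fun u => L (f u)).
Proof.
move=> sf; apply: ncsmooth_sum => // i; apply: ncsmoothZ => //; exact: ncsmooth_cst.
Qed.

Definition eta u := Zc gb c u bj.

(** The subtracted sum is the derivative of the truncated exponential at [L u] along the field Y_j,
    whose coordinates are [eta u]. Tensors of degree > m are kept. *)
Definition Xi u : A := ncexp m (L u) * ncgen R j -
  \sum_(n < m) ((n.+1)`!%:R)^-1 *: dpow n.+1 (L u) (L (eta u)).

Lemma Xi_eqm u : eqm m (Xi u) 0.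
Proof.
have oL := ord_Lc gb.
have H : eqm m (\sum_(n < m) ((n.+1)`!%:R)^-1 *: dpow n.+1 (L u) (L (eta u)))
               (ncexp m (L u) * ncgen R j).
  apply: eqm_trans (dexp (oL u) (oL (eta u))) _; apply: eqmM => //.
  have oj : ord 1 (ncgen R j) by exact: ord_gen.
  apply: (eqm_trans _ (Zser_inverse (oL u) oj Hc.2)); apply: eqm_sum => k _; apply: eqmZ.
  by apply: eqm_adn => //; rewrite -Hbj; apply: eqm_sym; exact: ZcP.
by move=> w wm; rewrite /Xi ncDE ncNE (H w wm) subrr.
Qed.

Lemma dpow_dil t n (a z : A) : dil t (dpow n a z) = dpow n (dil t a) (dil t z).
Proof.
elim: n => [|n IH] /=; first by apply/funext => w; rewrite /dil nc0E mulr0.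
by rewrite dilD !dilM IH dilX.
Qed.

Lemma dpowZ (t : R) n (a z : A) : dpow n a (t *: z) = t *: dpow n a z.
Proof. by elim: n => [|n IH] /=; rewrite ?scaler0 // IH scalerDr scalerAl scalerAr. Qed.

(** The coefficient of a word w is homogeneous of weight [size w] - 1, where the 1 is the degree of
    the generator. *)
Lemma Xi_dil t u : t *: Xi (dilc Is t u) = dil t (Xi u).
Proof.
rewrite /Xi scalerBr dilD dilN; congr (_ - _).
  rewrite scalerAr dilM; congr (_ * _).
    rewrite /ncexp dil_sum; apply: eq_bigr => n _.
    by rewrite dilZ dilX Lc_dilc.
  by have := dil_lie t [:: j]; rewrite expr1.
rewrite scaler_sumr dil_sum; apply: eq_bigr => n _.
rewrite dilZ dpow_dil /eta -(Zc_dilc gb c t u Hbj) dpowZ Lc_dilc.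
by rewrite scalerA mulrC -scalerA.
Qed.

Lemma ncsmooth_Xi : ncsmooth setT Xi.
Proof.
have sL : ncsmooth setT (fun u : 'rV[R]_N => L u) by apply: (@ncsmooth_Lc id) => i; exact: smooth_coord.
have sE : ncsmooth setT (fun u => L (eta u)) by apply: (@ncsmooth_Lc eta) => i; exact: smooth_Zc.
apply: ncsmoothB => //.
  by apply: ncsmoothM => //; [exact: ncsmooth_exp|exact: ncsmooth_cst].
apply: ncsmooth_sum => // n; apply: ncsmoothZ => //; first exact: smooth_cst.
exact: ncsmooth_dpow.
Qed.

(* [Xi] has no tensor component of degree at most [m], and by homogeneity the component of
   degree [r] is a function of weight [r - 1 >= m]; scaling by 2 detects the weight. *)
Lemma iderive_Xi w s : (wdeg Is s < m)%N ->
  iderive (map (@unitv R N) s) (fun u => Xi u w : R^o) 0 = 0.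
Proof.
move=> sm; have sX := ncsmooth_Xi w.
case: (leqP (size w) m) => wm.
  have -> : (fun u => Xi u w : R^o) = fun=> 0.
    by apply/funext => u; rewrite Xi_eqm.
  exact: iderive_zero.
set D := iderive _ _ _.
have E1 : 2 * ((\prod_(i <- s) 2 ^+ size (Is i)) * D) = 2 ^+ size w * D :> R.
  have H0 : (\row_i (2 ^+ size (Is i) * (0 : 'rV[R]_N) 0 i)) = 0 :> 'rV[R]_N.
    by apply/rowP => i; rewrite !mxE mulr0.
  have := iderive_diag (fun i => 2 ^+ size (Is i)) s 0 sX.
  cbv beta; rewrite H0 -/D => <-; rewrite /D.
  rewrite -(iderive_scale T) //; last first.
    apply: (smooth_comp T _ sX) => // i.
    apply: (@smooth_eq _ _ setT (fun u : 'rV[R]_N => 2 ^+ size (Is i) * u 0 i)) => //.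
      by move=> u _; rewrite mxE.
    by apply: smoothZ => //; exact: smooth_coord.
  rewrite -(iderive_scale T) //; apply: (iderive_eq T) => // u _.
  have := congr1 (fun a : A => a w) (Xi_dil 2 u).
  by rewrite ncZE /dil.
have E2 : \prod_(i <- s) 2 ^+ size (Is i) = 2 ^+ wdeg Is s :> R.
  by rewrite /wdeg; elim: (s) => [|i s' IH]; rewrite ?big_nil ?expr0 // !big_cons IH exprD.
move: E1; rewrite E2 mulrA -exprS => /eqP; rewrite -subr_eq0 -mulrBl mulf_eq0 => /orP[|/eqP//].
rewrite subr_eq0 => /eqP /(@ieexprIn R 2 _ _) E.
have : (wdeg Is s).+1 = size w by apply: E; rewrite ?ltr0n // gt_eqF // ltr1n.
lia.
Qed.

End Discrepancy.

(** * Vector fields as derivations *)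

Section Derivations.
Variables (R : realType) (V : normedModType R) (A : set V).
Hypothesis oA : open A.

(** This interface serves both fields on one copy of the space and fields on its square. Functions
    being total, [der_eq] expresses that values on [A] only depend on the restriction to [A]. *)
Record derivation_on (T : (V -> R) -> V -> R) : Prop := DerivationOn {
  der_smooth : forall f, smooth A f -> smooth A (T f);
  der_eq : forall f g, (forall x, A x -> f x = g x) -> forall x, A x -> T f x = T g x;
  der_lin : forall f g (c : R), smooth A f -> smooth A g -> forall x, A x ->
    T (fun y => c * f y + g y) x = c * T f x + T g x;
  der_mul : forall f g, smooth A f -> smooth A g -> forall x, A x ->
    T (fun y => f y * g y) x = T f x * g x + f x * T g x }.

Definition ld (G : V -> V) (f : V -> R) : V -> R := fun x => 'D_(G x) f x.

Lemma ld_derivation G : (forall f, smooth A f -> smooth A (ld G f)) -> derivation_on (ld G).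
Proof.
move=> sG; split=> //.
- by move=> f g fg x Ax; rewrite /ld; exact: (open_derive_eq oA fg).
- move=> f g c sf sg x Ax; rewrite /ld (derive_add _ (smoothZ c oA sf) sg Ax).
  congr (_ + _); exact: (@iderive_scale R V A oA f c [:: G x] sf x Ax).
- move=> f g sf sg x Ax; exact: derive_mul.
Qed.

Section Derivation.
Variable T : (V -> R) -> V -> R.
Hypothesis dT : derivation_on T.

Lemma der_cst0 x : A x -> T (fun=> 0) x = 0.
Proof.
move=> Ax; have E := der_lin dT (-1) (smooth_cst A 0) (smooth_cst A 0) Ax.
transitivity (T (fun=> -1 * 0 + 0) x); last by rewrite E mulN1r addNr.
by apply: (der_eq dT _ Ax) => y _; rewrite mulr0 addr0.
Qed.

Lemma der_scale f (c : R) x : smooth A f -> A x -> T (fun y => c * f y) x = c * T f x.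
Proof.
move=> sf Ax; have := der_lin dT c sf (smooth_cst A 0) Ax.
rewrite der_cst0 // addr0 => <-; apply: (der_eq dT _ Ax) => y _.
by rewrite addr0.
Qed.

Lemma der_add f g x : smooth A f -> smooth A g -> A x -> T (fun y => f y + g y) x = T f x + T g x.
Proof.
move=> sf sg Ax; have := der_lin dT 1 sf sg Ax.
rewrite mul1r => <-; apply: (der_eq dT _ Ax) => y _.
by rewrite mul1r.
Qed.

Lemma der_sum (I : Type) (r : seq I) (F : I -> V -> R) x : (forall i, smooth A (F i)) -> A x ->
  T (fun y => \sum_(i <- r) F i y) x = \sum_(i <- r) T (F i) x.
Proof.
move=> sF Ax; elim: r => [|i r IH].
  by rewrite big_nil -[RHS](der_cst0 Ax); apply: (der_eq dT _ Ax) => y _; rewrite big_nil.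
rewrite big_cons -IH -der_add //; last exact: smooth_sum.
by apply: (der_eq dT _ Ax) => y _; rewrite big_cons.
Qed.

Lemma iter_der_smooth n f : smooth A f -> smooth A (iter n T f).
Proof. by move=> sf; elim: n => //= n IH; exact: der_smooth. Qed.

Lemma iter_der_eq n f g : (forall x, A x -> f x = g x) ->
  forall x, A x -> iter n T f x = iter n T g x.
Proof. by move=> fg; elim: n => //= n IH x Ax; exact: der_eq. Qed.

Lemma iter_der_lin n f g (c : R) : smooth A f -> smooth A g -> forall x, A x ->
  iter n T (fun y => c * f y + g y) x = c * iter n T f x + iter n T g x.
Proof.
move=> sf sg; elim: n => //= n IH x Ax.
rewrite (der_eq dT IH Ax) (der_lin dT) //; exact: iter_der_smooth.
Qed.

Lemma iter_der_sum n (I : Type) (r : seq I) (c : I -> R) (F : I -> V -> R) x :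
  (forall i, smooth A (F i)) -> A x ->
  iter n T (fun y => \sum_(i <- r) c i * F i y) x = \sum_(i <- r) c i * iter n T (F i) x.
Proof.
move=> sF Ax; elim: r => [|i r IH].
  rewrite big_nil; transitivity (iter n T (fun=> 0) x).
    by apply: iter_der_eq => // y _; rewrite big_nil.
  by elim: n x Ax => //= n IH x Ax; rewrite (der_eq dT IH Ax) der_cst0.
rewrite big_cons -IH -iter_der_lin //; last by apply: smooth_sum => // k _; exact: smoothZ.
by apply: iter_der_eq => // y _; rewrite big_cons.
Qed.

Lemma iter_der_mul n f g x : smooth A f -> smooth A g -> A x ->
  iter n T (fun y => f y * g y) x =
  \sum_(i < n.+1) 'C(n, i)%:R * (iter i T f x * iter (n - i) T g x).
Proof.
move=> sf sg; elim: n x => [|n IH] x Ax; first by rewrite big_ord_recl big_ord0 /= bin0 mul1r addr0.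
rewrite /= (der_eq dT IH Ax).
have sfi i : smooth A (iter i T f) by exact: iter_der_smooth.
have sgi i : smooth A (iter i T g) by exact: iter_der_smooth.
rewrite der_sum //; last by move=> i; apply: smoothZ => //; exact: smoothM.
have E (i : 'I_n.+1) : T (fun y => 'C(n, i)%:R * (iter i T f y * iter (n - i) T g y)) x =
    'C(n, i)%:R * (iter i.+1 T f x * iter (n - i) T g x) +
    'C(n, i)%:R * (iter i T f x * iter (n - i).+1 T g x).
  have := @der_scale (fun y => iter i T f y * iter (n - i) T g y) 'C(n, i)%:R x.
  by move=> -> //; [rewrite (der_mul dT) // mulrDr|exact: smoothM].
rewrite (eq_bigr _ (fun i _ => E i)) big_split /=.
under [RHS]eq_bigr => i _.
  rewrite (_ : 'C(n.+1, i) = (if (i : nat) is i'.+1 then 'C(n, i') else 0) + 'C(n, i))%N; last first.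
    by case: (val i) => [|k]; rewrite ?bin0 // binS addnC.
  rewrite natrD mulrDl; over.
rewrite big_split /=; congr (_ + _).
  rewrite [RHS]big_ord_recl /= mul0r add0r; apply: eq_bigr => i _.
  by rewrite /bump /= add1n subSS.
rewrite [RHS]big_ord_recr /= bin_small // mul0r addr0; apply: eq_bigr => i _.
by rewrite subSn // -ltnS.
Qed.

Lemma subSS_neq i j n : (i < j)%N -> (j < n.+1)%N -> (j.+1 - i.+2 == n)%N = false.
Proof. by move=> ij jn; apply/eqP; lia. Qed.

(** Every factor vanishes at [x], so a nonzero term of the Leibniz expansion differentiates each of
    the n factors at least once. Fewer than n derivatives give 0, and n of them can be distributed
    in n! ways. *)
Lemma iter_der_prod n (F : 'I_n -> V -> R) x j : A x -> (forall i, smooth A (F i)) ->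
  (forall i, F i x = 0) -> (j <= n)%N ->
  iter j T (fun y => \prod_i F i y) x = (j == n)%:R * n`!%:R * \prod_i T (F i) x.
Proof.
move=> Ax; elim: n F j => [|n IH] F j sF F0 jn.
  move: jn; rewrite leqn0 => /eqP ->.
  by rewrite /= !big_ord0 fact0 !mul1r.
have sP : smooth A (fun y => \prod_(i < n) F (lift ord0 i) y) by apply: smooth_prod.
transitivity (iter j T (fun y => F ord0 y * \prod_(i < n) F (lift ord0 i) y) x).
  by apply: iter_der_eq => // y _; rewrite big_ord_recl.
rewrite iter_der_mul //.
case: j jn => [|j jn]; first by rewrite big_ord_recl big_ord0 /= F0 !mul0r mulr0 addr0.
rewrite big_ord_recl /= F0 mul0r mulr0 add0r.
(* With two or more derivatives on the first factor, too few are left for the others. *)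
rewrite big_ord_recl /= big1 => [|i _]; last first.
  rewrite /bump /= !add1n IH //; last by rewrite subSS (leq_trans (leq_subr _ _)).
  by rewrite (@subSS_neq i j n) ?mul0r ?mulr0.
rewrite addr0 /bump /= add1n bin1 subSS subn0 IH // eqSS.
rewrite [in RHS]big_ord_recl; case: eqP => [->|_]; last by rewrite !mul0r !mulr0.
by rewrite factS natrM !mul1r; ring.
Qed.

End Derivation.
End Derivations.

(** * Noncommutative series acting as differential operators *)

Section Words.
Variables (R : realType) (d : nat) (V : normedModType R) (A : set V).
Hypothesis oA : open A.
Variable D : 'I_d -> (V -> R) -> V -> R.
Hypothesis dD : forall i, derivation_on A (D i).
Local Notation nc := (nc R d).

Fixpoint words (K : nat) : seq (seq 'I_d) :=
  if K is K'.+1 then [::] :: [seq i :: w | i <- enum 'I_d, w <- words K'] else [:: [::]].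

Definition wop (w : seq 'I_d) (f : V -> R) : V -> R := foldr (fun i g => D i g) f w.

(** The action sending the i-th letter to [D i], with the leftmost letter applied last. [K] keeps
    the sum finite; by [rho_le] the result no longer depends on it beyond the degree of [a]. *)
Definition rho (K : nat) (a : nc) (f : V -> R) : V -> R :=
  fun x => \sum_(w <- words K) a w * wop w f x.

Lemma wop_smooth w f : smooth A f -> smooth A (wop w f).
Proof. by move=> sf; elim: w => //= i w IH; exact: der_smooth. Qed.

Lemma wop_eq w f g : (forall x, A x -> f x = g x) -> forall x, A x -> wop w f x = wop w g x.
Proof. by move=> fg; elim: w => //= i w IH x Ax; exact: (der_eq (dD i)). Qed.

Lemma rho_smooth K a f : smooth A f -> smooth A (rho K a f).
Proof. by move=> sf; apply: smooth_sum => // w _; apply: smoothZ => //; exact: wop_smooth. Qed.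

Lemma rho_eq K a f g : (forall x, A x -> f x = g x) ->
  forall x, A x -> rho K a f x = rho K a g x.
Proof. by move=> fg x Ax; apply: eq_bigr => w _; rewrite (wop_eq _ fg). Qed.

Lemma rhoD K a b f x : rho K (a + b) f x = rho K a f x + rho K b f x.
Proof. by rewrite /rho -big_split; apply: eq_bigr => w _; rewrite ncDE mulrDl. Qed.

Lemma rhoZ K (c : R) a f x : rho K (c *: a) f x = c * rho K a f x.
Proof. by rewrite /rho mulr_sumr; apply: eq_bigr => w _; rewrite ncZE mulrA. Qed.

Lemma rhoB K a b f x : rho K (a - b) f x = rho K a f x - rho K b f x.
Proof. by rewrite rhoD -[- b]scaleN1r rhoZ mulN1r. Qed.

Lemma rho0 K f x : rho K 0 f x = 0.
Proof. by rewrite /rho big1 // => w _; rewrite nc0E mul0r. Qed.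

Lemma rho_sum K (I : Type) (r : seq I) (F : I -> nc) f x :
  rho K (\sum_(i <- r) F i) f x = \sum_(i <- r) rho K (F i) f x.
Proof. by elim/big_rec2: _ => [|i y z _ <-]; rewrite ?rho0 ?rhoD. Qed.

Lemma rho_0 a f x : rho 0 a f x = a [::] * f x.
Proof. by rewrite /rho big_seq1. Qed.

Lemma rho_S K a f x : smooth A f -> A x ->
  rho K.+1 a f x = a [::] * f x + \sum_i D i (rho K (lsh i a) f) x.
Proof.
move=> sf Ax; rewrite /rho /= big_cons; congr (_ + _).
rewrite big_allpairs_dep big_enum /=; apply: eq_bigr => i _.
rewrite (der_sum oA (dD i)) //; last by move=> w; apply: smoothZ => //; exact: wop_smooth.
by apply: eq_bigr => w _; rewrite (der_scale (dD i)) //; exact: wop_smooth.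
Qed.

Lemma supp_lsh K (a : nc) i : supp K.+1 a -> supp K (lsh i a).
Proof. by move=> H w wK; apply: H. Qed.

Lemma rho_le K K' a f x : smooth A f -> A x -> supp K a -> (K <= K')%N ->
  rho K' a f x = rho K a f x.
Proof.
move=> sf; elim: K K' a x => [|K IH] K' a x Ax sa KK'.
  case: K' {KK'} => // K'; rewrite rho_S // rho_0 big1 ?addr0 // => i _.
  rewrite -[RHS](der_cst0 (dD i) Ax); apply: (der_eq (dD i)) => // y _.
  by rewrite /rho big1 // => w _; rewrite /lsh sa // mul0r.
case: K' KK' => // K' KK'; rewrite !rho_S //; congr (_ + _); apply: eq_bigr => i _.
by apply: (der_eq (dD i)) => // y Ay; apply: IH => //; exact: supp_lsh.
Qed.

(** Multiplicativity of the action, by removing the first letter of the left factor: [lshM] on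
    series matches [rho_S] on operators. *)
Lemma rho_mul K1 K2 K a b f x : smooth A f -> A x -> supp K1 a -> supp K2 b ->
  (K1 + K2 <= K)%N -> rho K (a * b) f x = rho K1 a (rho K2 b f) x.
Proof.
move=> sf; elim: K1 K a x => [|K1 IH] K a x Ax sa sb KK.
  have Ea : a = a [::] *: 1.
    apply/funext => -[|i w]; first by rewrite ncZE nc1E mulr1.
    by rewrite ncZE nc1E mulr0 sa.
  by rewrite rho_0 {1}Ea -scalerAl mul1r rhoZ (rho_le sf Ax sb KK).
case: K KK => // K KK.
have sg := rho_smooth K2 b sf.
rewrite rho_S // (rho_S _ _ sg Ax) ncM_nil -(rho_le sf Ax sb (_ : K2 <= K.+1)%N); last by lia.
rewrite rho_S // mulrDr mulrA -addrA; congr (_ + _).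
rewrite mulr_sumr -big_split /=; apply: eq_bigr => i _.
rewrite -(der_lin (dD i)) //; [|exact: rho_smooth|exact: rho_smooth].
apply: (der_eq (dD i)) => // y Ay; rewrite lshM rhoD rhoZ; congr (_ + _).
by apply: IH => //; exact: supp_lsh.
Qed.

Lemma rho_gen i f x : smooth A f -> A x -> rho 1 (ncgen R i) f x = D i f x.
Proof.
move=> sf Ax; rewrite rho_S // mul0r add0r (bigD1 i) //= big1 => [|k ki].
  rewrite addr0; apply: (der_eq (dD i)) => // y Ay.
  by rewrite rho_0 /lsh /ncgen eqxx mul1r.
rewrite -[RHS](der_cst0 (dD k) Ax); apply: (der_eq (dD k)) => // y Ay.
by rewrite rho_0 /lsh /ncgen eqseq_cons (negbTE ki) mul0r.
Qed.

Lemma rho_exp K k n a f x : smooth A f -> A x -> supp k a -> (n * k <= K)%N ->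
  rho K (a ^+ n) f x = iter n (rho k a) f x.
Proof.
move=> sf; elim: n K x => [|n IH] K x Ax sa nK.
  by rewrite expr0 (@rho_le 0) // ?rho_0 ?mul1r //; exact: supp1.
rewrite exprS (@rho_mul k (n * k)) //; last exact: suppX.
by apply: rho_eq => // y Ay; apply: IH.
Qed.

End Words.

(** * Vector fields and their commutators *)

Section Fields.
Variables (R : realType) (V : normedModType R) (A : set V).
Hypothesis oA : open A.

Section FieldCoefficients.
Variables (I : finType) (G : V -> V) (a : I -> V -> R) (u : I -> V).
Hypothesis sa : forall k, smooth A (a k).
Hypothesis Ga : forall x, A x -> G x = \sum_k a k x *: u k.

Lemma ld_sum f x : smooth A f -> A x -> ld G f x = \sum_k a k x * 'D_(u k) f x.
Proof. by move=> sf Ax; rewrite /ld Ga // (derive_sum_dir sf Ax). Qed.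

Lemma field_derivation : derivation_on A (ld G).
Proof.
apply: ld_derivation => // f sf.
apply: (@smooth_eq _ _ A (fun x => \sum_k a k x * 'D_(u k) f x)) => //.
  by move=> x Ax; rewrite ld_sum.
by apply: smooth_sum => // k _; apply: smoothM => //; exact: smooth_derive.
Qed.

End FieldCoefficients.

Lemma ld_ld (I J : finType) (G H : V -> V) (a : I -> V -> R) (u : I -> V)
    (b : J -> V -> R) (w : J -> V) :
  (forall k, smooth A (a k)) -> (forall x, A x -> G x = \sum_k a k x *: u k) ->
  (forall k, smooth A (b k)) -> (forall x, A x -> H x = \sum_k b k x *: w k) ->
  forall f x, smooth A f -> A x ->
  ld G (ld H f) x = \sum_l ld G (b l) x * 'D_(w l) f x +
    \sum_k \sum_l a k x * b l x * 'D_(u k) ('D_(w l) f) x.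
Proof.
move=> sa Ga sb Hb f x sf Ax.
have dG := field_derivation sa Ga.
have sD l : smooth A ('D_(w l) f) by exact: smooth_derive.
rewrite (der_eq dG (fun y Ay => ld_sum Hb sf Ay) Ax).
rewrite (der_sum oA dG) //; last by move=> l; exact: smoothM.
under eq_bigr => l _ do rewrite (der_mul dG) //.
rewrite big_split /=; congr (_ + _); rewrite exchange_big /=; apply: eq_bigr => l _.
rewrite (ld_sum Ga (sD l) Ax) mulr_sumr; apply: eq_bigr => k _.
by rewrite mulrA [b l x * _]mulrC.
Qed.

(** The second-order terms cancel by symmetry of second derivatives. Arbitrary finite families of
    constant directions are allowed, so that the formula also applies on the product space. *)
Lemma ld_comm (I J : finType) (G H : V -> V) (a : I -> V -> R) (u : I -> V)
    (b : J -> V -> R) (w : J -> V) :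
  (forall k, smooth A (a k)) -> (forall x, A x -> G x = \sum_k a k x *: u k) ->
  (forall k, smooth A (b k)) -> (forall x, A x -> H x = \sum_k b k x *: w k) ->
  forall f x, smooth A f -> A x ->
  ld G (ld H f) x - ld H (ld G f) x =
  \sum_l ld G (b l) x * 'D_(w l) f x - \sum_k ld H (a k) x * 'D_(u k) f x.
Proof.
move=> sa Ga sb Hb f x sf Ax.
rewrite (ld_ld sa Ga sb Hb sf Ax) (ld_ld sb Hb sa Ga sf Ax).
have -> : \sum_k \sum_l a k x * b l x * 'D_(u k) ('D_(w l) f) x =
          \sum_k \sum_l b k x * a l x * 'D_(w k) ('D_(u l) f) x.
  rewrite exchange_big; apply: eq_bigr => l _; apply: eq_bigr => k _.
  by rewrite (derive_comm oA sf _ _ Ax) [a k x * _]mulrC.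
by rewrite opprD addrACA subrr addr0.
Qed.

End Fields.

Section RowFields.
Variables (R : realType) (N : nat) (U : set 'rV[R]_N).
Hypothesis oU : open U.

Definition sfield (G : 'rV[R]_N -> 'rV[R]_N) := forall k, smooth U (fun x => G x 0 k : R).

Lemma sfield_derivation G : sfield G -> derivation_on U (ld G).
Proof. by move=> sG; apply: (field_derivation oU sG) => x _; exact: unitv_sum. Qed.

Lemma ld_coord G k x : ld G (fun y : 'rV[R]_N => y 0 k : R) x = G x 0 k.
Proof. exact: coord_derive. Qed.

Lemma vbr_coord G H k x : sfield G -> sfield H -> U x ->
  vbr G H x 0 k = ld G (fun y => H y 0 k : R) x - ld H (fun y => G y 0 k : R) x.
Proof.
move=> sG sH Ux; rewrite /vbr /ld !mxE.
have [_ ->] := @row_derive R _ N H x (G x) (fun i => @smooth_derivable _ _ U _ x (G x) (sH i) Ux).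
by have [_ ->] := @row_derive R _ N G x (H x) (fun i => @smooth_derivable _ _ U _ x (H x) (sG i) Ux).
Qed.

Lemma sfield_vbr G H : sfield G -> sfield H -> sfield (vbr G H).
Proof.
move=> sG sH k; apply: (@smooth_eq _ _ U (fun x => ld G (fun y => H y 0 k : R) x - ld H (fun y => G y 0 k : R) x)) => //.
  by move=> x Ux; rewrite vbr_coord.
by apply: smoothB => //; apply: der_smooth => //; exact: sfield_derivation.
Qed.

Lemma ld_vbr G H f x : sfield G -> sfield H -> smooth U f -> U x ->
  ld (vbr G H) f x = ld G (ld H f) x - ld H (ld G f) x.
Proof.
move=> sG sH sf Ux.
have eG y : U y -> G y = \sum_k G y 0 k *: unitv R k by move=> _; exact: unitv_sum.
have eH y : U y -> H y = \sum_k H y 0 k *: unitv R k by move=> _; exact: unitv_sum.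
rewrite (ld_comm oU sG eG sH eH sf Ux).
rewrite (ld_sum (fun y _ => unitv_sum (vbr G H y)) sf Ux) -sumrB.
by apply: eq_bigr => k _; rewrite vbr_coord // mulrBl.
Qed.

Variables (d : nat) (F : 'I_d -> 'rV[R]_N -> 'rV[R]_N).
Hypothesis sF : forall i, sfield (F i).

Let dF i := sfield_derivation (sF i).
Local Notation rhoF := (rho (fun i => ld (F i))).

Lemma brX_cons i J : J != [::] -> brX F (i :: J) = vbr (F i) (brX F J).
Proof. by case: J. Qed.

Lemma sfield_brX J : sfield (brX F J).
Proof.
elim: J => [|i [|l J] IH]; first by move=> k /= n; under eq_fun do rewrite mxE; exact: Ck_cst.
  exact: sF.
by rewrite brX_cons //; exact: sfield_vbr.
Qed.

(** A bracket of fields acts as the commutator of derivations, so iterated commutators act as the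
    Lie elements of the free algebra: the bridge from the given fields to the algebra. *)
Lemma ld_brX J K f x : (size J <= K)%N -> smooth U f -> U x ->
  ld (brX F J) f x = rhoF K (lie R J) f x.
Proof.
move=> JK sf Ux; elim: J K f x JK sf Ux => [|i [|l J] IH] K f x JK sf Ux.
- by rewrite rho0 /ld derive0.
- by rewrite (rho_le oU dF sf Ux (@supp_gen R d i)) // (rho_gen oU dF).
rewrite brX_cons // lie_cons // ld_vbr //; [|exact: sfield_brX].
rewrite /brk rhoB.
have sb := @supp_lie R d (l :: J); have sg := @supp_gen R d i.
have sB := der_smooth (sfield_derivation (sfield_brX (l :: J))).
congr (_ - _).
  rewrite (rho_mul oU dF sf Ux sg sb) // (rho_gen oU dF) //; last exact: rho_smooth.
  by apply: (der_eq (dF i)) => // y Uy; apply: IH.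
rewrite (rho_mul oU dF sf Ux sb sg) //; last by rewrite addn1.
rewrite -(IH (size (l :: J))) //; last exact: rho_smooth.
by apply: (der_eq (sfield_derivation (sfield_brX (l :: J)))) => // y Uy; rewrite (rho_gen oU dF).
Qed.

End RowFields.

(** * The commutator frame *)

Section Frame.
Variables (R : realType) (d m N : nat) (Is : 'I_N -> seq 'I_d).
Hypothesis gb : graded_basis R m Is.
Variable U : set 'rV[R]_N.
Hypothesis oU : open U.
Variable F : 'I_d -> 'rV[R]_N -> 'rV[R]_N.
Hypothesis sF : forall i, sfield U (F i).
Local Notation rhoF := (rho (fun i => ld (F i))).

Definition frame (x : 'rV[R]_N) : 'M[R]_N := \matrix_(i, k) brX F (Is i) x 0 k.

Lemma smooth_frame i k : smooth U (fun x => frame x i k).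
Proof.
by apply: (smooth_eq oU _ (sfield_brX oU sF (Is i) k)) => x _; rewrite mxE.
Qed.

Lemma ld_frame v K f x : (m <= K)%N -> smooth U f -> U x ->
  ld (fun y => v *m frame y) f x = rhoF K (Lc Is v) f x.
Proof.
move=> mK sf Ux.
have E y : v *m frame y = \sum_i v 0 i *: brX F (Is i) y.
  by apply/rowP => k; rewrite !mxE summxE; apply: eq_bigr => i _; rewrite !mxE.
rewrite /ld E (derive_sum_dir sf Ux) /Lc rho_sum; apply: eq_bigr => i _.
rewrite rhoZ -(ld_brX oU sF _ sf Ux) //.
by have /andP[_ H] := size_Is gb i; exact: leq_trans mK.
Qed.

(** A linear relation in the free Lie algebra passes to commutators of fields through their action
    on coordinate functions. Hence every commutator of order at most m lies in the row space of the
    frame, which is everything by the spanning hypothesis. *)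
Lemma frame_unit x : U x -> comm_span_all m F x -> frame x \in unitmx.
Proof.
move=> Ux span.
have H (v : 'rV[R]_N) : (v <= frame x)%MS.
  have [s [sm ->]] := span v.
  elim: s sm => [|p s IH] /=; first by rewrite big_nil sub0mx.
  move=> /andP[/andP[p0 pm] /IH {}IH]; rewrite big_cons addmx_sub // scalemx_sub //.
  have p10 : p.1 != [::] by case: p.1 p0.
  have [w Ew] := lie_Lc gb p10 pm.
  apply/submxP; exists w; apply/rowP => k.
  rewrite -(ld_coord (brX F p.1)) (ld_brX oU sF (K := m)) //; last exact: smooth_coord.
  by rewrite Ew -ld_frame // ?ld_coord //; exact: smooth_coord.
rewrite -row_full_unit -sub1mx; apply/row_subP => i; exact: H.
Qed.

End Frame.

(** * Smoothness under projections, slices, exchange and the diagonal *)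

Section AffineMaps.
Variable R : realType.

(** The derivative of the composite along [v] is the derivative of [f] along the fixed direction
    [l v], composed with [phi]; the induction then closes on itself. *)
Lemma smooth_affine (V V' : normedModType R) (A : set V) (B : set V') (phi : V -> V')
    (l : V -> V') (f : V' -> R) :
  (forall x, differentiable phi x) ->
  (forall (h : R) a w, phi (h *: w + a) = h *: l w + phi a) ->
  (forall x, A x -> B (phi x)) -> smooth B f -> smooth A (fun x => f (phi x)).
Proof.
move=> dphi lphi AB sf k; elim: k f sf => [|k IH] f sf.
  move=> x Ax; have c1 : phi @ x --> phi x by exact: differentiable_continuous.
  have c2 : f @ phi x --> f (phi x) by apply: (smooth_continuous sf); exact: AB.
  exact: (cvg_comp _ _ c1 c2).
split=> [x Ax|v].
  apply: (@differentiable_comp _ _ _ _ phi f) => //.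
  by apply: (smooth_differentiable sf); exact: AB.
have -> : 'D_v (fun x => f (phi x)) = fun x => 'D_(l v) f (phi x).
  apply/funext => x.
  exact: (@derive_along R _ _ _ f phi x v (l v) (fun h => lphi h x v)).1.
by apply: (IH ('D_(l v) f)); exact: smooth_derive.
Qed.

Section Product.
Variables (V W : normedModType R).

Lemma fst_differentiable (z : V * W) : differentiable (fst : V * W -> V) z.
Proof. by apply: linear_differentiable => w; exact: cvg_fst. Qed.

Lemma snd_differentiable (z : V * W) : differentiable (snd : V * W -> W) z.
Proof. by apply: linear_differentiable => w; exact: cvg_snd. Qed.

Lemma open_prod (A : set V) (B : set W) : open A -> open B -> open (A `*` B).
Proof.
move=> oA oB; rewrite openE => -[a b] [/= Aa Bb].
by exists (A, B) => //; split; exact: open_nbhs_nbhs.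
Qed.

Lemma smooth_fst (A : set V) (B : set W) f : smooth A f -> smooth (A `*` B) (fun z => f z.1).
Proof.
move=> sf; apply: (@smooth_affine _ _ _ A fst fst) => //; first exact: fst_differentiable.
by move=> x [].
Qed.

Lemma smooth_snd (A : set V) (B : set W) f : smooth B f -> smooth (A `*` B) (fun z => f z.2).
Proof.
move=> sf; apply: (@smooth_affine _ _ _ B snd snd) => //; first exact: snd_differentiable.
by move=> x [].
Qed.

Lemma smooth_slice2 (A : set V) (B : set W) x (f : V * W -> R) : A x -> smooth (A `*` B) f ->
  smooth B (fun y => f (x, y)).
Proof.
move=> Ax sf; apply: (@smooth_affine _ _ _ (A `*` B) (fun y => (x, y)) (fun y => (0, y))) => //.
by move=> h a w; congr (_, _); rewrite /= scaler0 add0r.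
Qed.

Lemma smooth_slice1 (A : set V) (B : set W) y (f : V * W -> R) : B y -> smooth (A `*` B) f ->
  smooth A (fun x => f (x, y)).
Proof.
move=> By sf; apply: (@smooth_affine _ _ _ (A `*` B) (fun x => (x, y)) (fun x => (x, 0))) => //.
by move=> h a w; congr (_, _); rewrite /= scaler0 add0r.
Qed.

End Product.

Lemma smooth_swap (V W : normedModType R) (A : set V) (B : set W) f : smooth (A `*` B) f ->
  smooth (B `*` A) (fun z => f (z.2, z.1)).
Proof.
move=> sf; apply: (@smooth_affine _ _ _ (A `*` B) (fun z : W * V => (z.2, z.1)) (fun z => (z.2, z.1))) => //.
- move=> z; apply: (@differentiable_pair _ _ _ _ snd fst).
    exact: snd_differentiable.
  exact: fst_differentiable.
- by move=> z [].
Qed.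

Lemma smooth_diag (V : normedModType R) (A : set V) (f : V * V -> R) : smooth (A `*` A) f ->
  smooth A (fun x => f (x, x)).
Proof.
move=> sf; apply: (@smooth_affine _ _ _ (A `*` A) (fun x => (x, x)) (fun x => (x, x))) => //.
Qed.

End AffineMaps.

Section LinearForms.
Variable R : realType.

Lemma linear_form_derive n (c : 'I_n -> R) x v : 'D_v (linear_form c) x = linear_form c v.
Proof.
have H (e : R) : 0 < e -> \forall h \near (0 : 'rV[R]_n),
    `|linear_form c (h + x) - linear_form c x - linear_form c h| <= e * `|h|.
  move=> e0; near=> h.
  by rewrite linearD addrK subrr normr0 mulr_ge0 // ltW.
exact: (@eps_differentiable R _ _ (linear_form c) x (linear_form c)
  (@linear_form_continuous R n c) H).2.
Unshelve. all: by end_near. Qed.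

Lemma smooth_linear_form n (c : 'I_n -> R) A : smooth A (linear_form c).
Proof.
apply: (@smooth_sub _ _ A setT) => //.
apply: smooth_sum => [|i _]; first exact: openT.
by apply: smoothM; [exact: openT|exact: smooth_coord|exact: smooth_cst].
Qed.

End LinearForms.

(** * Powers of a generic linear element *)

Section GeneratorPowers.
Variables (R : realType) (N : nat).

(** Here the N letters stand for the fields of the frame, not for the d generators. The coefficients
    of its n-th power are the monomials of degree n in [v]. *)
Definition gensum (v : 'rV[R]_N) : nc R N := \sum_i v 0 i *: ncgen R i.

Lemma gensum_nil v : gensum v [::] = 0.
Proof. by rewrite /gensum nc_sumE big1 // => i _; rewrite ncZE mulr0. Qed.

Lemma supp_gensum v : supp 1 (gensum v).
Proof. by apply: supp_sum => i _; apply: suppZ; exact: supp_gen. Qed.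

Lemma lsh_gensum v i : lsh i (gensum v) = v 0 i *: 1.
Proof.
apply/funext => w; rewrite /lsh /gensum nc_sumE (bigD1 i) //= big1 => [|k ki].
  by rewrite addr0 !ncZE /ncgen eqseq_cons eqxx.
by rewrite ncZE /ncgen eqseq_cons eq_sym (negbTE ki) mulr0.
Qed.

Lemma gensum_exp v n w : (gensum v ^+ n) w = if size w == n then \prod_(i <- w) v 0 i else 0.
Proof.
elim: n w => [|n IH] [|i w]; rewrite ?expr0 ?nc1E ?big_nil //.
  by rewrite exprS ncM_nil gensum_nil mul0r.
rewrite exprS -[LHS]/(lsh i (gensum v * gensum v ^+ n) w) lshM gensum_nil scale0r add0r.
rewrite lsh_gensum -scalerAl mul1r ncZE IH big_cons -[size (i :: w)]/(size w).+1 eqSS.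
by case: ifP; rewrite ?mulr0.
Qed.

End GeneratorPowers.

(** * Antisymmetric coordinates with prescribed jets *)

Section CanonicalCoordinates.
Variables (R : realType) (N : nat) (U : set 'rV[R]_N) (B : 'rV[R]_N -> 'M[R]_N).
Hypothesis oU : open U.
Hypothesis sB : forall i k, smooth U (fun x => B x i k).
Hypothesis uB : forall x, U x -> B x \in unitmx.

Local Notation rV := ('rV[R]_N).
Local Notation V2 := (rV * rV)%type.
Local Notation U2 := (U `*` U).

Definition along (v : rV) : (rV -> R) -> rV -> R := ld (fun x => v *m B x).
Definition along1 (v : rV) : (V2 -> R) -> V2 -> R := ld (fun z : V2 => (v *m B z.1, 0) : V2).
Definition along2 (v : rV) : (V2 -> R) -> V2 -> R := ld (fun z : V2 => (0, v *m B z.2) : V2).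

Let oU2 : open U2 := open_prod oU oU.

Let smooth_vB (v : rV) k : smooth U (fun x => (v *m B x) 0 k : R).
Proof.
by apply: (smooth_mulmx oU _ sB) => i j; exact: smooth_cst.
Qed.

Let inj1 (v : rV) : (v, 0) = \sum_k v 0 k *: ((unitv R k, 0) : V2).
Proof.
rewrite {1}(unitv_sum v); elim/big_rec2: _ => //= k y z _ <-.
by congr (_, _); rewrite /= scaler0 add0r.
Qed.

Let inj2 (v : rV) : (0, v) = \sum_k v 0 k *: ((0, unitv R k) : V2).
Proof.
rewrite {1}(unitv_sum v); elim/big_rec2: _ => //= k y z _ <-.
by congr (_, _); rewrite /= scaler0 add0r.
Qed.

Lemma along_derivation v : derivation_on U (along v).
Proof. by apply: sfield_derivation => // k; exact: smooth_vB. Qed.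

Lemma along1_derivation v : derivation_on U2 (along1 v).
Proof.
apply: (@field_derivation _ _ _ oU2 _ _ (fun k (z : V2) => (v *m B z.1) 0 k) (fun k => (unitv R k, 0))).
  by move=> k; exact: (smooth_fst U (smooth_vB v k)).
by move=> z _; exact: inj1.
Qed.

Lemma along2_derivation v : derivation_on U2 (along2 v).
Proof.
apply: (@field_derivation _ _ _ oU2 _ _ (fun k (z : V2) => (v *m B z.2) 0 k) (fun k => (0, unitv R k))).
  by move=> k; exact: (smooth_snd U (smooth_vB v k)).
by move=> z _; exact: inj2.
Qed.

Lemma along12_comm v f z : smooth U2 f -> U2 z ->
  along2 v (along1 v f) z = along1 v (along2 v f) z.
Proof.
move=> sf Uz; apply/eqP; rewrite -subr_eq0; apply/eqP.
rewrite (@ld_comm _ _ _ oU2 _ _ _ _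
  (fun k (z : V2) => (v *m B z.2) 0 k) (fun k => (0, unitv R k))
  (fun k (z : V2) => (v *m B z.1) 0 k) (fun k => (unitv R k, 0))) //.
- have E1 k : ld (fun z : V2 => (0, v *m B z.2) : V2) (fun z : V2 => (v *m B z.1) 0 k : R) z = 0.
    have [E _] := @derive_along R _ _ _ (fun x : rV => (v *m B x) 0 k : R) (fun y : V2 => y.1) z
      (0, v *m B z.2) 0 (fun h => erefl).
    by rewrite /ld E derive0.
  have E2 k : ld (fun z : V2 => (v *m B z.1, 0) : V2) (fun z : V2 => (v *m B z.2) 0 k : R) z = 0.
    have [E _] := @derive_along R _ _ _ (fun x : rV => (v *m B x) 0 k : R) (fun y : V2 => y.2) z
      (v *m B z.1, 0) 0 (fun h => erefl).
    by rewrite /ld E derive0.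
  by rewrite !big1 ?subrr // => k _; rewrite ?E1 ?E2 mul0r.
- by move=> k; exact: (smooth_snd U (smooth_vB v k)).
- by move=> k; exact: (smooth_fst U (smooth_vB v k)).
Qed.

Lemma iter_along2 v n f x x1 :
  iter n (along2 v) f (x, x1) = iter n (along v) (fun y => f (x, y)) x1.
Proof.
elim: n x1 => [|n IH] x1 //=.
have -> : iter n (along v) (fun y => f (x, y)) = fun y => iter n (along2 v) f (x, y).
  by apply/funext => y; rewrite IH.
rewrite /along /ld.
have H (h : R) : (x, h *: (v *m B x1) + x1) = h *: ((0, v *m B x1) : V2) + (x, x1).
  by congr (_, _); rewrite /= scaler0 add0r.
by have [-> _] := @derive_along R _ _ _ (iter n (along2 v) f) (fun y => (x, y)) x1 _ _ H.
Qed.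

Lemma iter_along1 v n f x x1 :
  iter n (along1 v) f (x1, x) = iter n (along v) (fun y => f (y, x)) x1.
Proof.
elim: n x1 => [|n IH] x1 //=.
have -> : iter n (along v) (fun y => f (y, x)) = fun y => iter n (along1 v) f (y, x).
  by apply/funext => y; rewrite IH.
rewrite /along /ld.
have H (h : R) : (h *: (v *m B x1) + x1, x) = h *: ((v *m B x1, 0) : V2) + (x1, x).
  by congr (_, _); rewrite /= scaler0 add0r.
by have [-> _] := @derive_along R _ _ _ (iter n (along1 v) f) (fun y => (y, x)) x1 _ _ H.
Qed.

Lemma along_diag (v : rV) f x : smooth U2 f -> U x ->
  along v (fun y => f (y, y)) x = along1 v f (x, x) + along2 v f (x, x).
Proof.
move=> sf Ux; rewrite /along /ld.
have [-> _] := @derive_along R _ _ _ f (fun y => (y, y)) x (v *m B x) (v *m B x, v *m B x)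
  (fun h => erefl).
have Uxx : U2 (x, x) by [].
have -> : (v *m B x, v *m B x) = 1 *: (v *m B x, 0) + (0, v *m B x) :> V2.
  by rewrite scale1r; congr (_, _); rewrite /= ?addr0 ?add0r.
by rewrite (derive_linear_dir sf Uxx) mul1r.
Qed.

Definition flatcoord (x x1 : rV) : rV := (x1 - x) *m invmx (B x).

Let smooth_iB i k : smooth U (fun x => invmx (B x) i k).
Proof. exact: smooth_invmx. Qed.

Lemma smooth_flatcoord k : smooth U2 (fun z : V2 => flatcoord z.1 z.2 0 k : R).
Proof.
apply: (smooth_mulmx oU2) => i j; last exact: (smooth_fst U (smooth_iB i j)).
apply: (@smooth_eq _ _ _ (fun z : V2 => z.2 0 j - z.1 0 j)) => //.
  by move=> z _; rewrite !mxE !ord1.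
have sc := @smooth_coord R N U j.
by apply: smoothB => //; [exact: (smooth_snd U sc)|exact: (smooth_fst U sc)].
Qed.

Lemma flatcoord_xx x : flatcoord x x = 0.
Proof. by rewrite /flatcoord subrr mul0mx. Qed.

Lemma along_flatcoord v x k : U x -> along v (fun x1 => flatcoord x x1 0 k) x = v 0 k.
Proof.
move=> Ux; rewrite /along /ld.
pose c i := invmx (B x) i k.
have lfE y : linear_form c y = (y *m invmx (B x)) 0 k by rewrite mxE.
have -> : (fun x1 => flatcoord x x1 0 k) = fun x1 => linear_form c x1 + - linear_form c x.
  by apply/funext => x1; rewrite !lfE /flatcoord mulmxBl !mxE.
rewrite (derive_add _ (smooth_linear_form c U) (smooth_cst _ _) Ux) derive_cst addr0.
by rewrite linear_form_derive lfE mulmxK // uB.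
Qed.

Let fr i : (V2 -> R) -> V2 -> R := ld (fun z : V2 => (0, row i (B z.2)) : V2).

Let fr_derivation i : derivation_on U2 (fr i).
Proof.
apply: (@field_derivation _ _ _ oU2 _ _ (fun k (z : V2) => row i (B z.2) 0 k) (fun k => (0, unitv R k))).
  move=> k; apply: (smooth_eq oU2 _ (smooth_snd U (sB i k))) => z _.
  by rewrite mxE.
by move=> z _; exact: inj2.
Qed.

Lemma along2_rho v K f z : (1 <= K)%N -> smooth U2 f -> U2 z ->
  along2 v f z = rho fr K (gensum v) f z.
Proof.
move=> K1 sf Uz; rewrite rho_sum.
have -> : \sum_i rho fr K (v 0 i *: ncgen R i) f z = \sum_i v 0 i * fr i f z.
  apply: eq_bigr => i _; rewrite rhoZ (rho_le oU2 fr_derivation sf Uz (@supp_gen R N i) K1).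
  by rewrite (rho_gen oU2 fr_derivation).
rewrite /along2 /fr /ld -(derive_sum_dir sf Uz); congr ('D_ _ f z).
rewrite mulmx_sum_row; elim/big_rec2: _ => // i y1 y2 _ <-.
by congr (_, _); rewrite /= scaler0 add0r.
Qed.

(** The n-th jet is a homogeneous polynomial of degree n in [v], and this expansion exhibits
    coefficients independent of [v], from which a correcting function can be built. *)
Lemma iter_along2_rho v n f z : smooth U2 f -> U2 z ->
  iter n (along2 v) f z =
  \sum_(w <- words N n | size w == n) \prod_(i <- w) v 0 i * wop fr w f z.
Proof.
move=> sf Uz.
have -> : iter n (along2 v) f z = iter n (rho fr 1 (gensum v)) f z.
  elim: n z Uz => //= n IH z Uz.
  rewrite (der_eq (along2_derivation v) IH Uz) (along2_rho v (leqnn 1)) //.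
  by elim: n {IH} => //= n IH; exact: (rho_smooth oU2 fr_derivation).
rewrite -(rho_exp oU2 fr_derivation sf Uz (supp_gensum v) (_ : n * 1 <= n)%N) ?muln1 //.
rewrite /rho [RHS]big_mkcond; apply: eq_bigr => w _.
by rewrite gensum_exp; case: ifP; rewrite ?mul0r.
Qed.

(* The symbol of [f] at order [n], evaluated at the base point and turned into a function of the
   second point; subtracting it divided by [n!] kills the [n]-th jet and no lower one. *)
Definition correction n (f : V2 -> R) : V2 -> R := fun z =>
  \sum_(w <- words N n | size w == n)
    wop fr w f (z.1, z.1) * \prod_(i <- w) flatcoord z.1 z.2 0 i.

Lemma smooth_correction n f : smooth U2 f -> smooth U2 (correction n f).
Proof.
move=> sf; apply: smooth_sum => // w _; apply: smoothM => //.
  have sw := smooth_diag (wop_smooth fr_derivation w sf).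
  exact: (smooth_fst U sw).
by apply: smooth_prod => // i _; exact: smooth_flatcoord.
Qed.

(** The flat coordinates vanish at [x] and have derivative [v] there, so by [iter_der_prod] a
    product of n of them has jet n! times a monomial in [v] at order n, and 0 below. *)
Lemma iter_along_correction v n j f x : smooth U2 f -> U x -> (j <= n)%N ->
  iter j (along v) (fun y => correction n f (x, y)) x =
  (j == n)%:R * n`!%:R * iter n (along2 v) f (x, x).
Proof.
move=> sf Ux jn; have dv := along_derivation v.
have sfl k : smooth U (fun y => flatcoord x y 0 k : R).
  exact: (smooth_slice2 Ux (smooth_flatcoord k)).
transitivity (iter j (along v) (fun y => \sum_(w <- [seq w <- words N n | size w == n])
   wop fr w f (x, x) * \prod_(i <- w) flatcoord x y 0 i) x).
  by apply: (iter_der_eq dv) => // y _; rewrite big_filter.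
rewrite (iter_der_sum oU dv) //; last by move=> w; apply: smooth_prod => // i _; exact: sfl.
rewrite iter_along2_rho // mulr_sumr big_filter; apply: eq_bigr => w /eqP wn.
have -> : iter j (along v) (fun y => \prod_(i <- w) flatcoord x y 0 i) x =
    (j == n)%:R * n`!%:R * \prod_(i <- w) v 0 i.
  rewrite -wn in jn *.
  transitivity (iter j (along v) (fun y => \prod_(l < size w)
      flatcoord x y 0 (tnth (in_tuple w) l)) x).
    by apply: (iter_der_eq dv) => // y _; rewrite (big_tnth _ _ w).
  rewrite (iter_der_prod oU dv (F := fun l y => flatcoord x y 0 (tnth (in_tuple w) l))) //.
  - rewrite [in RHS]big_tnth; congr (_ * _); apply: eq_bigr => l _.
    exact: along_flatcoord.
  - by move=> l; rewrite flatcoord_xx mxE.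
by rewrite mulrC mulrA.
Qed.

(** The flat coordinates are already right at orders 0 and 1, hence the bound [n.+1] and corrections
    starting at order 2. *)
Lemma canonical_jet k n : exists2 th : V2 -> R, smooth U2 th &
  forall j v x, (j <= n.+1)%N -> U x ->
    iter j (along v) (fun y => th (x, y)) x = (j == 1%N)%:R * v 0 k.
Proof.
elim: n => [|n [th sth Hth]].
  exists (fun z => flatcoord z.1 z.2 0 k); first exact: smooth_flatcoord.
  move=> [|[|//]] v x _ Ux /=; first by rewrite flatcoord_xx mxE mul0r.
  by rewrite along_flatcoord // mul1r.
have sc := smooth_correction n.+2 sth.
exists (fun z => - ((n.+2)`!%:R)^-1 * correction n.+2 th z + th z).
  by apply: smoothD => //; exact: smoothZ.
move=> j v x jn Ux; have dv := along_derivation v.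
rewrite (@iter_der_lin _ _ _ _ dv _ (fun y => correction n.+2 th (x, y)) (fun y => th (x, y)) _) //.
- rewrite iter_along_correction //.
  move: jn; rewrite leq_eqVlt => /predU1P[->|jn].
    rewrite eqxx mul1r mulNr mulrA mulVf ?fact_neq0 // mul1r iter_along2 addNr.
    by rewrite mul0r.
  by rewrite (ltn_eqF jn) !mul0r mulr0 add0r Hth.
- exact: (smooth_slice2 Ux sc).
- exact: (smooth_slice2 Ux sth).
Qed.

(* [along1 v] and [along2 v] commute and add up to the derivative along the diagonal, where the
   jets are constant: each [along2] may thus be traded for [- along1]. *)
Lemma iter_along12_diag th k n v : smooth U2 th ->
  (forall j x, (j <= n)%N -> U x ->
    iter j (along v) (fun y => th (x, y)) x = (j == 1%N)%:R * v 0 k) ->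
  forall a b x, (a + b <= n)%N -> U x ->
  iter a (along1 v) (iter b (along2 v) th) (x, x) = (-1) ^+ a * ((a + b == 1)%N%:R * v 0 k).
Proof.
move=> sth Hth; have d1 := along1_derivation v; have d2 := along2_derivation v.
elim=> [|a IH] b x abn Ux; first by rewrite /= iter_along2 Hth // mul1r.
have sb c := iter_der_smooth d2 c sth.
have comm c z : U2 z ->
    along2 v (iter a (along1 v) (iter c (along2 v) th)) z =
    iter a (along1 v) (iter c.+1 (along2 v) th) z.
  move=> Uz /=; have := sb c; move: (iter c _ _) => g sg.
  elim: (a) z Uz => //= a' IH' z Uz.
  rewrite along12_comm //; last exact: iter_der_smooth.
  exact: (der_eq d1).
have sG := iter_der_smooth d1 a (sb b).
have := along_diag v sG Ux.
rewrite comm // IH //; last by rewrite addnS -addSn.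
have -> : along v (fun y => iter a (along1 v) (iter b (along2 v) th) (y, y)) x = 0.
  transitivity (along v (fun=> (-1) ^+ a * ((a + b == 1)%N%:R * v 0 k)) x).
    apply: (der_eq (along_derivation v)) => // y Uy; apply: IH => //.
    by apply: leq_trans abn; rewrite addSn.
  exact: derive_cst.
by move=> /esym/eqP; rewrite addr_eq0 => /eqP E; rewrite iterS E addnS addSn exprS mulN1r mulNr.
Qed.

Lemma canonical_coordinates n : exists Th : rV -> rV -> rV,
  [/\ forall k, smooth U2 (fun z : V2 => Th z.1 z.2 0 k : R),
      forall x x1, Th x1 x = - Th x x1 &
      forall j v x k, (j <= n)%N -> U x ->
        iter j (along v) (fun y => Th x y 0 k) x = (j == 1%N)%:R * v 0 k].
Proof.
have H k : {th : V2 -> R | smooth U2 th & forall j v x, (j <= n.+1)%N -> U x ->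
    iter j (along v) (fun y => th (x, y)) x = (j == 1%N)%:R * v 0 k}.
  exact/cid2/canonical_jet.
pose th k := s2val (H k).
have sth k : smooth U2 (th k) := s2valP (H k).
have Hth k := s2valP' (H k).
exists (fun x x1 => \row_k (2^-1 * (th k (x, x1) - th k (x1, x)))); split.
- move=> k; apply: (@smooth_eq _ _ _ (fun z : V2 => 2^-1 * (th k (z.1, z.2) - th k (z.2, z.1)))) => //.
    by move=> z _; rewrite mxE.
  apply: smoothZ => //; apply: smoothB => //; last exact: smooth_swap.
  by apply: (smooth_eq oU2 _ (sth k)) => -[].
- by move=> x x1; apply/rowP => k; rewrite !mxE -mulrN opprB.
move=> j v x k jn Ux; have dv := along_derivation v.
have s2 := smooth_slice2 Ux (sth k); have s1 := smooth_slice1 Ux (sth k).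
transitivity (iter j (along v) (fun y => 2^-1 * th k (x, y) + - 2^-1 * th k (y, x)) x).
  by apply: (iter_der_eq dv) => // y _; rewrite mxE mulrBr mulNr.
rewrite (@iter_der_lin _ _ _ _ dv _ (fun y => th k (x, y)) (fun y => - 2^-1 * th k (y, x)) _) //; last exact: smoothZ.
have -> : iter j (along v) (fun y => - 2^-1 * th k (y, x)) x =
    - 2^-1 * iter j (along v) (fun y => th k (y, x)) x.
  transitivity (iter j (along v) (fun y => - 2^-1 * th k (y, x) + 0) x).
    by apply: (iter_der_eq dv) => // y _; rewrite addr0.
  rewrite (@iter_der_lin _ _ _ _ dv _ (fun y => th k (y, x)) (fun=> 0) _) //; last exact: smooth_cst.
  rewrite (_ : iter j (along v) (fun=> 0) x = 0) ?addr0 //.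
  elim: (j) x Ux {s2 s1 jn} => //= j' IH x Ux.
  by rewrite (der_eq dv IH Ux) (der_cst0 dv).
rewrite Hth 1?leqW // -iter_along1.
have := @iter_along12_diag (th k) k n.+1 v (sth k) (fun j x => Hth k j v x) j 0%N x.
rewrite addn0 /= => -> //; last exact: leqW.
(* At order 1 the jet in the first variable is -v, so the two halves add up to v; at all other
   orders both vanish. *)
case: eqP => [->|_]; last by rewrite !(mul0r, mulr0) addr0.
by rewrite expr1 mul1r; field.
Qed.

End CanonicalCoordinates.

(** * Local degree *)

Section TaylorPolynomial.
Variables (R : realType) (N : nat) (W : set 'rV[R]_N).
Hypotheses (oW : open W) (W0 : W 0).
Local Notation rV := ('rV[R]_N).

Definition dcst (v : rV) : (rV -> R) -> rV -> R := ld (fun=> v).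

Lemma dcst_derivation v : derivation_on W (dcst v).
Proof. by apply: sfield_derivation => // k; exact: smooth_cst. Qed.

(** As a function of [v], this is n! times the homogeneous Taylor term of degree n of [G] at 0. *)
Definition jet n (G : rV -> R) (v : rV) : R := iter n (dcst v) G 0.

Lemma jet_eq n G H v : (forall p, W p -> G p = H p) -> jet n G v = jet n H v.
Proof. by move=> GH; exact: (iter_der_eq (dcst_derivation v)). Qed.

Lemma jet_sum n (I : Type) (r : seq I) (c : I -> R) (G : I -> rV -> R) v :
  (forall i, smooth W (G i)) ->
  jet n (fun p => \sum_(i <- r) c i * G i p) v = \sum_(i <- r) c i * jet n (G i) v.
Proof. by move=> sG; exact: (iter_der_sum oW (dcst_derivation v)). Qed.

Lemma dcst_sum G v p : smooth W G -> W p ->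
  dcst v G p = \sum_k v 0 k * 'D_(unitv R k) G p.
Proof. by move=> sG Wp; rewrite /dcst /ld {1}(unitv_sum v) (derive_sum_dir sG Wp). Qed.

Lemma jetS n G v : smooth W G ->
  jet n.+1 G v = \sum_k v 0 k * jet n ('D_(unitv R k) G) v.
Proof.
move=> sG; rewrite /jet iterSr -/(jet n _ v).
rewrite (@jet_eq _ _ _ _ (fun p Wp => dcst_sum v sG Wp)) jet_sum // => k.
exact: smooth_derive.
Qed.

Lemma smooth_jet n G : smooth W G -> smooth setT (jet n G).
Proof.
elim: n G => [|n IH] G sG; first exact: smooth_cst.
apply: (@smooth_eq _ _ setT (fun v : rV => \sum_k v 0 k * jet n ('D_(unitv R k) G) v)).
- exact: openT.
- by move=> v _; rewrite jetS.
apply: smooth_sum => [|k _]; first exact: openT.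
apply: smoothM; [exact: openT|exact: smooth_coord|].
by apply: IH; exact: smooth_derive.
Qed.

Lemma product_rule_swap (a b c y z : R) : y = z -> a + b * (c * y) = a + c * (b * z).
Proof. by move=> ->; rewrite mulrCA. Qed.

Lemma derive_jet n G (e v : rV) : smooth W G ->
  'D_e (jet n.+1 G) v = n.+1%:R * jet n ('D_e G) v.
Proof.
have T := @openT rV.
elim: n G => [|n IH] G sG.
  have -> : jet 1 G = linear_form (fun k => 'D_(unitv R k) G 0).
    by apply/funext => u; rewrite jetS.
  by rewrite linear_form_derive mul1r -[RHS]/(dcst e G 0) dcst_sum.
have sD k : smooth W ('D_(unitv R k) G) by exact: smooth_derive.
have sJ k : smooth setT (jet n.+1 ('D_(unitv R k) G)) by exact: smooth_jet.
have sc k : smooth setT (fun u : rV => u 0 k : R) by exact: smooth_coord.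
have -> : jet n.+2 G = fun u : rV => \sum_k u 0 k * jet n.+1 ('D_(unitv R k) G) u.
  by apply/funext => u; rewrite jetS.
rewrite (derive_sum_fun _ _).2; last first.
  by move=> k; apply: (@smooth_derivable _ _ setT) => //; exact: smoothM.
have E k : 'D_e (fun u : rV => u 0 k * jet n.+1 ('D_(unitv R k) G) u) v =
    e 0 k * jet n.+1 ('D_(unitv R k) G) v + n.+1%:R * (v 0 k * jet n ('D_(unitv R k) ('D_e G)) v).
  rewrite (@derive_mul R rV setT (fun u : rV => u 0 k) _ e v (sc k) (sJ k) I).
  rewrite coord_derive (IH _ (sD k)).
  have C p : W p -> 'D_e ('D_(unitv R k) G) p = 'D_(unitv R k) ('D_e G) p.
    by move=> Wp; exact: (@derive_comm R rV W G oW sG p (unitv R k) e Wp).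
  exact: product_rule_swap (@jet_eq n ('D_e ('D_(unitv R k) G)) ('D_(unitv R k) ('D_e G)) v C).
rewrite (eq_bigr _ (fun k _ => E k)) big_split /= -mulr_sumr -jetS; last exact: smooth_derive.
rewrite -jet_sum // (@jet_eq _ _ ('D_e G)).
  by rewrite -[n.+2]add1n natrD mulrDl mul1r.
by move=> p Wp; rewrite -dcst_sum.
Qed.

(** Differentiating in [v] lowers the order of the jet and brings out its degree ([derive_jet]), so
    at 0 only derivatives of order exactly n survive. An identity of jets valid for all [v] is
    thereby turned into one of partial derivatives at 0. *)
Lemma iderive_jet s n G : smooth W G ->
  iderive (map (@unitv R N) s) (jet n G : _ -> R^o) 0 =
  (n == size s)%:R * n`!%:R * iderive (map (@unitv R N) s) (G : _ -> R^o) 0.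
Proof.
have T := @openT rV.
elim/last_ind: s n G => [|s i IH] n G sG.
  case: n => [|n] /=; first by rewrite !mul1r.
  by rewrite !mul0r /jet /= /dcst /ld derive0.
rewrite !map_rcons !iderive_rcons size_rcons.
case: n => [|n].
  have -> : (fun v : rV => 'D_(unitv R i) (jet 0 G : _ -> R^o) v) = fun=> 0.
    by apply/funext => v; exact: derive_cst.
  by rewrite iderive_zero !mul0r.
have -> : (fun v : rV => 'D_(unitv R i) (jet n.+1 G : _ -> R^o) v) =
    fun v => n.+1%:R * jet n ('D_(unitv R i) G) v.
  by apply/funext => v; exact: derive_jet.
have sD := smooth_derive (unitv R i) sG.
rewrite (iderive_scale T) //; last exact: smooth_jet.
by rewrite IH // eqSS factS natrM; ring.
Qed.

Lemma iderive_taylor m s G : (size s <= m)%N -> smooth W G ->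
  iderive (map (@unitv R N) s) (fun v => \sum_(n < m.+1) (n`!%:R)^-1 * jet n G v : R^o) 0 =
  iderive (map (@unitv R N) s) (G : _ -> R^o) 0.
Proof.
move=> sm sG; have T := @openT rV.
rewrite (iderive_sum T) //; last by move=> n; apply: smoothZ => //; exact: smooth_jet.
have sm' : (size s < m.+1)%N by [].
rewrite (bigD1 (Ordinal sm')) //= big1 ?addr0 => [|n ns].
  rewrite (iderive_scale T) //; last exact: smooth_jet.
  by rewrite iderive_jet // eqxx mul1r mulrA mulVf ?fact_neq0 // mul1r.
rewrite (iderive_scale T) //; last exact: smooth_jet.
rewrite iderive_jet // (_ : (n : nat) == size s = false) ?mul0r ?mulr0 //.
by apply/negbTE; apply: contra ns => /eqP ns; apply/eqP/val_inj.
Qed.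

End TaylorPolynomial.

(** * Jets transported by the coordinates *)

Section JetsInCoordinates.
Variables (R : realType) (N m : nat) (W W' : set 'rV[R]_N) (B : 'rV[R]_N -> 'M[R]_N).
Hypotheses (oW : open W) (oW' : open W').
Hypothesis sB : forall i k, smooth W (fun y => B y i k).
Variables (th : 'rV[R]_N -> 'rV[R]_N) (x : 'rV[R]_N).
Hypotheses (Wx : W x) (thx : th x = 0) (sth : forall k, smooth W (fun y => th y 0 k : R)).
Hypothesis thW : forall y, W y -> W' (th y).
Hypothesis th_jet : forall j v k, (j <= m)%N ->
  iter j (along B v) (fun y => th y 0 k) x = (j == 1%N)%:R * v 0 k.

Lemma smooth_comp_th G : smooth W' G -> smooth W (fun y => G (th y)).
Proof. by move=> sG; exact: (smooth_comp oW thW). Qed.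

(** Along the frame, [th] behaves up to order m like the straight line v t. After the chain rule and
    Leibniz, any further derivative of the factor coming from [th] is zero, so the frame derivative
    acts on G like the constant field [v]. *)
Lemma iter_along_jet n G v : (n <= m)%N -> smooth W' G ->
  iter n (along B v) (fun y => G (th y)) x = jet n G v.
Proof.
have W'0 : W' 0 by rewrite -thx; exact: thW.
have dv := along_derivation oW sB v.
elim: n G => [|n IH] G nm sG; first by rewrite /jet /= thx.
rewrite iterSr.
have Dk k : smooth W' ('D_(unitv R k) G) by exact: smooth_derive.
transitivity (iter n (along B v) (fun y => \sum_k 1 *
    (along B v (fun z => th z 0 k) y * 'D_(unitv R k) G (th y))) x).
  apply: (iter_der_eq dv) => // y Wy.
  have [_ E] := @chain_rule R _ N G th y (v *m B y)
    (fun i => smooth_differentiable (sth i) Wy) (smooth_differentiable sG (thW Wy)).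
  by rewrite /along /ld E; apply: eq_bigr => k _; rewrite mul1r.
have sa k : smooth W (along B v (fun z => th z 0 k)) by exact: (der_smooth dv).
rewrite (iter_der_sum oW dv) //; last first.
  by move=> k; apply: smoothM => //; exact: (smooth_comp_th (Dk k)).
rewrite (jetS oW' W'0) //; apply: eq_bigr => k _; rewrite mul1r.
rewrite (iter_der_mul oW dv) //; last exact: (smooth_comp_th (Dk k)).
rewrite big_ord_recl big1 ?addr0 => [|i _].
  have := @th_jet 1 v k (leq_ltn_trans (leq0n n) nm).
  by rewrite /= bin0 !mul1r subn0 => ->; rewrite (IH _ (ltnW nm) (Dk k)).
rewrite -iterSr th_jet ?mul0r ?mulr0 //.
exact: leq_ltn_trans (ltn_ord i) nm.
Qed.

End JetsInCoordinates.

(** * Functions of given weighted order *)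

Section WeightedOrder.
Variables (R : realType) (d N : nat) (Is : 'I_N -> seq 'I_d).
Variable W : set 'rV[R]_N.
Hypotheses (oW : open W) (W0 : W 0).

Definition weight_ge n (g : 'rV[R]_N -> R) := forall s, (wdeg Is s < n)%N ->
  iderive (map (@unitv R N) s) (g : _ -> R^o) 0 = 0.

Lemma wdeg_rcons s i : wdeg Is (rcons s i) = (wdeg Is s + size (Is i))%N.
Proof. by rewrite /wdeg -cats1 big_cat big_seq1. Qed.

(** The innermost derivative falls on [g], which lowers the bound by the weight of its direction, or
    on [h], which leaves it unchanged; both fit the induction on [s]. *)
Lemma weight_ge_mul n g h : smooth W g -> smooth W h -> weight_ge n g ->
  weight_ge n (fun p => g p * h p).
Proof.
move=> sg sh wg s; elim/last_ind: s n g h sg sh wg => [|s i IH] n g h sg sh wg sn.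
  by rewrite /= (wg [::] sn : g 0 = 0) mul0r.
rewrite map_rcons iderive_rcons.
rewrite wdeg_rcons in sn.
have sDg := smooth_derive (unitv R i) sg; have sDh := smooth_derive (unitv R i) sh.
have E : forall p, W p -> 'D_(unitv R i) (fun p => g p * h p : R^o) p =
    'D_(unitv R i) g p * h p + g p * 'D_(unitv R i) h p.
  by move=> p Wp; exact: derive_mul sg sh Wp.
rewrite (iderive_eq oW (g := fun p => 'D_(unitv R i) g p * h p + g p * 'D_(unitv R i) h p)) //.
rewrite (iderive_add oW) //; [|exact: smoothM|exact: smoothM].
rewrite (IH (n - size (Is i))%N ('D_(unitv R i) g) h) //; last by lia.
  by rewrite (IH n g ('D_(unitv R i) h)) ?addr0 //; lia.
move=> s' s'n; rewrite -iderive_rcons -map_rcons; apply: wg.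
by rewrite wdeg_rcons; move: s'n; rewrite ltn_subRL addnC.
Qed.

Lemma weight_ge_sum n (I : Type) (r : seq I) (F : I -> 'rV[R]_N -> R) :
  (forall i, smooth W (F i)) -> (forall i, weight_ge n (F i)) ->
  weight_ge n (fun p => \sum_(i <- r) F i p).
Proof.
move=> sF wF s sn; rewrite (iderive_sum oW) // big1 // => i _; exact: wF.
Qed.

End WeightedOrder.

(** * Approximation of the given fields by the left-invariant ones *)

Section Approximation.
Variables (R : realType) (d m N : nat) (Is : 'I_N -> seq 'I_d).
Hypothesis gb : graded_basis R m Is.
Variable U : set 'rV[R]_N.
Hypothesis oU : open U.
Variable F : 'I_d -> 'rV[R]_N -> 'rV[R]_N.
Hypothesis sF : forall i, sfield U (F i).
Local Notation rhoF := (rho (fun i => ld (F i))).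
Local Notation B := (frame Is F).
Local Notation L := (Lc Is).
Let dF i : derivation_on U (ld (F i)) := sfield_derivation oU (sF i).

Lemma iter_along_rho n K v f x : (n * m <= K)%N -> smooth U f -> U x ->
  iter n (along B v) f x = rhoF K (L v ^+ n) f x.
Proof.
move=> nK sf Ux; rewrite (rho_exp oU dF sf Ux (supp_Lc gb v) nK).
elim: n {nK} x Ux => //= n IH x Ux.
have dv := along_derivation oU (smooth_frame Is oU sF) v.
rewrite (der_eq dv IH Ux); apply: (ld_frame gb oU sF) => //.
by elim: n {IH} => //= n IH; exact: (rho_smooth oU dF).
Qed.

Lemma iter_along_rho_gen n K j v f x : (n * m < K)%N -> smooth U f -> U x ->
  iter n (along B v) (ld (F j) f) x = rhoF K (L v ^+ n * ncgen R j) f x.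
Proof.
move=> nK sf Ux.
have sf' := der_smooth (dF j) sf.
rewrite (iter_along_rho v (leqnn _) sf' Ux).
rewrite (rho_mul oU dF sf Ux (suppX (supp_Lc gb v)) (@supp_gen R d j)) ?addn1 //.
by apply: (rho_eq dF) => // y Uy; rewrite (rho_gen oU dF).
Qed.

Lemma is_derive_seq_sum (I : Type) (r : seq I) (f : I -> R -> R) (f' : I -> R) (t : R) :
  (forall i, is_derive t (1 : R) (f i) (f' i)) ->
  is_derive t (1 : R) (fun s => \sum_(i <- r) f i s) (\sum_(i <- r) f' i).
Proof.
move=> H; elim: r => [|i r IH].
  rewrite big_nil (_ : (fun s => _) = cst 0); first exact: is_derive_cst.
  by apply/funext => s; rewrite big_nil.
rewrite big_cons (_ : (fun s => _) = f i + (fun s => \sum_(j <- r) f j s)).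
  exact: is_deriveD.
by apply/funext => s; rewrite big_cons.
Qed.

Lemma rho_curve K (g : R -> nc R d) g' f x : cder g g' ->
  is_derive (0 : R) (1 : R) (fun t => rhoF K (g t) f x) (rhoF K g' f x).
Proof.
move=> H; apply: is_derive_seq_sum => w; set k := wop _ w f x.
have := is_deriveM (H w) (is_derive_cst k (0 : R) (1 : R)).
rewrite scaler0 add0r [_ *: _]mulrC; exact.
Qed.

Variable x : 'rV[R]_N.
Hypothesis Ux : U x.
Variable th : 'rV[R]_N -> 'rV[R]_N.
Hypothesis sth : forall k, smooth U (fun y => th y 0 k : R).
Hypothesis th_jet : forall n v k, (n <= m)%N ->
  iter n (along B v) (fun y => th y 0 k) x = (n == 1%N)%:R * v 0 k.

(** The jet condition makes the action of L(v + t z)^(n+1) on [th] linear in v + t z for n = 0 and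
    zero otherwise; the claim is its derivative at t = 0. *)
Lemma rho_dpow n K v z k : (n < m)%N -> (n.+1 * m <= K)%N ->
  rhoF K (dpow n.+1 (L v) (L z)) (fun y => th y 0 k) x = (n == 0%N)%:R * z 0 k.
Proof.
move=> nm nK.
have H1 := rho_curve K (fun y => th y 0 k) x (cderX n.+1 (cder_line (L v) (L z))).
move: H1; cbv beta; rewrite scale0r addr0 => H1.
have E : (fun t : R => rhoF K ((L v + t *: L z) ^+ n.+1) (fun y => th y 0 k) x) =
    (fun t : R => (n == 0%N)%:R * v 0 k + t *: ((n == 0%N)%:R * z 0 k)).
  apply/funext => t; rewrite -LcZ -LcD -(iter_along_rho _ nK (sth k) Ux) th_jet //.
  by rewrite eqSS !mxE /GRing.scale /=; ring.
have H2 : is_derive (0 : R) (1 : R)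
    (fun t : R => (n == 0%N)%:R * v 0 k + t *: ((n == 0%N)%:R * z 0 k)) ((n == 0%N)%:R * z 0 k).
  have D := is_deriveD (is_derive_cst ((n == 0%N)%:R * v 0 k) (0 : R) (1 : R))
    (is_deriveM (is_derive_id (0 : R) (1 : R)) (is_derive_cst ((n == 0%N)%:R * z 0 k) (0 : R) (1 : R))).
  move: D; rewrite add0r scaler0 add0r [_ *: 1]mulr1; exact.
by rewrite -(@derive_val _ _ _ _ _ _ _ H1) E (@derive_val _ _ _ _ _ _ _ H2).
Qed.

Variables (c : nat -> R) (j : 'I_d) (bj : 'rV[R]_N).
Hypotheses (Hc : dexp_inverse m c) (Hbj : L bj = ncgen R j).
Local Notation eta := (eta gb c bj).
Local Notation Xi := (Xi gb c j bj).

(** The cut-off bounds the degree of exp(L v) b_j: at most m factors of degree at most m, and one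
    letter. In the part subtracted in [Xi], only the first-order term acts nontrivially on [th], and
    it yields [eta]. *)
Lemma taylor_discrepancy k v :
  \sum_(n < m.+1) (n`!%:R)^-1 * iter n (along B v) (ld (F j) (fun y => th y 0 k)) x =
  rhoF (m * m).+1 (Xi v) (fun y => th y 0 k) x + eta v 0 k.
Proof.
have m0 : (0 < m)%N by have /andP[/leq_trans H1 /H1] := size_Is gb k.
rewrite /Xi rhoB.
have -> : rhoF (m * m).+1 (ncexp m (L v) * ncgen R j) (fun y => th y 0 k) x =
    \sum_(n < m.+1) (n`!%:R)^-1 * iter n (along B v) (ld (F j) (fun y => th y 0 k)) x.
  rewrite /ncexp mulr_suml rho_sum; apply: eq_bigr => n _.
  rewrite -scalerAl rhoZ -iter_along_rho_gen //.
  by rewrite ltnS leq_mul2r -ltnS ltn_ord orbT.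
rewrite rho_sum.
have -> : \sum_(n < m) rhoF (m * m).+1 ((n.+1)`!%:R^-1 *: dpow n.+1 (L v) (L (eta v)))
    (fun y => th y 0 k) x = eta v 0 k.
  have E (n : 'I_m) : rhoF (m * m).+1 ((n.+1)`!%:R^-1 *: dpow n.+1 (L v) (L (eta v)))
    (fun y => th y 0 k) x = (n.+1)`!%:R^-1 * ((val n == 0%N)%:R * eta v 0 k).
    by rewrite rhoZ rho_dpow // ltnW // ltnS leq_mul2r ltn_ord orbT.
  rewrite (eq_bigr _ (fun n _ => E n)) (bigD1 (Ordinal m0)) //= factS fact0 invr1 !mul1r.
  rewrite big1 ?addr0 // => n n0.
  rewrite (_ : (n : nat) == 0%N = false) ?mul0r ?mulr0 //.
  by apply/negbTE; apply: contra n0 => /eqP n0; apply/eqP/val_inj.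
by rewrite subrK.
Qed.

(** The jet condition at order 1 says that the Jacobian inverts the frame. For m = 0 it does not
    reach order 1, hence the alternative. *)
Lemma frame_jac : frame Is F x *m jac th x = 1%:M \/ m = 0%N.
Proof.
case: (posnP m) => [->|m0]; [by right|left].
apply/matrixP => i k; rewrite !mxE.
have := @th_jet 1 (unitv R i) k m0; rewrite eqxx mul1r mxE eq_sym => <-.
rewrite /= /along /ld (_ : unitv R i *m B x = \sum_l B x i l *: unitv R l); last first.
  by rewrite unitvE -rowE [LHS]unitv_sum; apply: eq_bigr => l _; rewrite mxE.
rewrite (derive_sum_dir (sth k) Ux); apply: eq_bigr => l _.
by congr (_ * _); rewrite mxE.
Qed.

Variables (W W' : set 'rV[R]_N) (psi : 'rV[R]_N -> 'rV[R]_N).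
Hypotheses (oW : open W) (oW' : open W') (WU : W `<=` U) (Wx : W x) (thx : th x = 0).
Hypothesis thW : forall y, W y -> W' (th y) /\ psi (th y) = y.
Hypothesis psiW : forall p, W' p -> W (psi p) /\ th (psi p) = p.
Hypothesis spsi : forall i, smooth W' (fun p => psi p 0 i : R).

(* By [taylor_discrepancy], up to order [m] this is the image under [rhoF] of [Xi], whose
   coefficients have weight at least [m]. *)
Definition discrepancy k (p : 'rV[R]_N) : R :=
  ld (F j) (fun y => th y 0 k) (psi p) - eta p 0 k.

Lemma smooth_discrepancy k : smooth W' (discrepancy k).
Proof.
apply: smoothB => //.
  apply: (smooth_comp oW' (B := U) _ (der_smooth (dF j) (sth k)) spsi) => p W'p.
  by apply: WU; have [] := psiW W'p.
by apply: (@smooth_sub _ _ W' setT) => //; exact: smooth_Zc.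
Qed.

(** A derivative of weight below m has order at most m, so it only sees the Taylor polynomial of
    degree m. By [taylor_discrepancy] this polynomial is [eta] plus the action of [Xi]; the former
    cancels and the latter has no derivative of weight below m. *)
Lemma weight_discrepancy k : weight_ge Is m (discrepancy k).
Proof.
move=> s sm; have T := @openT 'rV[R]_N.
have W'0 : W' 0 by rewrite -thx; have [] := thW Wx.
(* Each coordinate has weight at least 1, so the order does not exceed the weight. *)
have ss : (size s <= m)%N.
  apply: leq_trans (ltnW sm); rewrite /wdeg -sum1_size; apply: leq_sum => i _.
  by have /andP[] := size_Is gb i.
pose h := ld (F j) (fun y => th y 0 k).
have sh : smooth U h by exact: der_smooth (dF j) _ (sth k).
have sG : smooth W' (fun p => h (psi p)).
  apply: (smooth_comp oW' (B := U) _ sh spsi) => p W'p.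
  by apply: WU; have [] := psiW W'p.
have seta : smooth setT (fun p => eta p 0 k) by exact: smooth_Zc.
have sE : smooth W' (fun p => - 1 * eta p 0 k).
  by apply: smoothZ => //; apply: smooth_sub seta.
rewrite (iderive_eq oW' (g := fun p => h (psi p) + - 1 * eta p 0 k)) //; last first.
  by move=> p _; rewrite mulN1r.
rewrite (iderive_add oW') // -(iderive_taylor oW' W'0 ss sG).
have sBW i l : smooth W (fun y => B y i l).
  by apply: smooth_sub WU _; exact: smooth_frame.
have dv v : derivation_on W (along B v) by exact: along_derivation.
have EJ v : \sum_(n < m.+1) (n`!%:R)^-1 * jet n (fun p => h (psi p)) v =
    rhoF (m * m).+1 (Xi v) (fun y => th y 0 k) x + eta v 0 k.
  rewrite -taylor_discrepancy; apply: eq_bigr => n _; congr (_ * _).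
  rewrite -(iter_along_jet oW oW' sBW Wx thx (fun i => smooth_sub WU (sth i))
    (fun y Wy => (thW Wy).1) th_jet) //; last by rewrite -ltnS.
  by apply: (iter_der_eq (dv v)) => // y Wy; rewrite (thW Wy).2.
rewrite (iderive_eq T (g := fun v => rhoF (m * m).+1 (Xi v) (fun y => th y 0 k) x + eta v 0 k)) //.
have sX w : smooth setT (fun v => Xi v w * wop (fun i => ld (F i)) w (fun y => th y 0 k) x).
  by apply: smoothM => //; [exact: ncsmooth_Xi|exact: smooth_cst].
have sR : smooth setT (fun v => rhoF (m * m).+1 (Xi v) (fun y => th y 0 k) x).
  exact: smooth_sum.
rewrite (iderive_add T) //.
have -> : iderive [seq unitv R i | i <- s] (fun v => rhoF (m * m).+1 (Xi v) (fun y => th y 0 k) x : R^o) 0 = 0.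
  rewrite (iderive_sum T) // big1 // => w _.
  set q := wop _ w _ x.
  rewrite (iderive_eq T (g := fun v => q * Xi v w)) //; last by move=> v _; rewrite mulrC.
  by rewrite (iderive_scale T) ?(iderive_Xi gb Hc Hbj) ?mulr0 //; exact: ncsmooth_Xi.
rewrite add0r (iderive_scale oW') // ?mulN1r ?subrr //.
exact: smooth_sub seta.
Qed.

(** The remainder is known in the coordinate frame, whereas local degree refers to the
    left-invariant frame. The matrix [Y] of the latter is the identity at 0, and multiplication by
    its smooth inverse preserves weight >= m. *)
Lemma approximation_degree : (0 < m)%N ->
  local_degree_le m Is 0 (fun p => 'D_(F j (psi p)) th (psi p) - Yfield m Is (@tgen R d j) p).
Proof.
move=> m0; have T := @openT 'rV[R]_N.
have W'0 : W' 0 by rewrite -thx; have [] := thW Wx.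
pose Y (p : 'rV[R]_N) : 'M[R]_N := \matrix_(i, k) Zc gb c p (unitv R i) 0 k.
have sY i k : smooth setT (fun p => Y p i k).
  by apply: (smooth_eq T _ (smooth_Zc gb c (unitv R i) k)) => p _; rewrite mxE.
(* The left-invariant fields are only required to form a frame near 0, so the neighborhood is cut
   down to where [Y] is invertible. *)
pose V := W' `&` [set p | \det (Y p) != 0].
have oV : open V.
  apply: openI => //.
  apply: (@open_comp _ _ (fun p => \det (Y p)) [set z | z != 0]); last exact: open_neq.
  by move=> p _; apply: (smooth_continuous (smooth_det T sY)).
have Y0 : Y 0 = 1%:M.
  by apply/matrixP => i k; rewrite mxE Zc0 ?Hc.1 // !mxE eq_sym.
have V0 : V 0 by split => //=; rewrite Y0 det1 oner_neq0.
have uY p : V p -> Y p \in unitmx by move=> [_ /= ?]; rewrite unitmxE unitfE.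
have VW : V `<=` W' by move=> p [].
pose r (p : 'rV[R]_N) : 'rV[R]_N := \row_k discrepancy k p.
exists V, (fun i p => (r p *m invmx (Y p)) 0 i); split=> //.
- move=> i; apply: smooth_smooth_on; apply: smooth_mulmx => // k l.
    by apply: (smooth_eq oV _ (smooth_sub VW (smooth_discrepancy l))) => p _; rewrite mxE.
  by apply: smooth_invmx => // k' l'; apply: smooth_sub (sY k' l').
- move=> p Vp; have [W'p _] := Vp.
  have -> : 'D_(F j (psi p)) th (psi p) - Yfield m Is (@tgen R d j) p = r p.
    have -> : @tgen R d j = L bj.
      by rewrite Hbj; apply/funext => w; rewrite /tgen /ncgen; case: ifP.
    rewrite (YfieldE gb _ _ Hc); apply/rowP => k; rewrite !mxE.
    have Up : U (psi p) by apply: WU; have [] := psiW W'p.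
    have [_ ->] := @row_derive R _ N th (psi p) (F j (psi p))
      (fun i => @smooth_derivable _ _ U _ _ _ (sth i) Up).
    by [].
  rewrite -[LHS](mulmxKV (uY p Vp)) mulmx_sum_row; apply: eq_bigr => i _; congr (_ *: _).
  rewrite (brY_Is gb) -Lc_unitv (YfieldE gb _ _ Hc).
  by apply/rowP => k; rewrite !mxE.
(* A term of positive degree has weight below [size (Is i)], hence below m, where the coefficient
   has zero derivatives. *)
move=> i s; apply: contraNT; rewrite -ltNge => H.
have sm : (wdeg Is s < m)%N.
  have /andP[_ Hi] := size_Is gb i; apply: leq_trans Hi.
  by move: H; lia.
have sI k : smooth V (fun p => invmx (Y p) k i).
  by apply: smooth_invmx => // k' l'; apply: smooth_sub (sY k' l').
have sD k : smooth V (discrepancy k) by apply: smooth_sub VW _; exact: smooth_discrepancy.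
rewrite (iderive_eq oV (g := fun p => \sum_k discrepancy k p * invmx (Y p) k i)) //; last first.
  by move=> p _; rewrite mxE; apply: eq_bigr => k _; rewrite mxE.
have V0' : V 0 by [].
apply/eqP; apply: (weight_ge_sum oV V0') sm => k; first exact: smoothM.
by apply: (weight_ge_mul oV V0') => //; exact: weight_discrepancy.
Qed.

End Approximation.

(** * Smoothness of vector-valued maps, and the degenerate dimension *)

Section RowSmoothness.
Variable R : realType.

Lemma iderive_row (V : normedModType R) (A : set V) n (f : V -> 'rV[R]_n) : open A ->
  (forall k, smooth A (fun x => f x 0 k : R)) -> forall vs x, A x ->
  iderive vs f x = \row_k iderive vs (fun y => f y 0 k : R^o) x.
Proof.
move=> oA sf; elim=> [|v vs IH] x Ax /=.
  by apply/rowP => k; rewrite mxE.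
have -> : 'D_v (iderive vs f) x = 'D_v (fun y => \row_k iderive vs (fun z => f z 0 k : R^o) y) x.
  by apply: near_eq_derive; exact: near_open oA Ax IH.
have E k : (fun y => (\row_k iderive vs (fun z => f z 0 k : R^o) y : 'rV[R]_n) 0 k : R) =
    iderive vs (fun z => f z 0 k : R^o) by apply/funext => y; rewrite mxE.
have D k : derivable (fun y => (\row_k iderive vs (fun z => f z 0 k : R^o) y : 'rV[R]_n) 0 k : R) x v.
  by rewrite E; apply: smooth_derivable Ax; exact: smooth_iderive.
have [_ Dk] := row_derive D.
by apply/rowP => k; rewrite Dk E mxE.
Qed.

Lemma row_smooth_on (V : normedModType R) (A : set V) n (f : V -> 'rV[R]_n) : open A ->
  (forall k, smooth A (fun x => f x 0 k : R)) -> smooth_on A f.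
Proof.
move=> oA sf vs; have I := iderive_row oA sf vs.
have E k : (fun y => (\row_k iderive vs (fun z => f z 0 k : R^o) y : 'rV[R]_n) 0 k : R) =
    iderive vs (fun z => f z 0 k : R^o) by apply/funext => y; rewrite mxE.
have si k := smooth_iderive vs (sf k).
have I' x : A x -> \forall y \near x,
    \row_k iderive vs (fun z => f z 0 k : R^o) y = iderive vs f y.
  by move=> Ax; apply: near_open oA Ax _ => y Ay; rewrite I.
split=> [x Ax|v x Ax].
  apply: continuous_near_eq (I' x Ax) _; apply: row_continuous => k; rewrite E.
  exact: smooth_continuous Ax.
apply: near_eq_derivable (I' x Ax) _.
have D k : derivable (fun y => (\row_k iderive vs (fun z => f z 0 k : R^o) y : 'rV[R]_n) 0 k : R) x v.
  by rewrite E; exact: smooth_derivable Ax.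
exact: (row_derive D).1.
Qed.

Lemma smooth_on_coord (V : normedModType R) (A : set V) n (f : V -> 'rV[R]_n) k : open A ->
  smooth_on A f -> smooth_on A (fun x => f x 0 k : R^o).
Proof.
move=> oA sf.
have I vs x : A x -> iderive vs (fun y => f y 0 k : R^o) x = iderive vs f x 0 k.
  elim: vs x => //= v vs IH x Ax.
  rewrite (near_eq_derive v (near_open oA Ax IH)) derive_mx; last exact: (sf vs).2.
  by rewrite mxE.
have I' vs x : A x -> \forall y \near x, iderive vs f y 0 k = iderive vs (fun y => f y 0 k : R^o) y.
  by move=> Ax; apply: near_open oA Ax _ => y Ay; rewrite I.
move=> vs; split=> [x Ax|v x Ax].
  apply: continuous_near_eq (I' vs x Ax) _.
  have c1 : iderive vs f @ x --> iderive vs f x by exact: (sf vs).1.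
  have c2 : (fun u : 'rV[R]_n => u 0 k : R) @ iderive vs f x --> (iderive vs f x 0 k : R).
    by apply: differentiable_continuous; exact: differentiable_coord.
  exact: (cvg_comp _ _ c1 c2).
apply: near_eq_derivable (I' vs x Ax) _.
by have /derivable_mxP /(_ 0 k) := (sf vs).2 v x Ax.
Qed.

(** Iterated derivatives of the slice are those of the joint map in the directions (v, 0). *)
Lemma smooth_on_slice (V V' W : normedModType R) (A : set V) (T : set V')
    (F : V * V' -> W) y : T y -> smooth_on (A `*` T) F -> smooth_on A (fun x => F (x, y)).
Proof.
move=> Ty sF.
have H (x v : V) (h : R) : (h *: v + x, y) = h *: (v, 0) + (x, y) :> V * V'.
  by congr (_, _); rewrite /= scaler0 add0r.
have I vs : iderive vs (fun x => F (x, y)) = fun x => iderive [seq (v, 0) | v <- vs] F (x, y).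
  elim: vs => //= v vs ->; apply/funext => x.
  exact: (@derive_along R _ _ _ _ (fun x => (x, y)) x v (v, 0) (H x v)).1.
move=> vs; rewrite I; split=> [x Ax|v x Ax].
  have c1 : (fun x : V => (x, y)) @ x --> (x, y) by apply: cvg_pair; [exact: cvg_id|exact: cvg_cst].
  have c2 := (sF [seq (v, 0) | v <- vs]).1 (x, y) (conj Ax Ty).
  exact: (cvg_comp _ _ c1 c2).
apply/(@derive_along R _ _ _ _ (fun x => (x, y)) x v (v, 0) (H x v)).2.
by apply: (sF _).2.
Qed.

Lemma unitmx_dim0 N (M : 'M[R]_N) : N = 0%N -> M \in unitmx.
Proof. by case: N M => // M _; rewrite unitmxE det_mx00 unitr1. Qed.

Lemma graded_basis_dim0 d m N (Is : 'I_N -> seq 'I_d) : graded_basis R m Is -> m = 0%N -> N = 0%N.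
Proof.
move=> gb m0; case: N Is gb => // N Is gb.
by have := size_Is gb ord0; rewrite m0; case: (Is ord0).
Qed.

End RowSmoothness.

Theorem theorem3p4 (R : realType) (d m N q : nat)
  (Is : 'I_N -> seq 'I_d)
  (U0 : set 'rV[R]_N) (T0 : set 'rV[R]_q)
  (X : 'I_d -> 'rV[R]_q -> 'rV[R]_N -> 'rV[R]_N) :
  graded_basis R m Is ->
  open U0 -> U0 0 -> open T0 -> T0 0 ->
  (forall j, smooth_on (U0 `*` T0) (fun z : 'rV[R]_N * 'rV[R]_q => X j z.2 z.1)) ->
  (forall x y, U0 x -> T0 y -> comm_span_all m (fun j => X j y) x) ->
  exists (V : set 'rV[R]_N) (U : set 'rV[R]_N) (T : set 'rV[R]_q)
         (Theta : 'rV[R]_q -> 'rV[R]_N -> 'rV[R]_N -> 'rV[R]_N),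
    [/\ (open V /\ V 0) /\ (open U /\ U 0 /\ U `<=` U0) /\ (open T /\ T 0 /\ T `<=` T0),
        (forall y, T y ->
           smooth_on (U `*` U)
             (fun z : 'rV[R]_N * 'rV[R]_N => Theta y z.1 z.2) /\
           forall x x1, U x -> U x1 -> V (Theta y x x1)),
        (* (a) *)
        (forall y x x1, T y -> U x -> U x1 ->
           Theta y x1 x = ginv (Theta y x x1) /\ Theta y x x = 0) &
        (* (b) and (c) *)
        (forall x y, U x -> T y ->
           exists (W W' : set 'rV[R]_N) (psi : 'rV[R]_N -> 'rV[R]_N),
             [/\ (open W /\ W x /\ W `<=` U) /\ (open W' /\ W' 0),
                 (forall x1, W x1 -> W' (Theta y x x1) /\ psi (Theta y x x1) = x1),
                 (forall p, W' p -> W (psi p) /\ Theta y x (psi p) = p),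
                 smooth_on W (Theta y x) /\ smooth_on W' psi &
                 forall j : 'I_d,
                   local_degree_le m Is 0
                     (fun p => 'D_(X j y (psi p)) (Theta y x) (psi p)
                               - Yfield m Is (@tgen R d j) p)])].
Proof.
move=> gb oU U00 oT T00 sX span.
pose F y j := X j y.
have sF y j : T0 y -> sfield U0 (F y j).
  move=> Ty k; apply: (smooth_on_smooth oU); apply: (smooth_on_coord _ oU).
  exact: (smooth_on_slice Ty (sX j)).
pose B y := frame Is (F y).
have coord y : exists Th : 'rV[R]_N -> 'rV[R]_N -> 'rV[R]_N, T0 y ->
  [/\ forall k, smooth (U0 `*` U0) (fun z : 'rV[R]_N * 'rV[R]_N => Th z.1 z.2 0 k : R),
      forall x x1, Th x1 x = - Th x x1 &
      forall j v x k, (j <= m)%N -> U0 x ->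
        iter j (along (B y) v) (fun x1 => Th x x1 0 k) x = (j == 1%N)%:R * v 0 k].
  (* The choice below needs a map for every [y]; outside [T0] the zero map is a default. *)
  case: (pselect (T0 y)) => [Ty|nTy]; last by exists (fun _ _ => 0).
  have sB := smooth_frame Is oU (fun j => sF y j Ty).
  have uB x : U0 x -> B y x \in unitmx.
    by move=> Ux; apply: (frame_unit gb oU (fun j => sF y j Ty) Ux); exact: span.
  by have [Th H] := canonical_coordinates oU sB uB m; exists Th.
have [Th HTh] := choice coord.
have Txx y x : T0 y -> Th y x x = 0.
  move=> /HTh[_ anti _]; apply/rowP => k; rewrite mxE.
  have /rowP/(_ k) := anti x x; rewrite [RHS]mxE => /eqP.
  by rewrite -addr_eq0 -mulr2n mulrn_eq0 => /eqP.
(* The coordinates come from a formula valid on all of [U0] rather than from inverting a flow, so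
   the neighborhoods do not shrink; shrinking occurs only in [W] and [W']. *)
exists setT, U0, T0, Th; split=> //.
- by do !split => //; exact: openT.
- move=> y Ty; split=> //; have [sTh _ _] := HTh y Ty.
  by apply: row_smooth_on => //; exact: open_prod.
- by move=> y x x1 Ty _ _; split; [have [_ anti _] := HTh y Ty; exact: anti|exact: Txx].
move=> x y Ux Ty; have [sTh _ jets] := HTh y Ty.
have sth k : smooth U0 (fun x1 => Th y x x1 0 k : R) by exact: (smooth_slice2 Ux (sTh k)).
have sFy j := sF y j Ty.
have tjet n v k : (n <= m)%N ->
    iter n (along (B y) v) (fun x1 => Th y x x1 0 k) x = (n == 1%N)%:R * v 0 k.
  by move=> nm; exact: jets.
have uj : jac (Th y x) x \in unitmx.
  have [E|m0] := frame_jac Ux sth tjet; first by have [] := mulmx1_unit E.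
  by apply: unitmx_dim0; exact: graded_basis_dim0 gb m0.
have [W [W' [psi [[oW [Wx WU]] [oW' W'0] WP psiP spsi]]]] := inverse_function oU sth Ux uj.
rewrite Txx // in W'0.
exists W, W', psi; split=> //.
  split; apply: row_smooth_on => // k; exact: smooth_sub WU (sth k).
(* For m = 0 the basis is empty and N = 0, so every sum and every vector is trivial; for m > 0 the
   generator itself has coordinates [bj]. *)
move=> j; case: (posnP m) => [m0|m0].
  have noI (i : 'I_N) : False by have := size_Is gb i; rewrite m0; case: (Is i).
  exists setT, (fun i _ => 0); split=> //; first exact: openT.
  - by move=> p _; apply/rowP => i; case: (noI i).
have [c Hc] := dexpc_inverse R m.
have [bj Hbj] := lie_Lc gb (isT : [:: j] != [::]) m0.
exact: (approximation_degree gb oU sFy Ux sth tjet Hc (esym Hbj) oW oW' WU Wx (Txx y x Ty) WP psiP spsi m0).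
Qed.
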